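(* Let $\alpha>0$ and $d_1,d_2,d_3\in\mathbb{R}$. Up to topological equivalence, the global dynamics of system (D) has, and only has, the following $6$ different topological phase portraits in $\mathbb{R}^3_+$. (i) When $\alpha+d_i>0$ for $i=1,2,3$: the global attractor $\mathbb{S}^2_+$ consists of the periodic orbits $\Gamma(h)=\mathbb{S}^2_+\cap\Lambda_1(h)$, $h\in(h^*,\infty)$, the positive equilibrium $Q^*$ and the heteroclinic polycycle $\partial\mathbb{S}^2_+$. Further, $\omega_d(x)=\Gamma(h)$ if $x\in\Lambda_1(h)$ for any $h\in(h^*,\infty)$; $\omega_d(x)=\{Q^*\}$ if $x\in\mathcal{L}(Q^* )$; and $\omega_d(x)$ is one of $\{\mathbf e_1\},\{\mathbf e_2\},\{\mathbf e_3\}$ if $x\in\partial\mathbb{R}^3_+\setminus\{O\}$. (ii) When $\alpha+d_1<0$, $\alpha+d_2>0$, $\alpha+d_3<0$: on $\mathbb{S}^2_+$, $\mathbf e_1$ is a stable node, $\mathbf e_3$ is an unstable node, $\mathbf e_2$ is a saddle, and the orbits from $\mathbf e_3$ except $\Gamma_{23}$ go to $\mathbf e_1$. Further, $\omega_d(x)=\{\mathbf e_1\}$ if $x\in\mathrm{Int}\,\mathbb{R}^3_+$, and $\omega_d(x)$ is one of $\{\mathbf e_1\},\{\mathbf e_2\},\{\mathbf e_3\}$ for any $x\in\partial\mathbb{R}^3_+\setminus\{O\}$. (iii.a) When $\alpha+d_1=0$, $\alpha+d_2>0$, $\alpha+d_3>0$: $\mathbb{S}^2_+$ consists of infinitely many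 heteroclinic orbits on $\mathrm{Int}\,\mathbb{S}^2_+$, infinitely many equilibria filling $\Gamma_{12}$, and boundary heteroclinic orbits on $\partial\mathbb{S}^2_+$. Further, $\omega_d(x)$ is (the singleton of) one of the equilibria on $\Gamma_{12}^+$ if $x\in\mathrm{Int}\,\mathbb{R}^3_+$; and $\omega_d(x)=\{\mathbf e_3\}$ or $\omega_d(x)=\{Q\}$ for some $Q\in\Gamma_{12}$ if $x\in\partial\mathbb{R}^3_+\setminus\{O\}$. (iii.b) When $\alpha+d_1>0$, $\alpha+d_2=0$, $\alpha+d_3<0$: $\mathbf e_2$ is a stable node on $\mathbb{S}^2_+$ which attracts all orbits except $\Gamma_{13}$. Moreover, $\omega_d(x)=\{\mathbf e_2\}$ if $x\in\mathrm{Int}\,\mathbb{R}^3_+$; and $\omega_d(x)=\{\mathbf e_2\}$ or $\omega_d(x)=\{Q\}$ for some $Q\in\Gamma_{13}$ if $x\in\partial\mathbb{R}^3_+\setminus\{O\}$. (iv) When $\alpha+d_1=0$, $\alpha+d_2=0$, $\alpha+d_3<0$: $\mathbb{S}^2_+$ consists of heteroclinic orbits on $\mathrm{Int}\,\mathbb{S}^2_+$, infinitely many equilibria filling $\Gamma_{12}$ and $\Gamma_{13}$, and a boundary heteroclinic orbit with endpoints $\mathbf e_3$ and $\mathbf e_2$. Moreover, $\omega_d(x)$ is (the singleton of) one of the equilibria on $\Gamma_{12}$ if $x\in\mathrm{Int}\,\mathbb{R}^3_+$; and $\omega_d(x)=\{Q\}$ for some $Q\in\Gamma_{12}\cup\Gamma_{13}$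 if $x\in\partial\mathbb{R}^3_+\setminus\{O\}$. (v) When $\alpha+d_i=0$ for all $i\in\{1,2,3\}$: $\mathbb{S}^2_+$ consists of equilibria. Moreover, for every $x\in\mathbb{R}^3_+\setminus\{O\}$, $\omega_d(x)=\{Q_x\}$, where $Q_x$ is the unique point of $\mathcal{L}(x)\cap\mathbb{S}^2_+$.
   Context: System (D): $$\begin{aligned}\dot x_1&=x_1(\alpha-\alpha x_1^2-(2\alpha+d_1)x_2^2+d_2x_3^2),\\ \dot x_2&=x_2(\alpha+d_1x_1^2-\alpha x_2^2-(2\alpha+d_3)x_3^2),\\ \dot x_3&=x_3(\alpha-(2\alpha+d_2)x_1^2+d_3x_2^2-\alpha x_3^2).\end{aligned}$$ $\mathbb{R}^3_+=[0,\infty)^3$, $\mathrm{Int}\,\mathbb{R}^3_+=(0,\infty)^3$, $\partial\mathbb{R}^3_+=\mathbb{R}^3_+\setminus\mathrm{Int}\,\mathbb{R}^3_+$; $\mathbb{S}^2_+=\{x\in\mathbb{R}^3_+:\|x\|=1\}$ (invariant under (D)), $\mathrm{Int}\,\mathbb{S}^2_+=\mathbb{S}^2_+\cap\mathrm{Int}\,\mathbb{R}^3_+$, $\partial\mathbb{S}^2_+=\mathbb{S}^2_+\cap\partial\mathbb{R}^3_+$; $O$ is the origin, $\mathbf e_1,\mathbf e_2,\mathbf e_3$ the standard basis vectors. $\Psi(t,x)$ is the flow of (D) and $\omega_d(x)$ is the $\omega$-limit set of $x$. For $i<j$, $\Gamma_{ij}=\{x\in\mathbb{R}^3_+:x_i^2+x_j^2=1,\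 x_k=0\}$ where $k\in\{1,2,3\}\setminus\{i,j\}$. $\mathcal{L}(y)=\{\lambda y:\lambda>0\}$. In case (i), put $s=3\alpha+d_1+d_2+d_3$; $Q^*=(q_1^*,q_2^*,q_3^* )$ with $q_i^*=\sqrt{(\alpha+d_{4-i})/s}$; $H_1(x)=\|x\|^2\prod_{i=1}^3x_i^{-2(\alpha+d_{4-i})/s}$ on $\mathrm{Int}\,\mathbb{R}^3_+$; $\Lambda_1(h)=\{x\in\mathrm{Int}\,\mathbb{R}^3_+:H_1(x)=h\}$; $h^*=H_1(Q^* )=\prod_{i=1}^3\big(\tfrac{\alpha+d_{4-i}}{s}\big)^{-(\alpha+d_{4-i})/s}$. In case (iii.a), $\Gamma_{12}^+=\{x\in\Gamma_{12}:x_1>\bar q_1\}$ with $\bar q_1=\sqrt{(\alpha+d_3)/(2\alpha+d_2+d_3)}$. Topological equivalence: two global dynamics of (D) (for different parameter values) on $\mathbb{S}^2_+$ are topologically equivalent if there is a homeomorphism of $\mathbb{S}^2_+$ sending orbits of one onto orbits of the other, preserving or reversing the direction of the flow. ''Node'', ''saddle'' on $\mathbb{S}^2_+$ refer to the flow restricted to $\mathbb{S}^2_+$. *)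

(* Defs.v *)
From HB Require Import structures.
From mathcomp Require Import all_boot all_order all_algebra.
From mathcomp Require Import all_classical all_reals all_analysis.
From mathcomp Require Import ring lra.

Set Implicit Arguments.
Unset Strict Implicit.
Unset Printing Implicit Defensive.

Import Order.TTheory GRing.Theory Num.Theory.
Import numFieldNormedType.Exports.

Local Open Scope classical_set_scope.
Local Open Scope ring_scope.

(* Coordinates are 0-based: i1, i2, i3 stand for the indices 1, 2, 3. *)
Definition i1 : 'I_3 := @Ordinal 3 0 isT.
Definition i2 : 'I_3 := @Ordinal 3 1 isT.
Definition i3 : 'I_3 := @Ordinal 3 2 isT.

Section Geometry.
Variable R : realType.
Implicit Types x y : 'rV[R]_3.

Definition row3 (a b c : R) : 'rV[R]_3 := \row_i [:: a; b; c]`_i.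

Definition e_ (i : 'I_3) : 'rV[R]_3 := delta_mx 0 i.

(* The library norm on row vectors is the sup norm, hence this one. *)
Definition enorm x : R := Num.sqrt (\sum_i x 0 i ^+ 2).

Definition R3p : set 'rV[R]_3 := [set x | forall i, 0 <= x 0 i].
Definition IntR3p : set 'rV[R]_3 := [set x | forall i, 0 < x 0 i].
Definition bdR3p : set 'rV[R]_3 := R3p `\` IntR3p.
Definition S2p : set 'rV[R]_3 := R3p `&` [set x | enorm x = 1].
Definition IntS2p : set 'rV[R]_3 := S2p `&` IntR3p.
Definition bdS2p : set 'rV[R]_3 := S2p `&` bdR3p.

Definition Gamma (i j : 'I_3) : set 'rV[R]_3 :=
  [set x | [/\ R3p x, x 0 i ^+ 2 + x 0 j ^+ 2 = 1
             & forall k, k != i -> k != j -> x 0 k = 0]].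

Definition ray y : set 'rV[R]_3 := [set l *: y | l in [set l : R | 0 < l]].

End Geometry.

Arguments e_ {R} i.
Arguments R3p {R}.
Arguments IntR3p {R}.
Arguments bdR3p {R}.
Arguments S2p {R}.
Arguments IntS2p {R}.
Arguments bdS2p {R}.
Arguments Gamma {R} i j.

Section Dynamics.
Variable R : realType.
Variables (alpha : R) (d : 'I_3 -> R).
Implicit Types (x y A B : 'rV[R]_3) (gamma : R -> 'rV[R]_3).
Implicit Types (G S X : set 'rV[R]_3).

Definition field_D x : 'rV[R]_3 :=
  let x1 := x 0 i1 in let x2 := x 0 i2 in let x3 := x 0 i3 in
  let d1 := d i1 in let d2 := d i2 in let d3 := d i3 in
  row3
    (x1 * (alpha - alpha * x1 ^+ 2 - (2 * alpha + d1) * x2 ^+ 2 + d2 * x3 ^+ 2))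
    (x2 * (alpha + d1 * x1 ^+ 2 - alpha * x2 ^+ 2 - (2 * alpha + d3) * x3 ^+ 2))
    (x3 * (alpha - (2 * alpha + d2) * x1 ^+ 2 + d3 * x2 ^+ 2 - alpha * x3 ^+ 2)).

Definition equilibrium x := field_D x = 0.

Definition solution (I : interval R) gamma :=
  forall t, t \in I -> is_derive t 1 gamma (field_D (gamma t)).

(* Psi(t, x) = gamma t for all t >= 0. *)
Definition trajectory x gamma := solution `[0, +oo[ gamma /\ gamma 0 = x.

(* The orbit of a complete solution is its range. *)
Definition complete_solution gamma := solution `]-oo, +oo[ gamma.

(* The points lim_n Psi(u_n, x) with u_n -> +oo; if x had no trajectory, the
   set would be empty. *)
Definition omega_limit x : set 'rV[R]_3 :=
  [set y | exists gamma (u : R^nat),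
     [/\ trajectory x gamma, u @ \oo --> +oo & gamma (u n) @[n --> \oo] --> y]].

Definition goes_to x y :=
  exists2 gamma, trajectory x gamma & gamma t @[t --> +oo] --> y.

Definition periodic_orbit G :=
  exists gamma T, [/\ 0 < T, complete_solution gamma,
    forall t, gamma (t + T) = gamma t, ~ equilibrium (gamma 0)
    & G = range gamma].

Definition heteroclinic_orbit A B G :=
  [/\ equilibrium A, equilibrium B, A <> B & exists gamma,
     [/\ complete_solution gamma, gamma t @[t --> -oo] --> A,
         gamma t @[t --> +oo] --> B & G = range gamma]].

Definition heteroclinic_orbit_in S G :=
  (exists A B, heteroclinic_orbit A B G) /\ G `<=` S.

Definition heteroclinic_polycycle S :=
  exists n (v : 'I_n -> 'rV[R]_3) (G : 'I_n -> set 'rV[R]_3),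
    [/\ (1 < n)%N, injective v,
        forall i, heteroclinic_orbit (v i) (v (ordS i)) (G i)
      & S = \bigcup_i (v i |` G i)].

(* S is compact, invariant, and attracts every compact subset of X uniformly. *)
Definition global_attractor X S :=
  [/\ compact S, S !=set0, S `<=` X,
      forall x, S x -> exists gamma,
        [/\ complete_solution gamma, gamma 0 = x & range gamma `<=` S]
    & forall K U, compact K -> K `<=` X -> open U -> S `<=` U ->
        exists T : R, forall x, K x -> exists2 gamma, trajectory x gamma &
          forall t, 0 <= t -> T <= t -> U (gamma t)].

(* l and m are the eigenvalues, with multiplicity, of the linearization of the
   field at x restricted to the tangent plane of the sphere at x: the rows of B
   form a basis of that plane (the orthogonal of x), and M is the matrix of the
   restriction in this basis. *)
Definition tangent_eigenvalues x (l m : R) :=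
  exists (B : 'M[R]_(2, 3)) (M : 'M[R]_2),
    [/\ row_free B, B *m x^T = 0, B *m jacobian field_D x = M *m B
      & char_poly M = ('X - l%:P) * ('X - m%:P)].

Definition stable_node x :=
  equilibrium x /\ exists l m, [/\ tangent_eigenvalues x l m, l < 0 & m < 0].

Definition unstable_node x :=
  equilibrium x /\ exists l m, [/\ tangent_eigenvalues x l m, 0 < l & 0 < m].

Definition saddle x :=
  equilibrium x /\ exists l m, [/\ tangent_eigenvalues x l m, l < 0 & 0 < m].

Definition s_ : R := 3 * alpha + d i1 + d i2 + d i3.

(* rev_ord i is the 0-based form of the index 4 - i. *)
Definition Qstar : 'rV[R]_3 :=
  \row_i Num.sqrt ((alpha + d (rev_ord i)) / s_).

Definition H1 x : R :=
  enorm x ^+ 2 * \prod_i x 0 i `^ (- (2 * (alpha + d (rev_ord i))) / s_).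

Definition Lambda1 (h : R) : set 'rV[R]_3 := IntR3p `&` [set x | H1 x = h].

Definition hstar : R := H1 Qstar.

Definition Gamma_h (h : R) : set 'rV[R]_3 := S2p `&` Lambda1 h.

Definition qbar1 : R :=
  Num.sqrt ((alpha + d i3) / (2 * alpha + d i2 + d i3)).

Definition Gamma12p : set 'rV[R]_3 :=
  Gamma i1 i2 `&` [set x | qbar1 < x 0 i1].

End Dynamics.

(* A homeomorphism of S2p (with inverse g) mapping orbits onto orbits, compatibly
   with the direction of time on all orbits, or reversing it on all orbits. *)
Definition topologically_equivalent (R : realType)
    (alpha : R) (d : 'I_3 -> R) (alpha' : R) (d' : 'I_3 -> R) :=
  exists h g : 'rV[R]_3 -> 'rV[R]_3,
    [/\ {within S2p, continuous h}, {within S2p, continuous g},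
        set_fun S2p S2p h, set_fun S2p S2p g &
    [/\ {in S2p, cancel h g}, {in S2p, cancel g h} &
    let maps_orbits (monotone : (R -> R) -> Prop) :=
      forall gamma, complete_solution alpha d gamma -> range gamma `<=` S2p ->
      exists eta tau,
        [/\ complete_solution alpha' d' eta, monotone tau,
            range tau = setT & forall t, h (gamma t) = eta (tau t)] in
    maps_orbits (fun tau => {homo tau : t u / t < u}) \/
    maps_orbits (fun tau => {homo tau : t u /~ t < u})]].

Inductive portrait : Set :=
  P_i | P_ii | P_iiia | P_iiib | P_iv | P_v.

Definition in_case (R : realType) (c : portrait) (alpha : R) (d : 'I_3 -> R) :=
  let a i := alpha + d i in
  match c with
  | P_i => [/\ 0 < a i1, 0 < a i2 & 0 < a i3]
  | P_ii => [/\ a i1 < 0, 0 < a i2 & a i3 < 0]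
  | P_iiia => [/\ a i1 = 0, 0 < a i2 & 0 < a i3]
  | P_iiib => [/\ 0 < a i1, a i2 = 0 & a i3 < 0]
  | P_iv => [/\ a i1 = 0, a i2 = 0 & a i3 < 0]
  | P_v => [/\ a i1 = 0, a i2 = 0 & a i3 = 0]
  end.

Lemma hstarE (R : realType) (alpha : R) (d : 'I_3 -> R) :
  (forall i, 0 < alpha + d i) ->
  hstar alpha d =
  \prod_i ((alpha + d (rev_ord i)) / s_ alpha d)
    `^ (- (alpha + d (rev_ord i)) / s_ alpha d).
Proof.
move=> ad; have s_sum : \sum_i (alpha + d (rev_ord i)) = s_ alpha d.
  rewrite !big_ord_recl big_ord0 /s_ /=.
  have -> : rev_ord ord0 = i3 by exact: val_inj.
  have -> : rev_ord (lift ord0 ord0) = i2 by exact: val_inj.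
  have -> : rev_ord (lift ord0 (lift ord0 ord0)) = i1 by exact: val_inj.
  by ring.
have s_gt0 : 0 < s_ alpha d.
  by rewrite /s_; have := ad i1; have := ad i2; have := ad i3; lra.
have w_gt0 i : 0 < (alpha + d (rev_ord i)) / s_ alpha d by rewrite divr_gt0.
have norm1 : enorm (Qstar alpha d) = 1.
  rewrite /enorm; under eq_bigr do rewrite mxE sqr_sqrtr ?ltW//.
  by rewrite -mulr_suml s_sum divff ?sqrtr1// gt_eqF.
rewrite /hstar /H1 norm1 expr1n mul1r; apply: eq_bigr => i _; rewrite mxE.
by rewrite -powR12_sqrt ?ltW// -powRrM; congr (_ `^ _); field; rewrite gt_eqF.
Qed.

(* Main.v *)
Require Import Defs.
From HB Require Import structures.
From mathcomp Require Import all_boot all_order all_algebra.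
From mathcomp Require Import all_classical all_reals all_analysis.
From mathcomp Require Import ring lra.

(** Write [u i = x i ^ 2] and let [p] be the vector of the numbers
    [alpha + d j] in reverse order.  In these terms the field is
      x_i' = x_i (alpha (1 - |x|^2) + (p x u)_i)
    with the cross product of [p] and [u].  Since [u] is orthogonal to
    [p x u], the squared radius obeys a logistic equation and tends to 1, so
    the sphere attracts.  The angular part of a trajectory is an orbit on the
    sphere run at the speed |x|^2, which is a change of time tending to
    infinity; hence limit sets can be computed on the sphere
    ([radial_lift_trajectory], [omega_limitE]).

    On the sphere, [u] lives in the standard simplex and follows the
    replicator equation u_i' = 2 u_i (p x u)_i.  As [p] is orthogonal to
    [p x u], the product of the u_i ^ p_i is a first integral
    ([log_integral]).  The edge u_k = 0 consists of equilibria when p_k = 0 and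
    otherwise joins its two vertices in the direction given by the sign of p_k
    ([edge_limit]).  In the interior, monotone coordinates, exponential decay
    of a ratio of coordinates ([ratio_decay]) or the first integral give the
    limits when some p_k is not positive.  When all p_k are positive, the first
    integral is the weighted geometric mean [gmean], largest at the weights
    [p_k / sum p] and zero on the boundary; around this point the flow turns
    with an angular speed bounded below ([rotation]), so its level curves are
    periodic orbits ([level_curve]).

    For the classification, permuting the coordinates of [p] and multiplying
    [p] by a nonzero number give conjugate flows, and up to these operations
    there are six patterns of signs ([classification]).

    Flows with the same pattern are conjugate ([portrait_conjugate]).  In cases
    (ii) and (iii.b) a map raising each coordinate to its own power and
    normalizing carries the orbits to those of a fixed model, because it
    carries first integrals to first integrals ([conjugate_power]).  In cases
    (i) and (iii.a) a point is described by the level of the first integral and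
    by its direction seen from the maximum point [w] of [gmean], the centre of
    the disc in case (i) and a boundary point in case (iii.a); two flows
    correspond in these coordinates, the change of time on each orbit being
    read off from an angle, or a slope, that increases onto the whole line
    ([rotation], [slope_flow], [conjugate_polar]).  Compactness of the sphere
    turns such continuous injective descriptions into homeomorphisms
    ([conjugate_model]).

    Flows with different patterns are told apart by chains, 3-cycles and forks
    of connecting orbits, and by the set of equilibria
    ([conjugate_invariants], [portrait_facts]).  A linear form in [u] that
    increases strictly along every moving orbit excludes the cycles that must
    be absent ([lyapunov]). *)

Set Implicit Arguments.
Unset Strict Implicit.
Unset Printing Implicit Defensive.

Import Order.TTheory GRing.Theory Num.Theory.
Import numFieldNormedType.Exports.

Local Open Scope classical_set_scope.
Local Open Scope ring_scope.

Ltac deriv_ring := apply: is_derive_eq; rewrite /GRing.scale /=; ring.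

(** * The field in squared coordinates *)

Section Basics.
Variable R : realType.
Implicit Types (x y : 'rV[R]_3) (p u : 'I_3 -> R).

Lemma ord3_ind (P : 'I_3 -> Prop) : P i1 -> P i2 -> P i3 -> forall i, P i.
Proof.
move=> P1 P2 P3 [[|[|[|//]]] lti].
- by rewrite (_ : Ordinal lti = i1)//; exact: val_inj.
- by rewrite (_ : Ordinal lti = i2)//; exact: val_inj.
- by rewrite (_ : Ordinal lti = i3)//; exact: val_inj.
Qed.

Lemma sum3 (F : 'I_3 -> R) : \sum_i F i = F i1 + F i2 + F i3.
Proof.
rewrite !big_ord_recl big_ord0 addr0 addrA.
by congr (F _ + F _ + F _); exact: val_inj.
Qed.

Lemma prod3 (F : 'I_3 -> R) : \prod_i F i = F i1 * F i2 * F i3.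
Proof.
rewrite !big_ord_recl big_ord0 mulr1 mulrA.
by congr (F _ * F _ * F _); exact: val_inj.
Qed.

Lemma rowP3 x y : x 0 i1 = y 0 i1 -> x 0 i2 = y 0 i2 -> x 0 i3 = y 0 i3 -> x = y.
Proof. by move=> *; apply/rowP; exact: ord3_ind. Qed.

Lemma row3E (a b c : R) : (row3 a b c 0 i1 = a) * (row3 a b c 0 i2 = b) *
  (row3 a b c 0 i3 = c).
Proof. by rewrite /row3 !mxE. Qed.

Definition vec3 (a b c : R) (i : 'I_3) : R := [:: a; b; c]`_i.

Definition cross p u : 'I_3 -> R :=
  vec3 (p i2 * u i3 - p i3 * u i2) (p i3 * u i1 - p i1 * u i3)
       (p i1 * u i2 - p i2 * u i1).

Lemma vec3E a b c : (vec3 a b c i1 = a) * (vec3 a b c i2 = b) * (vec3 a b c i3 = c).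
Proof. by []. Qed.

Definition sq x : 'I_3 -> R := fun i => x 0 i ^+ 2.

(** The coordinates of this vector are the exponents of the first integral of the
    flow on the sphere; its k-th coordinate also governs the edge [x k = 0]. *)
Definition exponents (alpha : R) (d : 'I_3 -> R) : 'I_3 -> R :=
  fun i => alpha + d (rev_ord i).

Lemma rev_ord3 : (rev_ord i1 = i3) * (rev_ord i2 = i2) * (rev_ord i3 = i1).
Proof. by do !split; exact: val_inj. Qed.

Lemma exponentsE alpha d : (exponents alpha d i1 = alpha + d i3) *
  (exponents alpha d i2 = alpha + d i2) * (exponents alpha d i3 = alpha + d i1).
Proof. by rewrite /exponents !rev_ord3. Qed.

(** This form separates the radial part, which vanishes on the sphere, from a part
    that is tangent to it, [cross p u] being orthogonal to [u]. *)
Lemma field_DE alpha d x i : field_D alpha d x 0 i =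
  x 0 i * (alpha * (1 - \sum_j sq x j) + cross (exponents alpha d) (sq x) i).
Proof.
rewrite sum3 /cross !exponentsE /sq; move: i.
by apply: ord3_ind; rewrite /field_D !row3E !vec3E; ring.
Qed.

Lemma S2pE x : S2p x <-> (forall i, 0 <= x 0 i) /\ \sum_i sq x i = 1.
Proof.
split=> -[x0 xn]; split=> //.
  have : enorm x ^+ 2 = 1 by rewrite xn expr1n.
  by rewrite /enorm sqr_sqrtr// sumr_ge0// => i _; rewrite sqr_ge0.
by rewrite /S2p /= /enorm xn sqrtr1.
Qed.

Lemma is_derive_rowP (g : R -> 'rV[R]_3) (t : R) (v : 'rV[R]_3) :
  is_derive t 1 g v <-> forall i, is_derive t 1 (fun s => g s 0 i) (v 0 i).
Proof.
split=> [[dg gv] i|dg].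
  apply: DeriveDef; first by move/derivable_mxP : dg; exact.
  by rewrite -gv derive_mx// mxE.
have dg' : derivable g t 1.
  by apply/derivable_mxP => i j; rewrite (ord1 i); have [] := dg j.
apply: DeriveDef => //.
by apply/rowP => j; rewrite derive_mx// mxE; have [_ ->] := dg j.
Qed.

(** Coordinatewise form of the complete solutions in the sphere.  It depends on the
    parameters only through [p], which may then be any vector: the reflections,
    permutations and rescalings used below act on [p] directly. *)
Definition sphere_sol p (g : R -> 'rV[R]_3) := (forall t, S2p (g t)) /\
  forall (t : R) i, is_derive t 1 (fun s => g s 0 i) (g t 0 i * cross p (sq (g t)) i).

Lemma sphere_solP alpha d g : complete_solution alpha d g /\ range g `<=` S2p
  <-> sphere_sol (exponents alpha d) g.
Proof.
split=> [[cs sub]|[sub cs]]; split.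
- by move=> t; apply: sub; exists t.
- move=> t i; have /is_derive_rowP/(_ i) := cs t isT.
  rewrite field_DE; have /S2pE[_ ->] : S2p (g t) by apply: sub; exists t.
  by rewrite subrr mulr0 add0r.
- move=> t _; apply/is_derive_rowP => i; rewrite field_DE.
  by have /S2pE[_ ->] := sub t; rewrite subrr mulr0 add0r; exact: cs.
- by move=> _ [t _ <-]; exact: sub.
Qed.

End Basics.

(** * Monotonicity and primitives of real functions *)

Section RealFunctions.
Variable R : realType.

Lemma is_derive_continuous (f : R -> R) (t f' : R) :
  is_derive t 1 f f' -> {for t, continuous f}.
Proof. by move=> [df _]; apply/differentiable_continuous/derivable1_diffP. Qed.

Lemma is_derive_comp1 (f g : R -> R) (t f' g' : R) :
  is_derive (g t) 1 f f' -> is_derive t 1 g g' ->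
  is_derive t 1 (fun s => f (g s)) (f' * g').
Proof. by move=> df dg; exact: is_derive1_comp. Qed.

Lemma is_derive_reflect (f : R -> R) (t f' : R) :
  is_derive (- t) 1 f f' -> is_derive t 1 (fun s => f (- s)) (- f').
Proof.
move=> df; have dn : is_derive t 1 (fun s : R => - s) (-1) by apply: is_derive_eq.
by have := is_derive_comp1 (g := fun s : R => - s) df dn; rewrite mulrN1.
Qed.

Section OnSegment.
Variables (f f' : R -> R) (a b : R).
Hypothesis ab : a <= b.
Hypothesis df : forall t : R, a <= t <= b -> is_derive t 1 f (f' t).

Let cf : {within `[a, b], continuous f}.
Proof.
apply: continuous_in_subspaceT => t; rewrite inE/= in_itv/= => tab.
exact: is_derive_continuous (df tab).
Qed.

Let mvt : exists2 c, a <= c <= b & f b - f a = f' c * (b - a).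
Proof.
have df0 t : t \in `]a, b[ -> is_derive t 1 f (f' t).
  by rewrite in_itv/= => /andP[/ltW ta /ltW tb]; apply: df; rewrite ta.
have [c + e] := MVT_segment ab df0 cf.
by rewrite in_itv/= => cab; exists c.
Qed.

Lemma le_of_derive : (forall t, a <= t <= b -> 0 <= f' t) -> f a <= f b.
Proof.
move=> f0; have [c cab e] := mvt.
by rewrite -subr_ge0 e mulr_ge0 ?f0 ?subr_ge0.
Qed.

Lemma lt_of_derive : a < b -> (forall t, a <= t <= b -> 0 < f' t) -> f a < f b.
Proof.
move=> altb f0; have [c cab e] := mvt.
by rewrite -subr_gt0 e mulr_gt0 ?f0 ?subr_gt0.
Qed.

Lemma eq_of_derive : (forall t, a <= t <= b -> f' t = 0) -> f a = f b.
Proof.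
move=> f0; have [c cab e] := mvt.
by apply/eqP; rewrite eq_sym -subr_eq0 e f0 ?mul0r.
Qed.

End OnSegment.

Section OnLine.
Variables (f f' : R -> R).
Hypothesis df : forall t : R, is_derive t 1 f (f' t).

Lemma homo_of_derive : (forall t, 0 <= f' t) -> {homo f : s t / s <= t}.
Proof. by move=> f0 s t st; apply: (le_of_derive st (fun u _ => df u)). Qed.

Lemma shomo_of_derive : (forall t, 0 < f' t) -> {homo f : s t / s < t}.
Proof.
by move=> f0 s t st; apply: (lt_of_derive (ltW st) (fun u _ => df u)).
Qed.

Lemma cst_of_derive : (forall t, f' t = 0) -> forall s t, f s = f t.
Proof.
move=> f0 s t; wlog st : s t / s <= t => [h|].
  by have [/h//|/ltW/h->] := leP s t.
exact: (eq_of_derive st (fun u _ => df u)).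
Qed.

End OnLine.

Lemma le0_homo_of_derive (f f' : R -> R) :
  (forall t : R, is_derive t 1 f (f' t)) ->
  (forall t, f' t <= 0) -> forall s t, s <= t -> f t <= f s.
Proof.
move=> df f0 s t st; rewrite -lerN2.
apply: (@homo_of_derive (fun t => - f t) (fun t => - f' t)) => // u.
by rewrite oppr_ge0.
Qed.

(** The fundamental theorem of calculus gives a primitive on each half-line only;
    [primitive] glues these. *)
Let primitive_from (g : R -> R) (a : R) : continuous g ->
  exists G : R -> R, forall t, a < t -> is_derive t 1 G (g t).
Proof.
move=> cg; pose mu := @lebesgue_measure R.
pose F x := (\int[mu]_(s in `[a, x]) g s)%R.
exists F => t ta.
have gi : mu.-integrable `[a, t + 1] (EFin \o g).
  apply: continuous_compact_integrable; first exact: segment_compact.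
  exact: continuous_subspaceT.
have t1 : t < t + 1 by rewrite ltrDl.
have [dF eF] : derivable F t 1 /\ derive1 F t = g t.
  exact: continuous_FTC1_closed t1 gi ta (cg t).
by apply: (DeriveDef dF); rewrite -derive1E.
Qed.

Lemma primitive (g : R -> R) : continuous g ->
  exists G : R -> R, G 0 = 0 /\ forall t : R, is_derive t 1 G (g t).
Proof.
move=> cg.
have /choice[F dF] := fun n : nat => primitive_from (- n.+1%:R) cg.
pose G n t := F n t - F n 0.
have dG n (t : R) : - n.+1%:R < t -> is_derive t 1 (G n) (g t).
  move=> nt; have ? := dF n t nt.
  by apply: is_derive_eq; rewrite subr0.
have GE n m t : - n.+1%:R < t -> - m.+1%:R < t -> G n t = G m t.
  move=> nt mt.
  pose D t := G n t - G m t.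
  have n0 k : - k.+1%:R < 0 :> R by rewrite oppr_lt0.
  have D0 : D 0 = 0 by rewrite /D /G !subrr.
  have dD (s : R) : Num.min t 0 <= s -> is_derive s 1 D 0.
    move=> ts.
    have ? : is_derive s 1 (G n) (g s).
      by apply: dG; rewrite (lt_le_trans _ ts)// lt_min nt n0.
    have ? : is_derive s 1 (G m) (g s).
      by apply: dG; rewrite (lt_le_trans _ ts)// lt_min mt n0.
    by apply: is_derive_eq; rewrite subrr.
  apply/eqP; rewrite -subr_eq0 -/(D t) -D0; apply/eqP.
  have [t0|/ltW t0] := leP t 0.
    apply: (@eq_of_derive D (fun=> 0) t 0) => // s /andP[ts _].
    by apply: dD; rewrite ge_min ts.
  apply/esym/(@eq_of_derive D (fun=> 0) 0 t) => // s /andP[ts _].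
  by apply: dD; rewrite ge_min ts orbT.
(* an index whose half-line contains [t] in its interior *)
pose nn (t : R) := Num.truncn `|t|.
have nnP t : - (nn t).+1%:R < t.
  by rewrite ltrNl (le_lt_trans (ler_norm _))// normrN truncnS_gt.
exists (fun t => G (nn t) t); split; first by rewrite /G subrr.
move=> t; have := dG (nn t) t (nnP t).
apply: near_eq_is_derive.
near=> s; apply: GE; last exact: nnP.
near: s; exact: lt_nbhsr (nnP t).
Unshelve. all: by end_near. Qed.

End RealFunctions.

(** * Picard's theorem for bounded Lipschitz fields *)

Section Comparison.
Variable R : realType.

Lemma lipschitz_of_derive (f f' : R -> R) (B : R) :
  (forall t : R, is_derive t 1 f (f' t)) -> (forall t, `|f' t| <= B) ->
  forall s t, `|f s - f t| <= B * `|s - t|.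
Proof.
move=> df fB s t; wlog st : s t / s <= t => [h|].
  have [/h//|/ltW/h] := leP s t.
  by rewrite distrC [`|t - s|]distrC.
rewrite [`|s - t|]distrC (ger0_norm (_ : 0 <= t - s)) ?subr_ge0//.
have B1 : - (B * (t - s)) <= f s - f t.
  suff : f t - B * t <= f s - B * s by lra.
  apply: (@le0_homo_of_derive _ (fun u => f u - B * u) (fun u => f' u - B)) => // [u|u].
    by deriv_ring.
  by have := fB u; rewrite ler_norml => /andP[]; lra.
have B2 : f s - f t <= B * (t - s).
  suff : f s + B * s <= f t + B * t by lra.
  apply: (@homo_of_derive _ (fun u => f u + B * u) (fun u => f' u + B)) => // [u|u].
    by deriv_ring.
  by have := fB u; rewrite ler_norml => /andP[]; lra.
by rewrite ler_norml B1 B2.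
Qed.

(** An exponential weight is reproduced by integration up to the factor [1 / K], so
    that with [K] twice the Lipschitz constant each Picard step halves the weighted
    distance, uniformly on the whole line. *)
Lemma exp_bound_of_derive (D D' : R -> R) (c K : R) : 0 <= c ->
  (forall t : R, is_derive t 1 D (D' t)) -> D 0 = 0 ->
  (forall t, `|D' t| <= c * K * expR (K * `|t|)) ->
  forall t, `|D t| <= c * expR (K * `|t|).
Proof.
move=> c0; have half (F F' : R -> R) : (forall t : R, is_derive t 1 F (F' t)) ->
    F 0 = 0 -> (forall t, 0 <= t -> `|F' t| <= c * K * expR (K * t)) ->
    forall t, 0 <= t -> `|F t| <= c * expR (K * t).
  move=> dF F0 F'K t t0.
  have dE (u : R) : is_derive u 1 (fun v : R => c * expR (K * v)) (c * K * expR (K * u)).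
    by deriv_ring.
  rewrite ler_norml; apply/andP; split.
    suff : F 0 + c * expR (K * 0) <= F t + c * expR (K * t).
      by rewrite F0 mulr0 expR0; lra.
    apply: (@le_of_derive _ (fun u => F u + c * expR (K * u))
      (fun u => F' u + c * K * expR (K * u)) 0 t) => // u /andP[u0 _].
    by have := F'K u u0; rewrite ler_norml; lra.
  suff : - F 0 + c * expR (K * 0) <= - F t + c * expR (K * t).
    by rewrite F0 mulr0 expR0; lra.
  apply: (@le_of_derive _ (fun u => - F u + c * expR (K * u))
    (fun u => - F' u + c * K * expR (K * u)) 0 t) => // u /andP[u0 _].
  by have := F'K u u0; rewrite ler_norml; lra.
move=> dD D0 D'K t; have [t0|/ltW t0] := leP 0 t.
  rewrite (ger0_norm t0); apply: (half D D') => // u u0.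
  by have := D'K u; rewrite (ger0_norm u0).
rewrite (ler0_norm t0) -[t in D t]opprK.
apply: (half (fun s => D (- s)) (fun s => - D' (- s))); rewrite ?oppr0 ?oppr_ge0//.
  move=> u; have ? := dD (- u).
  by deriv_ring.
by move=> u u0; rewrite normrN; have := D'K (- u); rewrite normrN (ger0_norm u0).
Qed.

End Comparison.

Section GeometricLimit.
Variable R : realType.

(** The increments bound the tails by a geometric series; the limit is the supremum
    of the lower bounds [Y n - 2 C / 2 ^ n], which avoids any completeness of
    function spaces. *)
Lemma geometric_limit (Y : nat -> R) (C : R) :
  (forall n, `|Y n.+1 - Y n| <= C / 2 ^+ n) ->
  exists y, forall n, `|y - Y n| <= 2 * C / 2 ^+ n.
Proof.
move=> YC; pose r n : R := 2 * C / 2 ^+ n.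
have rS n : r n.+1 = C / 2 ^+ n.
  by rewrite /r exprS; field; rewrite expf_neq0.
have rS2 n : r n = r n.+1 *+ 2 by rewrite rS /r mulr2n; ring.
have inc n k : Y n - r n <= Y (n + k)%N - r (n + k)%N.
  elim: k => [|k IH]; first by rewrite addn0.
  rewrite addnS (le_trans IH)//; have := YC (n + k)%N.
  by rewrite -rS (rS2 (n + k)%N) ler_norml mulr2n; lra.
have dec n k : Y (n + k)%N + r (n + k)%N <= Y n + r n.
  elim: k => [|k IH]; first by rewrite addn0.
  rewrite addnS (le_trans _ IH)//; have := YC (n + k)%N.
  by rewrite -rS (rS2 (n + k)%N) ler_norml mulr2n; lra.
have r0 n : 0 <= r n by rewrite rS2 rS mulrn_wge0// (le_trans _ (YC n)).
have ab m n : Y n - r n <= Y m + r m.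
  have := inc n m; have := dec m n; rewrite addnC.
  by have := r0 (n + m)%N; lra.
exists (sup (range (fun n => Y n - r n))) => n.
have a0 : range (fun n => Y n - r n) !=set0 by exists (Y 0 - r 0)%R, 0%N.
rewrite -/(r n) ler_norml; apply/andP; split.
  rewrite lerBrDl; apply: ub_le_sup; last by exists n.
  by exists (Y n + r n) => _ [m _ <-]; exact: ab.
rewrite lerBlDl; apply: ge_sup => // _ [m _ <-]; exact: ab.
Qed.

Lemma eq0_geometric (x C : R) : (forall n, `|x| <= C / 2 ^+ n) -> x = 0.
Proof.
move=> xC; apply/eqP; rewrite -normr_eq0; apply/eqP/le_anti; rewrite normr_ge0 andbT.
apply/ler_addgt0Pr => e e0; rewrite add0r.
have C0 : 0 <= C by have := xC 0%N; rewrite expr0 divr1; apply: le_trans.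
pose n := (Num.truncn (C / e)).+1.
have nP : C / e < n%:R by rewrite truncnS_gt.
apply: (le_trans (xC n)); rewrite ler_pdivrMr ?exprn_gt0//.
move: nP; rewrite ltr_pdivrMr// => /ltW/le_trans; apply.
rewrite mulrC ler_pM2l// -natrX ler_nat; exact/ltnW/ltn_expl.
Qed.

End GeometricLimit.

Section Picard.
Variable R : realType.
Variables (f : ('I_3 -> R) -> 'I_3 -> R) (B L : R).
Hypothesis L0 : 0 < L.
Hypothesis fB : forall y i, `|f y i| <= B.
Hypothesis fL : forall y z (r : R), (forall j, `|y j - z j| <= r) ->
  forall i, `|f y i - f z i| <= L * r.

Let f_continuous (y : R -> 'I_3 -> R) : (forall j, continuous (y ^~ j)) ->
  forall i, continuous (fun t => f (y t) i).
Proof.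
move=> cy i t; apply/cvgrPdist_le => e e0.
have eL : 0 < e / L by rewrite divr_gt0.
have near_y j : \forall s \near nbhs t, `|y t j - y s j| <= e / L.
  by move: (cy j t) => /cvgrPdist_le; apply.
have near_ally : \forall s \near nbhs t, forall j, `|y t j - y s j| <= e / L.
  exact: filter_forall.
suff : \forall s \near nbhs t, `|f (y t) i - f (y s) i| <= e by [].
near=> s.
have yts : forall j, `|y t j - y s j| <= e / L by near: s.
by have := fL yts i; rewrite mulrCA divff ?mulr1// gt_eqF.
Unshelve. all: by end_near. Qed.

(** Primitives are chosen for all functions at once so that the iteration [Y] can be
    defined without carrying continuity proofs. *)
Let prim (g : R -> R) : R -> R :=
  if pselect (continuous g) is left cg then projT1 (cid (primitive cg)) else 0.

Let primP g : continuous g -> prim g 0 = 0 /\ forall t : R, is_derive t 1 (prim g) (g t).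
Proof.
by rewrite /prim => cg; case: pselect => // cg'; exact: projT2 (cid (primitive cg')).
Qed.

Let Y (n : nat) : R -> 'I_3 -> R :=
  iter n (fun y t i => prim (fun s => f (y s) i) t) (fun _ _ => 0).

Let Y_continuous n j : continuous (Y n ^~ j).
Proof.
elim: n j => [|n IH] j; first by move=> t; exact: cvg_cst.
have [_ dp] := primP (@f_continuous (Y n) IH j).
by move=> t; exact: is_derive_continuous (dp t).
Qed.

Let Y0 n i : Y n 0 i = 0.
Proof. by case: n => //= n; have [] := primP (@f_continuous (Y n) (@Y_continuous n) i). Qed.

Let dY n i (t : R) : is_derive t 1 (Y n.+1 ^~ i) (f (Y n t) i).
Proof. by have [_] := primP (@f_continuous (Y n) (@Y_continuous n) i); exact. Qed.

Let picard_iterates : exists Y : nat -> R -> 'I_3 -> R,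
  [/\ forall t i, Y 0%N t i = 0, forall n i, Y n 0 i = 0 &
   forall n i (t : R), is_derive t 1 (Y n.+1 ^~ i) (f (Y n t) i)].
Proof. by exists Y; split=> // n i t; exact: dY. Qed.

Section Limit.
Variable X : nat -> R -> 'I_3 -> R.
Hypothesis X00 : forall t i, X 0%N t i = 0.
Hypothesis X0 : forall n i, X n 0 i = 0.
Hypothesis dX : forall n i (t : R), is_derive t 1 (X n.+1 ^~ i) (f (X n t) i).

Let X_lipschitz n i s t : `|X n s i - X n t i| <= B * `|s - t|.
Proof.
case: n => [|n].
  by rewrite !X00 subrr normr0 mulr_ge0// (le_trans _ (fB (fun=> 0) i)).
exact: lipschitz_of_derive (dX n i) _ s t.
Qed.

Let M := B / (2 * L).

Let M0 : 0 <= M.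
Proof.
by rewrite divr_ge0 ?mulr_ge0 ?(ltW L0)// (le_trans _ (fB (fun=> 0) i1)).
Qed.

Let w (t : R) := expR (2 * L * `|t|).

Let w_ge1 t : 1 <= w t.
Proof. by rewrite -expR0 ler_expR mulr_ge0// mulr_ge0// ltW. Qed.

Let X_step n i t : `|X n.+1 t i - X n t i| <= M * w t / 2 ^+ n.
Proof.
elim: n i t => [|n IH] i t.
  rewrite expr0 divr1; apply: (@exp_bound_of_derive _ (fun s => X 1 s i - X 0 s i) (fun s => f (X 0 s) i) M (2 * L) M0).
  - by rewrite (_ : (fun s => _) = X 1 ^~ i)//; apply/funext => s; rewrite X00 subr0.
  - by rewrite !X0 subrr.
  - move=> s; rewrite /M divfK ?gt_eqF ?mulr_gt0//.
    apply: (le_trans (fB _ _)); rewrite ler_peMr//; last exact: w_ge1.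
    exact: (le_trans (normr_ge0 _) (fB (fun=> 0) i)).
rewrite mulrAC.
apply: (@exp_bound_of_derive _ (fun s => X n.+2 s i - X n.+1 s i)
  (fun s => f (X n.+1 s) i - f (X n s) i) (M / 2 ^+ n.+1) (2 * L)).
- by rewrite divr_ge0// exprn_ge0.
- by rewrite !X0 subrr.
- move=> s; rewrite -/(w s).
  apply: (le_trans (fL (fun j => IH j s) i)).
  rewrite le_eqVlt; apply/orP; left; apply/eqP.
  by rewrite exprS; field; rewrite expf_neq0.
Qed.

(** Pointwise limits of the iterates are Lipschitz, hence the integral of [f] along
    them is defined; it stays at weighted distance [M / 2 ^ n] from the iterates and
    therefore is the limit itself. *)
Lemma picard_limit : exists y : R -> 'I_3 -> R, (forall i, y 0 i = 0) /\
  forall (t : R) i, is_derive t 1 (y ^~ i) (f (y t) i).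
Proof.
have /choice[y yP] : forall ti : R * 'I_3, exists y, forall n,
    `|y - X n ti.1 ti.2| <= 2 * (M * w ti.1) / 2 ^+ n.
  by move=> [t i]; apply: geometric_limit => n; exact: X_step.
have yX n t i : `|y (t, i) - X n t i| <= 2 * M / 2 ^+ n * w t.
  by have := yP (t, i) n; rewrite /=; congr (_ <= _); ring.
have y0 i : y (0, i) = 0.
  apply: (@eq0_geometric _ _ (2 * M * w 0)) => n.
  by have := yX n 0 i; rewrite X0 subr0; congr (_ <= _); ring.
have y_lip i s t : `|y (s, i) - y (t, i)| <= B * `|s - t|.
  apply/ler_addgt0Pr => e e0.
  have [n ne] : exists n, 2 * M / 2 ^+ n * (w s + w t) <= e.
    apply: contrapT => /forallNP h.
    have : e = 0.
      apply: (@eq0_geometric _ _ (2 * M * (w s + w t))) => n.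
      rewrite gtr0_norm//; have /negP := h n; rewrite -ltNge => /ltW.
      by congr (_ <= _); ring.
    by move=> e00; rewrite e00 ltxx in e0.
  have := yX n s i; have := yX n t i; have := X_lipschitz n i s t.
  by rewrite !ler_norml; lra.
have cy j : continuous (fun t => y (t, j)).
  move=> t; apply/cvgrPdist_le => e e0.
  have B1 : 0 < B + 1 by rewrite ltr_wpDl// (le_trans _ (fB (fun=> 0) i1)).
  have eB : 0 < e / (B + 1) by rewrite divr_gt0.
  exists (e / (B + 1)) => //= s /= ts.
  apply: (le_trans (y_lip _ _ _)).
  apply: (@le_trans _ _ ((B + 1) * `|t - s|)).
    by rewrite ler_wpM2r// lerDl.
  by rewrite mulrC -ler_pdivlMr// ltW.
pose f' i := fun t => f (fun j => y (t, j)) i.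
have [Z ZP] : {Z | forall i, Z i 0 = 0 /\ forall t : R, is_derive t 1 (Z i) (f' i t)}.
  by exists (fun i => prim (f' i)) => i; apply/primP/f_continuous => j; exact: cy.
have ZE i t : y (t, i) = Z i t.
  apply/eqP; rewrite -subr_eq0; apply/eqP.
  apply: (@eq0_geometric _ _ (2 * M * w t)) => n.
  have bZ : `|Z i t - X n.+1 t i| <= M / 2 ^+ n * w t.
    apply: (@exp_bound_of_derive _ (fun s => Z i s - X n.+1 s i)
      (fun s => f' i s - f (X n s) i) (M / 2 ^+ n) (2 * L)).
    - by rewrite divr_ge0// exprn_ge0.
    - by move=> s; have [_ ?] := ZP i; have ? := dX n i s; deriv_ring.
    - by rewrite X0; have [-> _] := ZP i; rewrite subrr.
    - move=> s; rewrite -/(w s).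
      apply: (le_trans (fL (fun j => yX n s j) i)).
      by rewrite le_eqVlt; apply/orP; left; apply/eqP; ring.
  have := yX n.+1 t i.
  have -> : 2 * M / 2 ^+ n.+1 * w t = M / 2 ^+ n * w t.
    by rewrite exprS; field; rewrite expf_neq0.
  have -> : 2 * M * w t / 2 ^+ n = M / 2 ^+ n * w t + M / 2 ^+ n * w t by ring.
  by move: bZ; rewrite !ler_norml; lra.
exists (fun t i => y (t, i)); split=> // t i.
have [_ dZ] := ZP i.
by rewrite (_ : (fun t => y (t, i)) = Z i)//; apply/funext => s; exact: ZE.
Qed.

End Limit.

Lemma picard : exists y : R -> 'I_3 -> R, (forall i, y 0 i = 0) /\
  forall (t : R) i, is_derive t 1 (y ^~ i) (f (y t) i).
Proof. by have [X [X00 X0 dX]] := picard_iterates; exact: picard_limit X00 X0 dX. Qed.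

End Picard.

(** * Existence and uniqueness of the flow on the sphere *)

Section CrossBounds.
Variable R : realType.
Implicit Types (x : 'rV[R]_3) (p u v : 'I_3 -> R).

Definition norm1 p : R := `|p i1| + `|p i2| + `|p i3|.

Lemma norm1_ge0 p : 0 <= norm1 p.
Proof. by rewrite /norm1 !addr_ge0. Qed.

Lemma ler_norm1 u i : `|u i| <= norm1 u.
Proof.
rewrite /norm1; have := normr_ge0 (u i1); have := normr_ge0 (u i2).
have := normr_ge0 (u i3).
by move: i; apply: ord3_ind; lra.
Qed.

Lemma cross_bound p u (r : R) : (forall j, `|u j| <= r) ->
  forall i, `|cross p u i| <= norm1 p * r.
Proof.
move=> ur; have r0 : 0 <= r := le_trans (normr_ge0 _) (ur i1).
have pur i j : `|p i * u j| <= `|p i| * r by rewrite normrM ler_wpM2l.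
have p0 i : 0 <= `|p i| * r by rewrite mulr_ge0.
have sub a b i j k l : `|p a * u i - p b * u j| <= `|p a| * r + `|p b| * r + `|p k| * r * l%:R.
  rewrite (le_trans (ler_normB _ _))// -[leLHS]addr0 lerD ?mulr_ge0 ?lerD//.
rewrite /norm1 !mulrDl; apply: ord3_ind; rewrite /cross vec3E.
- by have := sub i2 i3 i3 i2 i1 1%N; lra.
- by have := sub i3 i1 i1 i3 i2 1%N; lra.
- by have := sub i1 i2 i2 i1 i3 1%N; lra.
Qed.

Lemma crossB p u v i : cross p u i - cross p v i = cross p (fun j => u j - v j) i.
Proof. by move: i; apply: ord3_ind; rewrite /cross !vec3E; ring. Qed.

(** Hence the flow preserves the sum of the squared coordinates. *)
Lemma cross_skew p u : \sum_i u i * cross p u i = 0.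
Proof. by rewrite sum3 /cross !vec3E; ring. Qed.

(** Hence the sum of the [p i * ln (u i)] is constant along the flow. *)
Lemma cross_kernel p u : \sum_i p i * cross p u i = 0.
Proof. by rewrite sum3 /cross !vec3E; ring. Qed.

End CrossBounds.

Section Existence.
Variable R : realType.
Implicit Types (x : 'rV[R]_3) (p y z c : 'I_3 -> R).

Let Z c y := \sum_j c j * expR (y j).
(** The normalized exponentials parametrize the orbits in the simplex: writing
    [u i = c i * expR (y i)] turns the equation into one for [y] with a bounded
    Lipschitz field. *)
Let sm c y : 'I_3 -> R := fun i => c i * expR (y i) / Z c y.

Section Softmax.
Variable c : 'I_3 -> R.
Hypotheses (c0 : forall i, 0 <= c i) (c1 : \sum_i c i = 1).

Let Z_gt0 y : 0 < Z c y.
Proof.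
have term i : 0 <= c i * expR (y i) by rewrite mulr_ge0 ?expR_ge0.
rewrite lt_def sumr_ge0 ?andbT//; apply/eqP => Z0.
have cz i : c i = 0.
  have := Z0 => /(psumr_eq0P (fun j _ => term j))/(_ i isT)/eqP.
  by rewrite mulf_eq0 (gt_eqF (expR_gt0 _)) orbF => /eqP.
by move: c1; rewrite big1// => /esym/eqP; rewrite oner_eq0.
Qed.

Let sm_ge0 y i : 0 <= sm c y i.
Proof. by apply: divr_ge0; [rewrite mulr_ge0 ?expR_ge0|exact/ltW/Z_gt0]. Qed.

Let sm_sum y : \sum_i sm c y i = 1.
Proof. by rewrite /sm -mulr_suml divff// gt_eqF ?Z_gt0. Qed.

Let sm_le1 y i : sm c y i <= 1.
Proof.
rewrite -(sm_sum y) sum3; have := sm_ge0 y i1; have := sm_ge0 y i2.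
by have := sm_ge0 y i3; move: i; apply: ord3_ind; lra.
Qed.

(** Moving every [y j] by at most [r] changes numerator and denominator by factors
    between [expR (- r)] and [expR r]. *)
Let sm_lip y z (r : R) : (forall j, `|y j - z j| <= r) ->
  forall i, `|sm c y i - sm c z i| <= 2 * r.
Proof.
suff half (a b : 'I_3 -> R) i : (forall j, `|a j - b j| <= r) ->
    sm c a i - sm c b i <= 2 * r.
  move=> yzr i; rewrite ler_norml lerNl opprB !half// => j.
  by rewrite distrC.
move=> abr; have r0 : 0 <= r := le_trans (normr_ge0 _) (abr i).
have Zle : Z c b <= expR r * Z c a.
  rewrite /Z mulr_sumr; apply: ler_sum => j _; rewrite mulrCA ler_wpM2l//.
  by rewrite -expRD ler_expR; have := abr j; rewrite ler_norml; lra.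
have num : expR (- r) * (c i * expR (a i)) <= c i * expR (b i).
  rewrite mulrCA ler_wpM2l// -expRD ler_expR.
  by have := abr i; rewrite ler_norml; lra.
have le1 : expR (- r) ^+ 2 * sm c a i <= sm c b i.
  rewrite /sm ler_pdivlMr//.
  have coef0 : 0 <= expR (- r) ^+ 2 * (c i * expR (a i) / Z c a).
    by rewrite mulr_ge0 ?sqr_ge0// sm_ge0.
  apply: (le_trans (ler_wpM2l coef0 Zle)).
  have -> : expR (- r) ^+ 2 * (c i * expR (a i) / Z c a) * (expR r * Z c a) =
    expR (- r) * (c i * expR (a i)) * (expR (- r) * expR r) * (Z c a / Z c a).
    by ring.
  by rewrite -expRD addNr expR0 divff ?gt_eqF// !mulr1.
have e2 : 1 - 2 * r <= expR (- r) ^+ 2.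
  rewrite -expRM_natl; apply: le_trans (expR_ge1Dx _); lra.
have := sm_ge0 a i; have := sm_le1 a i.
by nra.
Qed.

(** The normalizing sum has derivative proportional to [cross_skew], so it keeps its
    initial value 1 and disappears from the equation. *)
Lemma softmax_ode p : exists y : R -> 'I_3 -> R, [/\ forall i, y 0 i = 0,
  forall (t : R) i, is_derive t 1 (y ^~ i)
    (2 * cross p (fun j => c j * expR (y t j)) i) &
  forall t, \sum_j c j * expR (y t j) = 1].
Proof.
have L0 : 0 < 4 * norm1 p + 1 by have := norm1_ge0 p; lra.
have fB y i : `|2 * cross p (sm c y) i| <= 2 * (norm1 p * 1).
  rewrite normrM ger0_norm// ler_wpM2l//; apply: cross_bound => j.
  by rewrite ger0_norm.
have fL y z (r : R) : (forall j, `|y j - z j| <= r) -> forall i,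
    `|2 * cross p (sm c y) i - 2 * cross p (sm c z) i| <= (4 * norm1 p + 1) * r.
  move=> yzr i; have r0 : 0 <= r := le_trans (normr_ge0 _) (yzr i).
  rewrite -mulrBr crossB normrM ger0_norm//.
  have := cross_bound p (sm_lip yzr) i.
  by have := norm1_ge0 p; lra.
have [y [y0 dy]] := picard L0 fB fL.
have Z1 t : Z c (y t) = 1.
  have Z01 : Z c (y 0) = 1.
    by rewrite -c1; apply: eq_bigr => i _; rewrite y0 expR0 mulr1.
  rewrite -Z01.
  apply: (@cst_of_derive _ (fun t => Z c (y t))
    (fun t => 2 * Z c (y t) * \sum_i sm c (y t) i * cross p (sm c (y t)) i)).
    move=> s; rewrite /Z.
    have -> : (fun t : R => \sum_j c j * expR (y t j)) =
        \sum_j (fun t => c j * expR (y t j)).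
      by apply/funext => u; rewrite fct_sumE.
    rewrite mulr_sumr.
    apply: is_derive_sum => j.
    have ? := dy s j.
    apply: is_derive_eq; rewrite /GRing.scale/=.
    set X := cross _ _ _; rewrite /sm -/(Z c (y s)); field; exact: lt0r_neq0 (Z_gt0 _).
  by move=> s; rewrite cross_skew mulr0.
exists y; split => // t i; have := dy t i.
have -> // : sm c (y t) = fun j => c j * expR (y t j).
by apply/funext => j; rewrite /sm Z1 divr1.
Qed.

End Softmax.

(** The exponential form of the solution also shows that a coordinate vanishes
    forever or never. *)
Lemma sphere_sol_exists p x : S2p x -> exists g : R -> 'rV[R]_3,
  [/\ sphere_sol p g, g 0 = x &
   forall i, x 0 i = 0 /\ (forall t, g t 0 i = 0) \/ forall t, 0 < g t 0 i].
Proof.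
move=> /S2pE[x0 x1].
have [y [y0 dy Z1]] := softmax_ode (c := sq x) (fun i => sqr_ge0 _) x1 p.
(* half of the exponent, as [y] describes the squared coordinates *)
pose g t : 'rV[R]_3 := \row_i (x 0 i * expR (y t i / 2)).
have sqg t : sq (g t) = fun j => sq x j * expR (y t j).
  apply/funext => j; rewrite /sq mxE exprMn -expRM_natl.
  by congr (_ * expR _); field.
exists g; split.
- split=> [t|t i].
    apply/S2pE; split; last by rewrite sqg.
    by move=> i; rewrite mxE mulr_ge0 ?expR_ge0.
  rewrite sqg.
  have -> : (fun s => g s 0 i) = (fun s => x 0 i * expR (y s i / 2)).
    by apply/funext => s; rewrite mxE.
  have ? := dy t i; rewrite mxE; apply: is_derive_eq.
  by rewrite /GRing.scale/=; field.
- by apply/rowP => i; rewrite mxE y0 mul0r expR0 mulr1.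
- move=> i; have := x0 i; rewrite le_eqVlt => /predU1P[xi|xi].
    by left; split => // t; rewrite mxE -xi mul0r.
  by right => t; rewrite mxE mulr_gt0 ?expR_gt0.
Qed.

End Existence.

Section Uniqueness.
Variable R : realType.
Implicit Types (x : 'rV[R]_3) (p : 'I_3 -> R) (g h : R -> 'rV[R]_3).

(** The sum of the squares, damped by [expR (- 6 C t)], is nonincreasing and starts
    at 0. *)
Lemma gronwall (D F : 'I_3 -> R -> R) (T C : R) : 0 <= T -> 0 <= C ->
  (forall i (t : R), 0 <= t <= T -> is_derive t 1 (D i) (F i t)) ->
  (forall i t, 0 <= t <= T -> `|F i t| <= C * norm1 (D ^~ t)) ->
  (forall i, D i 0 = 0) -> forall i, D i T = 0.
Proof.
move=> T0 C0 dD FC D0.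
(* (a + b + c)^2 <= 3 (a^2 + b^2 + c^2), doubled by the differentiation of squares *)
pose E t := (D i1 t ^+ 2 + D i2 t ^+ 2 + D i3 t ^+ 2) * expR (- (6 * C * t)).
pose E' t := (2 * (D i1 t * F i1 t + D i2 t * F i2 t + D i3 t * F i3 t)
   - 6 * C * (D i1 t ^+ 2 + D i2 t ^+ 2 + D i3 t ^+ 2)) * expR (- (6 * C * t)).
have dE (t : R) : 0 <= t <= T -> is_derive t 1 (fun s => - E s) (- E' t).
  move=> tT; have ? := dD i1 t tT; have ? := dD i2 t tT; have ? := dD i3 t tT.
  by rewrite /E /E'; deriv_ring.
have E'0 t : 0 <= t <= T -> 0 <= - E' t.
  move=> tT; rewrite oppr_ge0 /E' pmulr_lle0 ?expR_gt0// subr_le0.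
  have term i : D i t * F i t <= `|D i t| * (C * norm1 (D ^~ t)).
    by rewrite (le_trans (ler_norm _))// normrM ler_wpM2l// FC.
  have := term i1; have := term i2; have := term i3; rewrite /norm1.
  rewrite -(real_normK (num_real (D i1 t))) -(real_normK (num_real (D i2 t))).
  rewrite -(real_normK (num_real (D i3 t))).
  move: `|D i1 t| `|D i2 t| `|D i3 t| (D i1 t * _) (D i2 t * _) (D i3 t * _).
  move=> a b c A B K HK HB HA.
  have sq_le : C * (a + b + c) ^+ 2 <= C * (3 * (a ^+ 2 + b ^+ 2 + c ^+ 2)).
    rewrite ler_wpM2l//; have := sqr_ge0 (a - b); have := sqr_ge0 (b - c).
    by have := sqr_ge0 (a - c); lra.
  by lra.
have := le_of_derive T0 dE E'0.
rewrite /E !D0 expr0n !addr0 mul0r oppr0 oppr_ge0 pmulr_lle0 ?expR_gt0// => s0.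
have := sqr_ge0 (D i1 T); have := sqr_ge0 (D i2 T); have := sqr_ge0 (D i3 T).
by move=> *; apply: (@ord3_ind (fun i => D i T = 0)); apply/eqP; rewrite -sqrf_eq0; apply/eqP; lra.
Qed.

Let replicator_lip p (V W : 'I_3 -> R) (M : R) : 0 <= M ->
  (forall i, `|V i| <= M) -> (forall i, `|W i| <= M) ->
  forall i, `|V i * cross p V i - W i * cross p W i| <=
    2 * M * norm1 p * norm1 (fun j => V j - W j).
Proof.
move=> M0 VM WM i.
have -> : V i * cross p V i - W i * cross p W i =
    (V i - W i) * cross p V i + W i * (cross p V i - cross p W i) by ring.
rewrite crossB (le_trans (ler_normD _ _))// !normrM.
have h1 : `|V i - W i| * `|cross p V i| <=
    norm1 (fun j => V j - W j) * (norm1 p * M).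
  by rewrite ler_pM// ?cross_bound//; exact: (ler_norm1 (fun j => V j - W j)).
have h2 : `|W i| * `|cross p (fun j => V j - W j) i| <=
    M * (norm1 p * norm1 (fun j => V j - W j)).
  by rewrite ler_pM// cross_bound// => j; exact: (ler_norm1 (fun j => V j - W j)).
by lra.
Qed.

(** Two curves following the same orbit at the same prescribed speed [l] coincide.
    The speed is allowed to vary because conjugacies do not preserve time. *)
Lemma replicator_unique p (l : R -> R) (Lam : R) (V W : R -> 'I_3 -> R) :
  (forall t, `|l t| <= Lam) ->
  (forall t i, `|V t i| <= 1) -> (forall t i, `|W t i| <= 1) ->
  (forall (t : R) i, is_derive t 1 (V ^~ i) (l t * (2 * V t i * cross p (V t) i))) ->
  (forall (t : R) i, is_derive t 1 (W ^~ i) (l t * (2 * W t i * cross p (W t) i))) ->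
  V 0 = W 0 -> V = W.
Proof.
move=> lL V1 W1 dV dW VW0.
have Lam0 : 0 <= Lam := le_trans (normr_ge0 _) (lL 0).
have C0 : 0 <= Lam * (2 * (2 * 1 * norm1 p)) by rewrite !mulr_ge0 ?norm1_ge0.
have bound s i : `|l s * (2 * V s i * cross p (V s) i) -
    l s * (2 * W s i * cross p (W s) i)| <=
    Lam * (2 * (2 * 1 * norm1 p)) * norm1 (fun j => V s j - W s j).
  have -> : l s * (2 * V s i * cross p (V s) i) - l s * (2 * W s i * cross p (W s) i)
    = l s * (2 * (V s i * cross p (V s) i - W s i * cross p (W s) i)) by ring.
  rewrite normrM -[leRHS]mulrA ler_pM// normrM ger0_norm//.
  by have := replicator_lip p ler01 (V1 s) (W1 s) i; lra.
apply/funext => t; apply/funext => i; apply/eqP; rewrite -subr_eq0; apply/eqP.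
have [t0|/ltW t0] := leP 0 t.
  apply: (@gronwall (fun i s => V s i - W s i) (fun i s =>
    l s * (2 * V s i * cross p (V s) i) - l s * (2 * W s i * cross p (W s) i))
    t _ t0 C0); last by move=> j; rewrite VW0 subrr.
  by move=> j s _; exact: bound.
rewrite -[t]opprK.
apply: (@gronwall (fun i s => V (- s) i - W (- s) i) (fun i s =>
    - (l (- s) * (2 * V (- s) i * cross p (V (- s)) i) -
       l (- s) * (2 * W (- s) i * cross p (W (- s)) i)))
    (- t) _ _ C0).
- by rewrite oppr_ge0.
- move=> j s _; have ? := is_derive_reflect (dV (- s) j).
  by have ? := is_derive_reflect (dW (- s) j); deriv_ring.
- by move=> j s _; rewrite normrN; exact: bound.
- by move=> j; rewrite oppr0 VW0 subrr.
Qed.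

Lemma sq_sphere x : S2p x -> forall i, 0 <= sq x i <= 1.
Proof.
move=> /S2pE[_ x1] i; rewrite sqr_ge0/= -x1 sum3.
have := sqr_ge0 (x 0 i1); have := sqr_ge0 (x 0 i2); have := sqr_ge0 (x 0 i3).
by move: i; apply: ord3_ind; rewrite /sq; lra.
Qed.

Lemma sq_inj x y : S2p x -> S2p y -> sq x = sq y -> x = y.
Proof.
move=> /S2pE[x0 _] /S2pE[y0 _] xy; apply/rowP => i; apply/eqP.
by rewrite -(@eqrXn2 _ 2)//; have /(congr1 (@^~ i)) := xy; rewrite /sq => /= ->.
Qed.

Lemma sphere_sol_sq p g : sphere_sol p g -> forall (t : R) i,
  is_derive t 1 (fun s => sq (g s) i) (2 * sq (g t) i * cross p (sq (g t)) i).
Proof.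
by move=> [_ dg] t i; have ? := dg t i; rewrite {1 2}/sq; deriv_ring.
Qed.

Lemma sphere_sol_unique p g h : sphere_sol p g -> sphere_sol p h ->
  g 0 = h 0 -> g = h.
Proof.
move=> sg sh gh0.
have n1 x i : S2p x -> `|sq x i| <= 1.
  by move=> /sq_sphere/(_ i)/andP[? ?]; rewrite ger0_norm.
have gh : (fun t => sq (g t)) = (fun t => sq (h t)).
  have lam1 (t : R) : `|1 : R| <= 1 by rewrite normr1.
  have dsq k : sphere_sol p k -> forall (t : R) i,
      is_derive t 1 (fun s => sq (k s) i) (1 * (2 * sq (k t) i * cross p (sq (k t)) i)).
    by move=> sk t i; rewrite mul1r; exact: sphere_sol_sq.
  apply: (replicator_unique lam1 _ _ (dsq g sg) (dsq h sh)).
  - by move=> t i; apply: n1; have [] := sg.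
  - by move=> t i; apply: n1; have [] := sh.
  - by rewrite gh0.
apply/funext => t; apply: sq_inj; [by have [] := sg|by have [] := sh|].
exact: (congr1 (@^~ t) gh).
Qed.

End Uniqueness.

(** * Topology of row vectors and of the sphere *)

Section RealValuedContinuity.
Variables (R : realType) (T : topologicalType).
Implicit Types (f g : T -> R) (x : T).

Lemma ctsD f g x : {for x, continuous f} -> {for x, continuous g} ->
  {for x, continuous (fun y => f y + g y)}.
Proof. by move=> cf cg; exact: (@continuousD _ R^o). Qed.

Lemma ctsB f g x : {for x, continuous f} -> {for x, continuous g} ->
  {for x, continuous (fun y => f y - g y)}.
Proof. by move=> cf cg; exact: (@continuousB _ R^o). Qed.

Lemma ctsM f g x : {for x, continuous f} -> {for x, continuous g} ->
  {for x, continuous (fun y => f y * g y)}.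
Proof. by move=> cf cg; exact: continuousM. Qed.

Lemma cts_sqr f x : {for x, continuous f} -> {for x, continuous (fun y => f y ^+ 2)}.
Proof. by move=> cf; exact: (ctsM cf cf). Qed.

Lemma cts_div f g x : {for x, continuous f} -> {for x, continuous g} ->
  g x != 0 -> {for x, continuous (fun y => f y / g y)}.
Proof. by move=> cf cg gx; apply: ctsM => //; exact: continuousV. Qed.

Lemma cts_comp f (h : R -> R) x : {for x, continuous f} ->
  {for f x, continuous h} -> {for x, continuous (fun y => h (f y))}.
Proof. by move=> cf ch; exact: continuous_comp cf ch. Qed.

Lemma cts_cst (a : R) x : {for x, continuous (fun _ : T => a)}.
Proof. exact: cst_continuous. Qed.

End RealValuedContinuity.

Section RowTopology.
Variable R : realType.
Implicit Types (x y : 'rV[R]_3).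

Lemma row_norm_le x (e : R) : 0 <= e -> (forall i, `|x 0 i| <= e) -> `|x| <= e.
Proof.
move=> e0 xe; rewrite /Num.Def.normr/= mx_normrE (bigmax_le _ e0)//= => -[i j] _ /=.
by rewrite (ord1 i).
Qed.

Lemma row_norm_ge x i : `|x 0 i| <= `|x|.
Proof.
by rewrite [leRHS]/Num.Def.normr/= mx_normrE; exact: (le_bigmax _ _ (0, i)).
Qed.

Lemma cvg_rowP (T : Type) (F : set_system T) {FF : Filter F} (f : T -> 'rV[R]_3) y :
  f @ F --> y <-> forall i, f t 0 i @[t --> F] --> y 0 i.
Proof.
split=> [fy i|fy].
  apply/cvgrPdist_le => e e0; move/cvgrPdist_le : fy => /(_ e e0).
  apply: filterS => t; apply: le_trans.
  by have := row_norm_ge (y - f t) i; rewrite !mxE.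
apply/cvgrPdist_le => e e0.
have h i : \forall t \near F, `|y 0 i - f t 0 i| <= e.
  by move/cvgrPdist_le : (fy i) => /(_ e e0).
have := filter_forall _ h => /(_ FF).
apply: filterS => t yt; apply: row_norm_le; first exact: ltW.
by move=> i; rewrite !mxE.
Qed.

Lemma continuous_rowP (T : topologicalType) (f : T -> 'rV[R]_3) t :
  {for t, continuous f} <-> forall i, {for t, continuous (fun s => f s 0 i)}.
Proof. exact: cvg_rowP. Qed.

Lemma coord_continuous3 i : continuous (fun x => x 0 i).
Proof. by move=> x; have /continuous_rowP := @cvg_id _ (nbhs x); exact. Qed.

Lemma enorm_continuous : continuous (@enorm R).
Proof.
rewrite (_ : @enorm R =
  fun x => Num.sqrt (x 0 i1 * x 0 i1 + x 0 i2 * x 0 i2 + x 0 i3 * x 0 i3)); last first.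
  by apply/funext => x; rewrite /enorm sum3 !expr2.
move=> x; apply: (@cts_comp _ _ (fun x : 'rV[R]_3 =>
  x 0 i1 * x 0 i1 + x 0 i2 * x 0 i2 + x 0 i3 * x 0 i3) Num.sqrt); last first.
  exact: sqrt_continuous.
by apply: ctsD; [apply: ctsD|]; apply: ctsM; exact: coord_continuous3.
Qed.

Lemma enormE x : enorm x ^+ 2 = \sum_i sq x i.
Proof. by rewrite /enorm sqr_sqrtr// sumr_ge0// => i _; rewrite sqr_ge0. Qed.

Lemma enorm_gt0 x : x != 0 -> 0 < enorm x.
Proof.
move=> x0; rewrite sqrtr_gt0 lt_def sumr_ge0 ?andbT; last by move=> i _; rewrite sqr_ge0.
apply: contra x0 => /eqP h; apply/eqP/rowP => i; rewrite mxE; apply/eqP.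
rewrite -sqrf_eq0; apply/eqP.
by apply: (psumr_eq0P _ h) => // j _; rewrite sqr_ge0.
Qed.

Lemma enorm_normalize x : R3p x -> x != 0 -> S2p ((enorm x)^-1 *: x).
Proof.
move=> x0 xn0; have e0 := enorm_gt0 xn0; apply/S2pE; split=> [i|].
  by rewrite mxE mulr_ge0 ?invr_ge0 ?(ltW e0).
under eq_bigr do rewrite /sq mxE exprMn.
by rewrite -mulr_sumr -[X in _ * X]enormE -exprMn mulVf ?expr1n// gt_eqF.
Qed.

Lemma S2p_closed : closed (@S2p R).
Proof.
have -> : @S2p R = \bigcap_(i in [set: 'I_3]) ((fun x => x 0 i) @^-1` [set r | 0 <= r])
    `&` (@enorm R) @^-1` [set r | r = 1].
  by apply/seteqP; split=> x [x0 x1]; split=> // i; [move=> _|]; exact: x0.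
apply: closedI; last first.
  by apply: preimage_closed => [x _|]; [exact: enorm_continuous|exact: closed_eq].
apply: closed_bigI => i _.
by apply: preimage_closed => [x _|]; [exact: coord_continuous3|exact: closed_ge].
Qed.

Lemma S2p_norm_le1 x i : S2p x -> `|x 0 i| <= 1.
Proof.
move=> xS; have /andP[_] := sq_sphere xS i.
by rewrite /sq -(real_normK (num_real _)) expr_le1.
Qed.

Lemma S2p_compact : compact (@S2p R).
Proof.
apply: bounded_closed_compact; last exact: S2p_closed.
exists 1; split; first by rewrite num_real.
move=> M M1 x xS; apply: row_norm_le; first by rewrite ltW// (lt_trans _ M1).
by move=> i; rewrite (le_trans (S2p_norm_le1 _ xS))// ltW.
Qed.

End RowTopology.

(** * From the sphere to the octant *)

Section LogisticTime.
Variable R : realType.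
Variables (a c : R).
Hypotheses (a0 : 0 < a) (c0 : 0 < c).

(** With [c] the initial squared radius, the squared radius at time [t] is
    [c * expR (2 * a * t) / growth a c t]. *)
Definition growth (t : R) : R := 1 + c * (expR (2 * a * t) - 1).
(** Integral of the squared radius from 0 to [t]: the time elapsed for the angular
    part. *)
Definition ltime (t : R) : R := ln (growth t) / (2 * a).

Lemma growth_ge t : 0 <= t -> 1 + 2 * a * c * t <= growth t.
Proof.
move=> t0; rewrite /growth lerD2l.
have := expR_ge1Dx (2 * a * t); rewrite -lerBrDl => h.
by have := ler_wpM2l (ltW c0) h; rewrite -!mulrA; congr (_ <= _); ring.
Qed.

Lemma growth_ge1 t : 0 <= t -> 1 <= growth t.
Proof.
move=> t0; apply: le_trans (growth_ge t0).
by rewrite lerDl mulr_ge0// mulr_ge0 ?(ltW c0)// mulr_ge0// ltW.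
Qed.

Lemma growth_gt0 t : 0 <= t -> 0 < growth t.
Proof. by move=> t0; apply: lt_le_trans (growth_ge1 t0). Qed.

Lemma ltime_ge0 t : 0 <= t -> 0 <= ltime t.
Proof.
by move=> t0; rewrite /ltime divr_ge0 ?ln_ge0 ?growth_ge1// mulr_ge0// ltW.
Qed.

Lemma expR_ltime t : 0 <= t -> expR (2 * a * ltime t) = growth t.
Proof.
move=> t0; rewrite /ltime mulrCA divff ?mulr1; last by rewrite gt_eqF ?mulr_gt0.
by rewrite lnK// posrE growth_gt0.
Qed.

Lemma ltime_homo s t : 0 <= s -> s <= t -> ltime s <= ltime t.
Proof.
move=> s0 st; have t0 := le_trans s0 st.
rewrite /ltime ler_wpM2r ?invr_ge0 ?mulr_ge0 ?(ltW a0)//.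
rewrite ler_ln ?posrE ?growth_gt0// /growth lerD2l ler_wpM2l ?(ltW c0)//.
by rewrite lerD2r ler_expR ler_wpM2l ?mulr_ge0 ?(ltW a0).
Qed.

End LogisticTime.

Section LogisticTimeInverse.
Variable R : realType.
Variables (a c : R).
Hypotheses (a0 : 0 < a) (c0 : 0 < c).

(** The change of time for the inverse of the initial squared radius is the inverse
    change of time. *)
Lemma ltimeK t : 0 <= t -> ltime a c^-1 (ltime a c t) = t.
Proof.
move=> t0.
have e : growth a c^-1 (ltime a c t) = expR (2 * a * t).
  by rewrite {1}/growth expR_ltime// /growth; field; rewrite gt_eqF.
by rewrite {1}/ltime e expRK mulrC mulKf// gt_eqF ?mulr_gt0.
Qed.

End LogisticTimeInverse.

Lemma ltime_cvgy (R : realType) (a c : R) (T : Type) (F : set_system T)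
    {FF : Filter F} (u : T -> R) : 0 < a -> 0 < c ->
  u @ F --> +oo -> ltime a c (u t) @[t --> F] --> +oo.
Proof.
move=> a0 c0 uy; apply/cvgryPge => A.
have c'0 : 0 < c^-1 by rewrite invr_gt0.
pose B := ltime a c^-1 (Num.max A 0).
have A0 : 0 <= Num.max A 0 by rewrite le_max lexx orbT.
have B0 : 0 <= B by rewrite ltime_ge0.
move/cvgryPge : uy => /(_ B); apply: filterS => t Bt.
apply: (@le_trans _ _ (ltime a c B)); last exact: ltime_homo.
by have := ltimeK a0 c'0 A0; rewrite invrK => ->; rewrite le_max lexx.
Qed.

Section Trajectories.
Variable R : realType.
Variables (alpha : R) (d : 'I_3 -> R).
Hypothesis alpha0 : 0 < alpha.
Let p := exponents alpha d.
Implicit Types (x : 'rV[R]_3) (g : R -> 'rV[R]_3).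

Definition radius x (t : R) : R :=
  enorm x * expR (alpha * t) / Num.sqrt (growth alpha (enorm x ^+ 2) t).

(** The field is the sum of a radial part and of |x|^2 times a tangent part, so the
    direction follows the flow on the sphere at the speed |x|^2. *)
Definition radial_lift x g (t : R) : 'rV[R]_3 :=
  radius x t *: g (ltime alpha (enorm x ^+ 2) t).

Section Lift.
Variables (x : 'rV[R]_3) (g : R -> 'rV[R]_3).
Hypotheses (xn0 : x != 0) (sg : sphere_sol p g) (g0 : g 0 = (enorm x)^-1 *: x).

Let r0 := enorm_gt0 xn0.
Let c0 : 0 < enorm x ^+ 2. Proof. exact: exprn_gt0. Qed.
Let E := growth alpha (enorm x ^+ 2).
Let E0 (t : R) : 0 <= t -> 0 < E t. Proof. exact: growth_gt0. Qed.

Lemma radius_gt0 t : 0 <= t -> 0 < radius x t.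
Proof.
by move=> t0; rewrite divr_gt0 ?sqrtr_gt0 ?E0// mulr_gt0 ?expR_gt0.
Qed.

Lemma radius_sq t : 0 <= t ->
  radius x t ^+ 2 = enorm x ^+ 2 * expR (2 * alpha * t) / E t.
Proof.
move=> t0; rewrite /radius expr_div_n exprMn (sqr_sqrtr (ltW (E0 t0))).
have -> : 2 * alpha * t = 2%:R * (alpha * t) by rewrite mulrA.
by rewrite expRM_natl.
Qed.

(** The gap of the squared radius to 1 is divided by [growth], which is at least
    linear; this explicit bound is uniform over compact sets of initial points. *)
Lemma radius_dist t : 0 <= t -> `|radius x t - 1| <=
  `|enorm x ^+ 2 - 1| / (1 + 2 * alpha * enorm x ^+ 2 * t).
Proof.
move=> t0; apply: (@le_trans _ _ `|radius x t ^+ 2 - 1|).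
  have -> : radius x t ^+ 2 - 1 = (radius x t - 1) * (radius x t + 1) by ring.
  by rewrite normrM ler_peMr// ger0_norm; have := radius_gt0 t0; lra.
have -> : radius x t ^+ 2 - 1 = (enorm x ^+ 2 - 1) / E t.
  by rewrite radius_sq//; have := E0 t0; rewrite /E/growth => ?; field; rewrite gt_eqF.
rewrite normrM normfV (gtr0_norm (E0 t0)) ler_wpM2l// lef_pV2 ?posrE ?E0//.
  exact: growth_ge.
by rewrite ltr_pwDl// mulr_ge0// mulr_ge0 ?(ltW c0)// mulr_ge0// ltW.
Qed.

Lemma radius_cvg (T : Type) (F : set_system T) {FF : Filter F} (u : T -> R) :
  u @ F --> +oo -> radius x (u t) @[t --> F] --> (1 : R).
Proof.
move=> uy; apply/cvgrPdist_le => e e0.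
pose A := `|enorm x ^+ 2 - 1| / e / (2 * alpha * enorm x ^+ 2).
have k0 : 0 < 2 * alpha * enorm x ^+ 2 by rewrite !mulr_gt0.
have A0 : 0 <= A by rewrite !divr_ge0// ltW.
move/cvgryPge : uy => /(_ A); apply: filterS => t At.
have t0 := le_trans A0 At.
rewrite distrC (le_trans (radius_dist t0))//.
have D0 : 0 < 1 + 2 * alpha * enorm x ^+ 2 * u t.
  by rewrite ltr_pwDl// mulr_ge0// ltW.
rewrite ler_pdivrMr//.
move: At; rewrite /A ler_pdivrMr// ler_pdivrMr// => h.
by rewrite (le_trans h)//; nra.
Qed.

Lemma radial_lift0 : radial_lift x g 0 = x.
Proof.
rewrite /radial_lift /radius /ltime /growth !mulr0 expR0 subrr mulr0 addr0.
by rewrite ln1 mul0r sqrtr1 divr1 mulr1 g0 scalerA divff ?scale1r ?gt_eqF.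
Qed.

Let dE (t : R) : is_derive t 1 E (2 * alpha * enorm x ^+ 2 * expR (2 * alpha * t)).
Proof. by rewrite /E /growth; deriv_ring. Qed.

Let d_ltime (t : R) : 0 <= t ->
  is_derive t 1 (ltime alpha (enorm x ^+ 2)) (radius x t ^+ 2).
Proof.
move=> t0; have ? := dE t.
have dl : is_derive t 1 (fun s => ln (E s)) ((E t)^-1 * (2 * alpha * enorm x ^+ 2 * expR (2 * alpha * t))).
  by apply: is_derive_comp1; apply: is_derive1_ln; exact: E0.
rewrite /ltime -/E; apply: is_derive_eq; rewrite radius_sq//.
rewrite /GRing.scale/=; field; rewrite !gt_eqF//; exact: E0.
Qed.

(** Logarithmic differentiation: near [t] the radius is the exponential of
    [alpha * s - ln (E s) / 2] up to a constant factor. *)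
Let d_radius (t : R) : 0 <= t ->
  is_derive t 1 (radius x) (radius x t * (alpha * (1 - radius x t ^+ 2))).
Proof.
move=> t0; have ? := dE t.
have Et := E0 t0.
have dl : is_derive t 1 (fun s => ln (E s)) ((E t)^-1 * (2 * alpha * enorm x ^+ 2 * expR (2 * alpha * t))).
  by apply: is_derive_comp1; apply: is_derive1_ln; exact: E0.
have near_r : \forall s \near t,
    enorm x * expR (alpha * s - ln (E s) / 2) = radius x s.
  have cE : {for t, continuous E} by exact: is_derive_continuous (dE t).
  have : \forall s \near t, 0 < E s by exact: (cvgr_gt _ cE).
  apply: filterS => s Es.
  rewrite /radius -/E -powR12_sqrt ?ltW// /powR gt_eqF// expRD -expRN mulrA.
  by congr (_ * expR (- _)); rewrite mulrC.
apply: (near_eq_is_derive near_r).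
apply: is_derive_eq.
rewrite /GRing.scale/= radius_sq// -(nbhs_singleton near_r).
by field; rewrite gt_eqF.
Qed.

Lemma radial_lift_trajectory : trajectory alpha d x (radial_lift x g).
Proof.
split; last exact: radial_lift0.
move=> t; rewrite in_itv/= andbT => t0; apply/is_derive_rowP => i.
rewrite field_DE -/p.
set s := ltime alpha (enorm x ^+ 2) t.
have sqE : sq (radial_lift x g t) = fun j => radius x t ^+ 2 * sq (g s) j.
  by apply/funext => j; rewrite /sq mxE exprMn.
have crossE : cross p (sq (radial_lift x g t)) i =
    radius x t ^+ 2 * cross p (sq (g s)) i.
  by rewrite sqE; move: i; apply: ord3_ind; rewrite /cross !vec3E; ring.
have sumE : \sum_j sq (radial_lift x g t) j = radius x t ^+ 2.
  rewrite sqE -mulr_sumr; have [gS _] := sg.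
  by have /S2pE[_ ->] := gS s; rewrite mulr1.
rewrite sumE crossE.
rewrite (_ : (fun u => _) = fun u => radius x u * g (ltime alpha (enorm x ^+ 2) u) 0 i); last first.
  by apply/funext => u; rewrite mxE.
have ? := d_radius t0.
have dgi := sg.2 s i.
have ? := is_derive_comp1 (g := ltime alpha (enorm x ^+ 2)) dgi (d_ltime t0).
apply: is_derive_eq; rewrite mxE -/s /GRing.scale/=; ring.
Qed.

End Lift.
End Trajectories.

Section TrajectoryUniqueness.
Variable R : realType.
Variables (alpha : R) (d : 'I_3 -> R).
Let p := exponents alpha d.
Implicit Types (x y : 'rV[R]_3) (g h : R -> 'rV[R]_3).

(** The constant is explicit because it must only depend on a common bound for the
    two points. *)
Let field_lip x y (M : R) : 0 <= M ->
  (forall i, `|x 0 i| <= M) -> (forall i, `|y 0 i| <= M) ->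
  forall i, `|field_D alpha d x 0 i - field_D alpha d y 0 i| <=
    (`|alpha| * (1 + 3 * M ^+ 2) + norm1 p * M ^+ 2
      + M * (`|alpha| * (2 * M) + norm1 p * (2 * M))) *
    norm1 (fun j => x 0 j - y 0 j).
Proof.
move=> M0 xM yM i; rewrite !field_DE -/p.
set r := norm1 (fun j => x 0 j - y 0 j).
have r0 : 0 <= r by exact: norm1_ge0.
have sqM (z : 'rV[R]_3) j : (forall i, `|z 0 i| <= M) -> `|sq z j| <= M ^+ 2.
  by move=> zM; rewrite /sq normrX lerXn2r ?nnegrE.
have sqB j : `|sq x j - sq y j| <= 2 * M * `|x 0 j - y 0 j|.
  rewrite /sq subr_sqr normrM mulrC ler_wpM2r//.
  by rewrite (le_trans (ler_normD _ _))//; have := xM j; have := yM j; lra.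
have sqBr j : `|sq x j - sq y j| <= 2 * M * r.
  rewrite (le_trans (sqB j))// ler_wpM2l ?mulr_ge0//.
  exact: (ler_norm1 (fun j => x 0 j - y 0 j)).
have sumB : `|\sum_j sq x j - \sum_j sq y j| <= 2 * M * r.
  rewrite -sumrB sum3 /r /norm1 (le_trans (ler_normD _ _))//.
  have := sqB i1; have := sqB i2; have := sqB i3.
  by have := ler_normD (sq x i1 - sq y i1) (sq x i2 - sq y i2); lra.
have sumM : `|\sum_j sq x j| <= 3 * M ^+ 2.
  rewrite sum3 (le_trans (ler_normD _ _))//.
  have := sqM x i1 xM; have := sqM x i2 xM; have := sqM x i3 xM.
  by have := ler_normD (sq x i1) (sq x i2); lra.
set G := fun z => alpha * (1 - \sum_j sq z j) + cross p (sq z) i.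
have GM : `|G x| <= `|alpha| * (1 + 3 * M ^+ 2) + norm1 p * M ^+ 2.
  rewrite (le_trans (ler_normD _ _))// lerD//.
    rewrite normrM ler_wpM2l// (le_trans (ler_normB _ _))// normr1 lerD2l//.
  by apply: cross_bound => j; exact: sqM.
have GB : `|G x - G y| <= `|alpha| * (2 * M * r) + norm1 p * (2 * M * r).
  have -> : G x - G y = - (alpha * (\sum_j sq x j - \sum_j sq y j))
      + (cross p (sq x) i - cross p (sq y) i) by rewrite /G; ring.
  rewrite (le_trans (ler_normD _ _))// normrN normrM lerD ?ler_wpM2l//.
  by rewrite crossB; exact: cross_bound.
rewrite -/(G x) -/(G y).
have -> : x 0 i * G x - y 0 i * G y = (x 0 i - y 0 i) * G x + y 0 i * (G x - G y).
  by ring.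
rewrite (le_trans (ler_normD _ _))// !normrM.
have h1 : `|x 0 i - y 0 i| * `|G x| <=
    r * (`|alpha| * (1 + 3 * M ^+ 2) + norm1 p * M ^+ 2).
  by rewrite ler_pM//; exact: (ler_norm1 (fun j => x 0 j - y 0 j)).
have h2 : `|y 0 i| * `|G x - G y| <=
    M * (`|alpha| * (2 * M * r) + norm1 p * (2 * M * r)) by rewrite ler_pM.
by lra.
Qed.

(** Two trajectories remain in a common compact set on each [[0, T]], where the
    field is Lipschitz. *)
Lemma trajectory_unique x g h : trajectory alpha d x g -> trajectory alpha d x h ->
  forall t, 0 <= t -> g t = h t.
Proof.
move=> [sg g0] [sh h0] T T0.
have dk k (t : R) i : solution alpha d `[0, +oo[ k -> 0 <= t <= T ->
    is_derive t 1 (fun s => k s 0 i) (field_D alpha d (k t) 0 i).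
  move=> sk /andP[t0 _]; have /is_derive_rowP : is_derive t 1 k (field_D alpha d (k t)).
    by apply: sk; rewrite in_itv/= t0.
  exact.
pose S t := sq (g t) i1 + sq (g t) i2 + sq (g t) i3 +
  (sq (h t) i1 + sq (h t) i2 + sq (h t) i3).
have cS : {within `[0, T], continuous S}.
  apply: continuous_in_subspaceT => t; rewrite inE/= in_itv/= => tT.
  have c k i : solution alpha d `[0, +oo[ k -> {for t, continuous (fun s => sq (k s) i)}.
    move=> sk; apply: cts_sqr; exact: is_derive_continuous (dk k t i sk tT).
  have ab k : solution alpha d `[0, +oo[ k -> {for t, continuous
      (fun s => sq (k s) i1 + sq (k s) i2 + sq (k s) i3)}.
    by move=> sk; exact: ctsD (ctsD (c k i1 sk) (c k i2 sk)) (c k i3 sk).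
  exact: ctsD (ab g sg) (ab h sh).
have [m _ Sm] := EVT_max T0 cS.
have S0 t i : sq (g t) i <= S t /\ sq (h t) i <= S t.
  have q k j : 0 <= sq (k t) j :> R by exact: sqr_ge0.
  have := q g i1; have := q g i2; have := q g i3.
  have := q h i1; have := q h i2; have := q h i3.
  by rewrite /S; split; move: i; apply: ord3_ind; lra.
(* a bound for the coordinates, since [|a| <= 1 + a ^ 2] *)
pose M := 1 + S m.
have Sm0 : 0 <= S m by have [+ _] := S0 m i1; apply: le_trans; exact: sqr_ge0.
have M0 : 0 <= M by rewrite addr_ge0.
have bd (a : R) : a ^+ 2 <= S m -> `|a| <= M.
  rewrite -(real_normK (num_real a)) /M => a2.
  by have := sqr_ge0 (`|a| - 1); nra.
have gM t i : 0 <= t <= T -> `|g t 0 i| <= M.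
  move=> tT; apply: bd; have [+ _] := S0 t i; move=> /le_trans; apply.
  by apply: Sm; rewrite in_itv.
have hM t i : 0 <= t <= T -> `|h t 0 i| <= M.
  move=> tT; apply: bd; have [_ +] := S0 t i; move=> /le_trans; apply.
  by apply: Sm; rewrite in_itv.
apply/rowP => i; apply/eqP; rewrite -subr_eq0; apply/eqP.
have C0 := field_lip M0.
apply: (@gronwall _ (fun i s => g s 0 i - h s 0 i)
  (fun i s => field_D alpha d (g s) 0 i - field_D alpha d (h s) 0 i) T
  (`|alpha| * (1 + 3 * M ^+ 2) + norm1 p * M ^+ 2
      + M * (`|alpha| * (2 * M) + norm1 p * (2 * M))) T0).
- have := norm1_ge0 p; have := normr_ge0 alpha => *.
  by rewrite !addr_ge0// ?mulr_ge0// ?addr_ge0// ?mulr_ge0// ?sqr_ge0.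
- move=> j t tT; have ? := dk g t j sg tT; have ? := dk h t j sh tT.
  by deriv_ring.
- by move=> j t tT; apply: field_lip => // k; [exact: gM|exact: hM].
- by move=> j; rewrite g0 h0 subrr.
Qed.

End TrajectoryUniqueness.

(** * Limit sets *)

Section OmegaLimits.
Variable R : realType.
Implicit Types (x y Q : 'rV[R]_3) (p : 'I_3 -> R) (g h : R -> 'rV[R]_3).

(** Limit set of a complete solution, to be compared with [omega_limit], which
    quantifies over all trajectories from a point. *)
Definition Omega g : set 'rV[R]_3 := [set y | exists u : R^nat,
  u @ \oo --> +oo /\ g (u n) @[n --> \oo] --> y].

Lemma sphere_sol_continuous p g : sphere_sol p g -> continuous g.
Proof.
move=> [_ dg] t; apply/continuous_rowP => i; exact: is_derive_continuous (dg t i).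
Qed.

Lemma Omega_cvg g Q : g t @[t --> +oo] --> Q -> Omega g = [set Q].
Proof.
move=> gQ; apply/seteqP; split=> [y [u [uy guy]]|_ ->].
  have guQ : g (u n) @[n --> \oo] --> Q by exact: cvg_comp uy gQ.
  exact: (cvg_unique (@norm_hausdorff _ _) guy guQ).
exists (fun n => n%:R); split; first exact: cvgr_idn.
by apply: cvg_comp gQ; exact: cvgr_idn.
Qed.

Lemma periodic_nat g T : (forall t, g (t + T) = g t) ->
  forall t (n : nat), g (t + n%:R * T) = g t.
Proof.
move=> gT t; elim=> [|n IH]; first by rewrite mul0r addr0.
by rewrite -natr1 mulrDl mul1r addrA gT.
Qed.

(** The range is compact, hence closed, which gives one inclusion; for the other, a
    point is reached again after each period. *)
Lemma Omega_periodic g T : continuous g -> 0 < T ->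
  (forall t, g (t + T) = g t) -> Omega g = range g.
Proof.
move=> cg T0 gT; have gnT := periodic_nat gT.
have rangeE : range g = g @` `[0, T]%classic.
  apply/seteqP; split=> [_ [t _ <-]|_ [t _ <-]]; last by exists t.
  pose n := (Num.floor (t / T)).
  exists (t - n%:~R * T).
    rewrite /= in_itv/=; have := floor_itv (t / T); rewrite -/n => /andP[].
    rewrite ler_pdivlMr// ltr_pdivrMr// intrD mulrDl mul1r.
    by move=> h1 h2; apply/andP; split; lra.
  case: n => k; first by rewrite -[in RHS](subrK (k%:R * T) t) gnT.
  rewrite NegzE mulrNz mulNr opprK; exact: gnT.
have clr : closed (range g).
  rewrite rangeE; apply: compact_closed; first exact: norm_hausdorff.
  by apply: continuous_compact; [exact: continuous_subspaceT|exact: segment_compact].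
apply/seteqP; split=> [y [u [uy guy]]|_ [s _ <-]].
  apply: (closed_cvg (range g) _ _ _ guy) => //.
  by apply: nearW => n; exists (u n).
exists (fun n => s + n%:R * T); split; last first.
  by under eq_fun do rewrite gnT; exact: cvg_cst.
apply/cvgryPge => A.
have : \forall n \near \oo, (A - s) / T <= n%:R.
  by have /cvgryPge := @cvgr_idn R; exact.
by apply: filterS => n; rewrite ler_pdivrMr//; lra.
Qed.

Section RadialReduction.
Variables (alpha : R) (d : 'I_3 -> R).
Hypothesis alpha0 : 0 < alpha.
Let p := exponents alpha d.

(** Uniqueness identifies every trajectory from [x] with the radial lift of [g].  The
    radius tends to 1 and the change of time tends to infinity and is invertible, so
    the limits along the two curves are the same. *)
Lemma omega_limitE x g : x != 0 -> sphere_sol p g -> g 0 = (enorm x)^-1 *: x ->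
  omega_limit alpha d x = Omega g.
Proof.
move=> xn0 sg g0.
have tr := radial_lift_trajectory alpha0 xn0 sg g0.
have c0 : 0 < enorm x ^+ 2 by rewrite exprn_gt0// enorm_gt0.
have c'0 : 0 < (enorm x ^+ 2)^-1 by rewrite invr_gt0.
have near0 (u : R^nat) : u @ \oo --> +oo -> \forall n \near \oo, 0 <= u n.
  by move=> /cvgryPge; exact.
apply/seteqP; split=> y.
  move=> [h [u [trh uy huy]]].
  exists (fun n => ltime alpha (enorm x ^+ 2) (u n)); split; first exact: ltime_cvgy.
  have ru : radius alpha x (u n) @[n --> \oo] --> (1 : R) by exact: radius_cvg.
  apply/cvg_rowP => i.
  have hui : h (u n) 0 i @[n --> \oo] --> y 0 i by move/cvg_rowP : huy; exact.
  have h1 : (radius alpha x (u n))^-1 * h (u n) 0 i @[n --> \oo] --> 1^-1 * y 0 i.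
    by apply: cvgM hui; apply: cvgV => //; exact: oner_neq0.
  move: h1; rewrite invr1 mul1r => h1; apply: cvg_trans h1; apply: near_eq_cvg.
  near=> n; have u0 : 0 <= u n by near: n; exact: near0.
  rewrite (trajectory_unique trh tr u0) /radial_lift /= mxE mulrA mulVf ?mul1r//.
  by rewrite gt_eqF// radius_gt0.
move=> [w [wy gwy]].
pose u n := ltime alpha (enorm x ^+ 2)^-1 (w n).
have uy : u @ \oo --> +oo by exact: ltime_cvgy.
exists (radial_lift alpha x g), u; split=> //.
have ru : radius alpha x (u n) @[n --> \oo] --> (1 : R) by exact: radius_cvg.
apply/cvg_rowP => i.
have gwi : g (w n) 0 i @[n --> \oo] --> y 0 i by move/cvg_rowP : gwy; exact.
have h1 : radius alpha x (u n) * g (w n) 0 i @[n --> \oo] --> 1 * y 0 i.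
  exact: cvgM ru gwi.
move: h1; rewrite mul1r => h1; apply: cvg_trans h1; apply: near_eq_cvg.
near=> n; have w0 : 0 <= w n by near: n; exact: near0.
by rewrite /radial_lift mxE /u; have := ltimeK alpha0 c'0 w0; rewrite invrK => ->.
Unshelve. all: by end_near. Qed.

Lemma equilibriumE x : S2p x -> equilibrium alpha d x <->
  forall i, x 0 i * cross p (sq x) i = 0.
Proof.
move=> /S2pE[_ x1]; have fE i : field_D alpha d x 0 i = x 0 i * cross p (sq x) i.
  by rewrite field_DE x1 subrr mulr0 add0r.
split=> [e i|e]; first by rewrite -fE e mxE.
by apply/rowP => i; rewrite fE e mxE.
Qed.

Lemma sphere_sol_trajectory x g : sphere_sol p g -> g 0 = x -> trajectory alpha d x g.
Proof.
move=> sg g0; split=> // t _.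
by have [cs _] := (sphere_solP alpha d g).2 sg; exact: cs.
Qed.

Lemma goes_toE x y g : sphere_sol p g -> g 0 = x ->
  goes_to alpha d x y <-> g t @[t --> +oo] --> y.
Proof.
move=> sg g0; have tr := sphere_sol_trajectory sg g0; split=> [[h trh hy]|]; last by exists g.
apply: cvg_trans hy; apply: near_eq_cvg; near=> t.
apply: (trajectory_unique trh tr).
by near: t; exact: nbhs_pinfty_ge.
Unshelve. all: by end_near. Qed.

End RadialReduction.
End OmegaLimits.

(** * Attraction by the sphere *)

Section Attraction.
Variable R : realType.
Implicit Types (x y Q : 'rV[R]_3) (p : 'I_3 -> R) (g h : R -> 'rV[R]_3).

Lemma e_E i j : (e_ i : 'rV[R]_3) 0 j = (j == i)%:R.
Proof. by rewrite /e_ mxE eqxx. Qed.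

Lemma S2p_e i : S2p (e_ i : 'rV[R]_3).
Proof.
apply/S2pE; split=> [j|]; first by rewrite e_E ler0n.
by rewrite sum3 /sq !e_E; move: i; apply: ord3_ind; rewrite !expr2 /=; ring.
Qed.

Lemma S2p_neq0 x : S2p x -> x != 0.
Proof.
move=> /S2pE[_ x1]; apply/eqP => x0; move: x1; rewrite x0 big1 => [/eqP|i _].
  by rewrite eq_sym oner_eq0.
by rewrite /sq mxE expr0n.
Qed.

Lemma S2p_enorm x : S2p x -> enorm x = 1.
Proof. by case. Qed.

(** Lebesgue number of a compact set in an open one. *)
Lemma tubular_neighborhood (S U : set 'rV[R]_3) : compact S -> open U -> S `<=` U ->
  exists2 e, 0 < e & forall y, S y -> ball y e `<=` U.
Proof.
move=> cS oU SU.
have /compact_near_coveringP cov := cS.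
have := cov R (0^'+) (fun e y => ball y e `<=` U) _.
case=> [x Sx|e /= e0 H].
  have /nbhs_ballP[e /= e0 eU] : nbhs x U by apply: open_nbhs_nbhs; split=> //; exact: SU.
  exists (ball x (e / 2), [set e' | e' <= e / 2]).
    split; first by apply: nbhsx_ballx; rewrite divr_gt0.
    by apply: nbhs_right_le; rewrite divr_gt0.
  move=> [y e'] /= [xy e'e] z yz; apply: eU.
  rewrite (splitr e); apply: ball_triangle xy _.
  exact: le_ball yz.
exists (e / 2); first by rewrite divr_gt0.
move=> y Sy; apply: (H (e / 2)) => //; last by rewrite divr_gt0.
by rewrite /ball_/= sub0r normrN gtr0_norm ?divr_gt0// ltr_pdivrMr// ltr_pMr// ltr1n.
Qed.

(** The trajectory from [x] is at distance at most |radius - 1| from the sphere, and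
    the extreme values of the norm on a compact set bound this uniformly. *)
Lemma sphere_attractor alpha (d : 'I_3 -> R) : 0 < alpha ->
  global_attractor alpha d (R3p `\ 0) S2p.
Proof.
move=> a0; split.
- exact: S2p_compact.
- by exists (e_ i1); exact: S2p_e.
- by move=> x xS; split; [case: xS|exact/eqP/S2p_neq0].
- move=> x xS; have [g [sg g0 _]] := sphere_sol_exists (exponents alpha d) xS.
  by have [cs rg] := (sphere_solP alpha d g).2 sg; exists g.
move=> K U cK KX oU SU.
have [e e0 eU] := tubular_neighborhood (@S2p_compact R) oU SU.
have [->|K0] := eqVneq K set0; first by exists 0.
have {}K0 : K !=set0 by exact/set0P.
have cn : {within K, continuous (@enorm R)}.
  by apply: continuous_subspaceT; exact: enorm_continuous.
have [m mK mP] := EVT_min_rV K0 cK cn.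
have [M _ MP] := EVT_max_rV K0 cK cn.
have m0 : 0 < enorm m.
  by apply: enorm_gt0; have [_ /eqP] := KX _ (set_mem mK).
have M0 : 0 <= enorm M by exact: sqrtr_ge0.
(* after this time [radius_dist] gives a distance less than [e] *)
pose A := (enorm M ^+ 2 + 1) / e / (2 * alpha * enorm m ^+ 2).
have k0 : 0 < 2 * alpha * enorm m ^+ 2 by rewrite !mulr_gt0// exprn_gt0.
exists A => x Kx; have [xR /eqP xn0] := KX _ Kx.
have [g [sg g0 _]] := sphere_sol_exists (exponents alpha d) (enorm_normalize xR xn0).
exists (radial_lift alpha x g); first exact: radial_lift_trajectory sg g0.
move=> t t0 At; set s := ltime alpha (enorm x ^+ 2) t.
apply: (eU (g s)); first by have [] := sg.
rewrite -ball_normE /ball_/= distrC.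
have xk : enorm m ^+ 2 <= enorm x ^+ 2 <= enorm M ^+ 2.
  rewrite !lerXn2r ?nnegrE ?sqrtr_ge0//; first by apply: MP; exact: mem_set.
  by apply: mP; exact: mem_set.
have D0 : 0 < 1 + 2 * alpha * enorm m ^+ 2 * t by rewrite ltr_pwDl// mulr_ge0// ltW.
have D1 : 1 + 2 * alpha * enorm m ^+ 2 * t <= 1 + 2 * alpha * enorm x ^+ 2 * t.
  rewrite lerD2l ler_wpM2r// ler_wpM2l ?mulr_ge0 ?(ltW a0)//.
  by have /andP[] := xk.
have rb : `|radius alpha x t - 1| < e.
  apply: (le_lt_trans (radius_dist a0 xn0 t0)).
  rewrite ltr_pdivrMr; last exact: lt_le_trans D1.
  apply: (@lt_le_trans _ _ (e * (1 + 2 * alpha * enorm m ^+ 2 * t))); last first.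
    by rewrite ler_wpM2l// ltW.
  have h1 : `|enorm x ^+ 2 - 1| <= enorm M ^+ 2 + 1.
    have := sqr_ge0 (enorm x); move: xk => /andP[_ h] h'.
    by rewrite ler_norml; apply/andP; split; lra.
  move: At; rewrite /A ler_pdivrMr// ler_pdivrMr// => h2.
  by rewrite (le_lt_trans h1)//; nra.
apply: le_lt_trans rb; apply: row_norm_le => // i.
rewrite /radial_lift !mxE -/s -[X in _ - X]mul1r -mulrBl normrM ler_piMr//.
by apply: S2p_norm_le1; have [] := sg.
Qed.

End Attraction.

(** * Limits of orbits on the sphere *)

Section LimitTools.
Variable R : realType.
Implicit Types (x y Q : 'rV[R]_3) (p : 'I_3 -> R) (g h : R -> 'rV[R]_3).

(** Reversing time negates [p], so that limits at -oo follow from limits at +oo. *)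
Lemma sphere_sol_reflect p g : sphere_sol p g ->
  sphere_sol (fun i => - p i) (fun t => g (- t)).
Proof.
move=> [gS dg]; split=> [t|t i]; first exact: gS.
have := is_derive_reflect (dg (- t) i); congr is_derive.
rewrite -mulrN; congr (_ * _).
by move: i; apply: ord3_ind; rewrite /cross !vec3E; ring.
Qed.

Lemma sphere_sol_shift p g s : sphere_sol p g -> sphere_sol p (fun t => g (t + s)).
Proof.
move=> [gS dg]; split=> [t|t i]; first exact: gS.
have ds : is_derive t 1 (fun u : R => u + s) 1 by deriv_ring.
by have := is_derive_comp1 (g := fun u => u + s) (dg (t + s) i) ds; rewrite mulr1.
Qed.

Lemma cvgNyE (T : topologicalType) (f : R -> T) (l : T) :
  f t @[t --> -oo] --> l <-> f (- t) @[t --> +oo] --> l.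
Proof. by rewrite cvgNy_compNP. Qed.

Lemma sphere_sol_sign p g : sphere_sol p g -> forall i,
  (forall t, g t 0 i = 0) \/ (forall t, 0 < g t 0 i).
Proof.
move=> sg i; have [h [sh h0 hP]] := sphere_sol_exists p (sg.1 0).
have -> : g = h by exact: sphere_sol_unique sg sh (esym h0).
by have [[_]|] := hP i; [left|right].
Qed.

Lemma sphere_sol_gt0 p g i t : sphere_sol p g -> 0 < g t 0 i -> forall s, 0 < g s 0 i.
Proof.
by move=> sg gt0; have [g0|] := sphere_sol_sign sg i => //; move: gt0; rewrite g0 ltxx.
Qed.

Lemma sphere_sol_eq0 p g i t : sphere_sol p g -> g t 0 i = 0 -> forall s, g s 0 i = 0.
Proof.
by move=> sg gt0; have [|g0] := sphere_sol_sign sg i => //; have := g0 t; rewrite gt0 ltxx.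
Qed.

Lemma sphere_sol_cst p x : S2p x -> (forall i, x 0 i * cross p (sq x) i = 0) ->
  sphere_sol p (fun=> x).
Proof.
by move=> xS x0; split=> // t i; rewrite x0; exact: is_derive_cst.
Qed.

(** A derivative that stays away from 0 makes the function grow linearly. *)
Lemma bounded_derive_limit (f f' : R -> R) (m B : R) :
  (forall t : R, is_derive t 1 f (f' t)) -> (forall t, `|f t| <= B) ->
  f' t @[t --> +oo] --> m -> m = 0.
Proof.
have pos (k k' : R -> R) (l : R) : (forall t : R, is_derive t 1 k (k' t)) ->
    (forall t, `|k t| <= B) -> k' t @[t --> +oo] --> l -> l <= 0.
  move=> dk kB kl; rewrite leNgt; apply/negP => l0.
  have l20 : 0 < l / 2 by rewrite divr_gt0.
  have : \forall t \near +oo, l / 2 <= k' t.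
    move/cvgrPdist_le : kl => /(_ (l / 2) l20).
    by apply: filterS => t; rewrite ler_norml; lra.
  move=> [A [_ AP]].
  (* over this interval a slope [l / 2] produces more than the oscillation [2 B] *)
  pose a := A + 1; pose t := a + (2 * B + 1) / (l / 2).
  have B0 : 0 <= B := le_trans (normr_ge0 _) (kB 0).
  have at_ : a <= t by rewrite lerDl divr_ge0 ?(ltW l20)// addr_ge0// mulr_ge0.
  have : k a - l / 2 * a <= k t - l / 2 * t.
    apply: (@le_of_derive _ (fun s => k s - l / 2 * s) (fun s => k' s - l / 2) a t) => //.
      by move=> s _; have ? := dk s; deriv_ring.
    move=> s /andP[sa _]; rewrite subr_ge0 AP//.
    by rewrite (lt_le_trans _ sa)// ltrDl.
  have := kB a; have := kB t; rewrite !ler_norml.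
  have : l / 2 * (t - a) = 2 * B + 1 by rewrite /t addrC addKr mulrC divfK// gt_eqF.
  by lra.
move=> df fB f'm; apply/le_anti/andP; split; first exact: pos df fB f'm.
rewrite -oppr_le0; apply: (pos (fun t => - f t) (fun t => - f' t)).
- by move=> t; rewrite normrN.
- exact: cvgN.
Qed.

(** The derivatives of the coordinates converge and the coordinates are bounded, so
    these limits are 0. *)
Lemma limit_stationary p g Q : sphere_sol p g -> g t @[t --> +oo] --> Q ->
  S2p Q /\ forall i, Q 0 i * cross p (sq Q) i = 0.
Proof.
move=> sg gQ; have SQ : S2p Q.
  apply: (closed_cvg S2p _ _ _ gQ); first exact: S2p_closed.
  by apply: nearW => t; have [] := sg.
split=> // i.
have c j : g t 0 j @[t --> +oo] --> Q 0 j by move/cvg_rowP : gQ; exact.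
have c2 j : sq (g t) j @[t --> +oo] --> sq Q j.
  by rewrite /sq !expr2; apply: cvgM.
have cc : cross p (sq (g t)) i @[t --> +oo] --> cross p (sq Q) i.
  by move: i; apply: ord3_ind; rewrite /cross !vec3E; apply: cvgB; apply: cvgM => //;
    exact: cvg_cst.
apply: (@bounded_derive_limit (fun t => g t 0 i) _ _ 1 (fun t => sg.2 t i)).
  by move=> t; apply: S2p_norm_le1; have [] := sg.
exact: cvgM.
Qed.

Lemma limit_stationaryNy p g Q : sphere_sol p g -> g t @[t --> -oo] --> Q ->
  S2p Q /\ forall i, Q 0 i * cross p (sq Q) i = 0.
Proof.
move=> sg /cvgNyE gQ; have [SQ Qe] := limit_stationary (sphere_sol_reflect sg) gQ.
split=> // i; apply/eqP; rewrite -oppr_eq0 -(Qe i) -mulrN; apply/eqP; congr (_ * _).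
by move: i {Qe}; apply: ord3_ind; rewrite /cross !vec3E; ring.
Qed.

Lemma decay_cvg0 (f : R -> R) (c m : R) : 0 < m -> 
  (forall t, 0 <= t -> `|f t| <= c * expR (- (m * t))) -> f t @[t --> +oo] --> (0 : R).
Proof.
move=> m0 fc; apply/cvgrPdist_le => e e0.
have c0 : 0 <= c by have := fc 0 (lexx 0); rewrite mulr0 oppr0 expR0 mulr1; apply: le_trans.
near=> t.
have t0 : 0 <= t by near: t; exact: nbhs_pinfty_ge.
rewrite sub0r normrN (le_trans (fc t t0))// expRN ler_pdivrMr ?expR_gt0//.
apply: (@le_trans _ _ (e * (1 + m * t))); last first.
  by rewrite ler_wpM2l ?(ltW e0)// expR_ge1Dx.
have : c / e / m <= t by near: t; apply: nbhs_pinfty_ge; rewrite num_real.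
by rewrite ler_pdivrMr// ler_pdivrMr// => h; nra.
Unshelve. all: by end_near. Qed.

(** The logarithmic derivative of [g t 0 j / g t 0 i] is at most [- m], and the
    denominator is at most 1. *)
Lemma ratio_decay p g i j (m : R) : sphere_sol p g -> (forall t, 0 < g t 0 i) ->
  (forall t : R, 0 <= t -> m <= cross p (sq (g t)) i - cross p (sq (g t)) j) ->
  exists c, forall t, 0 <= t -> `|g t 0 j| <= c * expR (- (m * t)).
Proof.
move=> sg gi hm; pose q t := - (g t 0 j / g t 0 i * expR (m * t)).
have g_ge0 t k : 0 <= g t 0 k by have /S2pE[+ _] := sg.1 t; exact.
have dq (t : R) : is_derive t 1 q (q t * (cross p (sq (g t)) j - cross p (sq (g t)) i + m)).
  have ? := sg.2 t i; have ? := sg.2 t j.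
  have ? := is_deriveV (lt0r_neq0 (gi t)) (sg.2 t i).
  apply: is_derive_eq; rewrite /q /GRing.scale/=; field; exact: lt0r_neq0.
exists (- q 0) => t t0.
have : q 0 <= q t.
  apply: (le_of_derive t0 (fun s _ => dq s)) => s /andP[s0 _].
  rewrite /q mulNr oppr_ge0 mulr_ge0_le0//.
    by rewrite mulr_ge0 ?expR_ge0// divr_ge0.
  by have := hm s s0; lra.
rewrite ger0_norm// expRN.
rewrite -lerN2 {1}/q opprK => h.
rewrite ler_pdivlMr ?expR_gt0// (le_trans _ h)// ler_wpM2r ?expR_ge0//.
rewrite ler_pdivlMr// ler_piMr//.
by have := S2p_norm_le1 i (sg.1 t); rewrite ger0_norm.
Qed.

Lemma cvg_e p g i : sphere_sol p g ->
  (forall j, j != i -> g t 0 j @[t --> +oo] --> (0 : R)) ->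
  g t @[t --> +oo] --> (e_ i : 'rV[R]_3).
Proof.
move=> sg h; apply/cvg_rowP => j; rewrite e_E.
have [ji|ji] := eqVneq j i; last exact: h.
rewrite ji.
pose F k t := if k == i then 0 else sq (g t) k.
have cF k : F k t @[t --> +oo] --> (0 : R).
  rewrite /F; case: eqVneq => ki; first exact: cvg_cst.
  by rewrite /sq -[X in _ --> X](mulr0 0); apply: cvgM; exact: h.
apply/cvgrPdist_le => e e0.
have cS : F i1 t + F i2 t + F i3 t @[t --> +oo] --> (0 : R).
  have : F i1 t + F i2 t + F i3 t @[t --> +oo] --> (0 + 0 + 0 : R).
    by apply: cvgD; [apply: cvgD|]; exact: cF.
  by rewrite !addr0.
move/cvgrPdist_le : cS => /(_ e e0); apply: filterS => t.
rewrite sub0r normrN; apply: le_trans.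
have /S2pE[/(_ i) gi0 s1] := sg.1 t.
have gi1 : g t 0 i <= 1 by have := S2p_norm_le1 i (sg.1 t); rewrite (ger0_norm gi0).
rewrite ger0_norm ?subr_ge0//; apply: le_trans (ler_norm _).
have h2 : 1 - g t 0 i <= 1 - sq (g t) i by rewrite lerD2l lerN2 /sq expr2 ler_piMr.
apply: (le_trans h2); rewrite -s1 sum3 /F; move: i {h F cF ji gi0 gi1 h2}.
by apply: ord3_ind => /=; lra.
Qed.

End LimitTools.

(** * Edges and vertices *)

Section Cyclic.
Variable R : realType.
Implicit Types (x y : 'rV[R]_3) (p u : 'I_3 -> R) (g : R -> 'rV[R]_3).

(** The three cyclic arrangements: statements about one edge or vertex are proved
    for [cyclic3 i j k] and hold for all of them, signs included. *)
Inductive cyclic3 : 'I_3 -> 'I_3 -> 'I_3 -> Prop :=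
  | Cyclic123 : cyclic3 i1 i2 i3
  | Cyclic231 : cyclic3 i2 i3 i1
  | Cyclic312 : cyclic3 i3 i1 i2.

Section Triple.
Variables i j k : 'I_3.
Hypothesis ijk : cyclic3 i j k.

Lemma cyclic3_rot : cyclic3 j k i.
Proof. by case: ijk; constructor. Qed.

Lemma cyclic3_neq : [/\ j != i, k != i, k != j & ordS i = j].
Proof. by case: ijk; split => //; exact: val_inj. Qed.

Lemma cyclic3_all (P : 'I_3 -> Prop) : P i -> P j -> P k -> forall l, P l.
Proof. by case: ijk => *; exact: ord3_ind. Qed.

Lemma cyclic3_sum (F : 'I_3 -> R) : \sum_l F l = F i + F j + F k.
Proof. by rewrite sum3; case: ijk; ring. Qed.

Lemma crossE p u : [/\ cross p u i = p j * u k - p k * u j,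
  cross p u j = p k * u i - p i * u k & cross p u k = p i * u j - p j * u i].
Proof. by case: ijk; split; rewrite /cross !vec3E. Qed.

End Triple.

Lemma cyclic3_third k : exists i j, cyclic3 i j k.
Proof.
by move: k; apply: ord3_ind; [exists i2, i3|exists i3, i1|exists i1, i2]; constructor.
Qed.

Lemma S2p_eqE i j k x : cyclic3 i j k -> S2p x -> x 0 k = 0 -> x 0 i = 0 -> x = e_ j.
Proof.
move=> c /S2pE[x0]; rewrite (cyclic3_sum c) => x1 xk xi.
have [ji ki kj _] := cyclic3_neq c.
apply/rowP; apply: (cyclic3_all c); rewrite e_E.
- by rewrite xi eq_sym (negPf ji).
- apply/eqP; rewrite eqxx -(@eqrXn2 _ 2)//; apply/eqP.
  by move: x1; rewrite /sq xi xk !expr0n /= add0r addr0 expr1n.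
- by rewrite xk (negPf kj).
Qed.

(** On the edge, [u i + u j = 1] makes the difference of the growth rates of the two
    coordinates equal to the constant [p k]. *)
Lemma edge_limit p g i j k : cyclic3 i j k -> sphere_sol p g ->
  (forall t, g t 0 k = 0) -> (forall t, 0 < g t 0 i) -> (forall t, 0 < g t 0 j) ->
  (0 < p k -> g t @[t --> +oo] --> (e_ j : 'rV[R]_3)) /\
  (p k < 0 -> g t @[t --> +oo] --> (e_ i : 'rV[R]_3)).
Proof.
move=> c sg gk gi gj.
have diff t : cross p (sq (g t)) j - cross p (sq (g t)) i = p k.
  have [-> -> _] := crossE c p (sq (g t)); have /S2pE[_] := sg.1 t; rewrite (cyclic3_sum c).
  have -> : sq (g t) k = 0 by rewrite /sq gk expr0n.
  move=> s1.
  have -> : sq (g t) j = 1 - sq (g t) i by lra.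
  by ring.
have [ji ki kj _] := cyclic3_neq c.
have k0 : g t 0 k @[t --> +oo] --> (0 : R).
  by under eq_fun do rewrite gk; exact: cvg_cst.
split=> pk; apply: (cvg_e sg); apply: (cyclic3_all c) => //; rewrite ?eqxx//.
- move=> _.
  have hd t : 0 <= t -> p k <= cross p (sq (g t)) j - cross p (sq (g t)) i.
    by rewrite diff.
  have [c0 h] := ratio_decay sg gj hd; exact: decay_cvg0 pk h.
- move=> _.
  have hd t : 0 <= t -> - p k <= cross p (sq (g t)) i - cross p (sq (g t)) j.
    by rewrite -(diff t) opprB.
  by have [c0 h] := ratio_decay sg gi hd; apply: decay_cvg0 h; rewrite oppr_gt0.
Qed.

Lemma edge_limitNy p g i j k : cyclic3 i j k -> sphere_sol p g ->
  (forall t, g t 0 k = 0) -> (forall t, 0 < g t 0 i) -> (forall t, 0 < g t 0 j) ->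
  (0 < p k -> g t @[t --> -oo] --> (e_ i : 'rV[R]_3)) /\
  (p k < 0 -> g t @[t --> -oo] --> (e_ j : 'rV[R]_3)).
Proof.
move=> c sg gk gi gj.
have [h1 h2] := edge_limit c (sphere_sol_reflect sg) (fun t => gk (- t))
  (fun t => gi (- t)) (fun t => gj (- t)).
by split=> pk; apply/cvgNyE; [apply: h2|apply: h1]; rewrite ?oppr_lt0 ?oppr_gt0.
Qed.

Lemma stationary_cst p g : sphere_sol p g ->
  (forall i, g 0 0 i * cross p (sq (g 0)) i = 0) -> forall t, g t = g 0.
Proof.
move=> sg e t; have sc := sphere_sol_cst (sg.1 0) e.
exact: (congr1 (@^~ t) (sphere_sol_unique sg sc erefl)).
Qed.

Lemma stationary_edge p x i j k : cyclic3 i j k -> x 0 k = 0 -> p k = 0 ->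
  forall l, x 0 l * cross p (sq x) l = 0.
Proof.
move=> c xk pk; have [Ci Cj Ck] := crossE c p (sq x).
by apply: (cyclic3_all c); rewrite ?Ci ?Cj ?Ck ?xk /sq ?xk ?pk; ring.
Qed.

Lemma stationary_e p i l : (e_ i : 'rV[R]_3) 0 l * cross p (sq (e_ i)) l = 0.
Proof.
move: i l; apply: ord3_ind; apply: ord3_ind; rewrite /cross !vec3E /sq !e_E /=; ring.
Qed.

(** A boundary point is a vertex, an equilibrium of an edge with [p k = 0], or moves
    along its edge to a vertex. *)
Lemma boundary_limit p g : sphere_sol p g -> (exists k, g 0 0 k = 0) ->
  (exists i, g t @[t --> +oo] --> (e_ i : 'rV[R]_3)) \/
  (exists k, [/\ p k = 0, g 0 0 k = 0 & forall t, g t = g 0]).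
Proof.
move=> sg [k gk0]; have [i [j c]] := cyclic3_third k.
have gk := sphere_sol_eq0 sg gk0.
have vertex l : g 0 = e_ l -> exists i, g t @[t --> +oo] --> (e_ i : 'rV[R]_3).
  move=> gl; exists l; have gc : forall t, g t = g 0.
    by apply: stationary_cst sg _ => m; rewrite gl; exact: stationary_e.
  by under eq_fun do rewrite gc gl; exact: cvg_cst.
have [gi|gi] := sphere_sol_sign sg i.
  by left; apply: (vertex j); exact: S2p_eqE c (sg.1 0) gk0 (gi 0).
have [gj|gj] := sphere_sol_sign sg j.
  left; apply: (vertex i); apply: (S2p_eqE (cyclic3_rot (cyclic3_rot c)) (sg.1 0)) => //.
have [pk|pk|pk] := ltgtP (p k) 0.
- by left; exists i; have [_] := edge_limit c sg gk gi gj; apply.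
- by left; exists j; have [+ _] := edge_limit c sg gk gi gj; apply.
- right; exists k; split=> //; apply: stationary_cst sg _.
  exact: stationary_edge c gk0 pk.
Qed.

End Cyclic.

Section Vertices.
Variable R : realType.
Variables (alpha : R) (d : 'I_3 -> R).
Let p := exponents alpha d.

Let is_derive_coord (x v : 'rV[R]_3) i : is_derive x v (fun y : 'rV[R]_3 => y 0 i) (v 0 i).
Proof.
have dc := @differentiable_coord R _ _ x 0 i.
apply: DeriveDef; first exact: diff_derivable.
rewrite deriveE//; pose f := fun y : 'rV[R]_3 => y 0 i.
have lf : linear f by move=> a y z; rewrite /f !mxE.
pose fL := GRing.isLinear.Build _ _ _ _ f lf.
pose F : {linear 'rV[R]_3 -> R^o} := HB.pack f fL.
by rewrite (_ : (fun y => _) = F)// diff_lin//; exact: coord_continuous3.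
Qed.

(** A coordinate direction other than that of the vertex is an eigenvector, because
    the squared coordinates have zero derivative in this direction at [e_ i]. *)
Let jacobian_vertex i l : l != i ->
  (e_ l : 'rV[R]_3) *m jacobian (field_D alpha d) (e_ i) =
  cross p (sq (e_ i : 'rV[R]_3)) l *: e_ l.
Proof.
move=> li; set x : 'rV[R]_3 := e_ i; set v : 'rV[R]_3 := e_ l.
have dsq m : is_derive x v (fun y => sq y m) 0.
  have ? := is_derive_coord x v m; rewrite /sq; apply: is_derive_eq.
  rewrite /GRing.scale/= /x /v !e_E; case: (eqVneq m l) => [->|_].
    by rewrite (negPf li) /=; ring.
  by rewrite /=; ring.
pose G j (y : 'rV[R]_3) := alpha * (1 - \sum_m sq y m) + cross p (sq y) j.
have dG j : is_derive x v (G j) 0.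
  have ? := dsq i1; have ? := dsq i2; have ? := dsq i3.
  rewrite /G; under eq_fun do rewrite sum3.
  by move: j; apply: ord3_ind; rewrite /cross; (under eq_fun do rewrite vec3E); deriv_ring.
have dF j : is_derive x v (fun y => field_D alpha d y 0 j) (v 0 j * G j x).
  under eq_fun do rewrite field_DE -/p -/(G j _).
  have ? := dG j; have ? := is_derive_coord x v j; deriv_ring.
have fdiff : differentiable (field_D alpha d) x.
  rewrite (_ : field_D alpha d = \sum_(m < 3) (fun y => field_D alpha d y 0 m *: e_ m)); last first.
    apply/funext => y; rewrite fct_sumE; apply/rowP => j.
    have Z m : (field_D alpha d y 0 m *: e_ m) 0 j = field_D alpha d y 0 m * (j == m)%:R.
      by rewrite mxE e_E.
    rewrite summxE sum3 !Z; move: j {Z}.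
    by apply: ord3_ind; rewrite /=; ring.
  apply: differentiable_sum => m; apply: differentiableZl.
  have cd n := @differentiable_coord R _ _ x 0 n.
  have sd n : differentiable (fun y : 'rV[R]_3 => sq y n) x := differentiableX 1 (cd n).
  have sumd : differentiable (fun y : 'rV[R]_3 => \sum_n sq y n) x.
    under eq_fun do rewrite sum3.
    exact: differentiableD (differentiableD (sd i1) (sd i2)) (sd i3).
  have crossd : differentiable (fun y : 'rV[R]_3 => cross p (sq y) m) x.
    move: m; apply: ord3_ind; rewrite /cross; (under eq_fun do rewrite vec3E).
    + exact: differentiableB (differentiableZ (p i2) (sd i3)) (differentiableZ (p i3) (sd i2)).
    + exact: differentiableB (differentiableZ (p i3) (sd i1)) (differentiableZ (p i1) (sd i3)).
    + exact: differentiableB (differentiableZ (p i1) (sd i2)) (differentiableZ (p i2) (sd i1)).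
  under eq_fun do rewrite field_DE.
  apply: differentiableM (cd m) _.
  apply: differentiableD crossd; apply: differentiableZ.
  exact: differentiableB (differentiable_cst _ _) sumd.
rewrite -deriveEjacobian//.
apply/rowP => j; rewrite derive_mx; last exact: diff_derivable.
rewrite !mxE; have [_ ->] := dF j.
have [->|jl] := eqVneq j l.
  rewrite /v e_E eqxx mul1r mulr1 /G; have /S2pE[_ ->] := S2p_e R i.
  by rewrite subrr mulr0 add0r.
by rewrite /v !e_E (negPf jl) mul0r mulr0.
Qed.

Lemma tangent_eigenvalues_e i j k : cyclic3 i j k ->
  tangent_eigenvalues alpha d (e_ i) (p k) (- p j).
Proof.
move=> c; have [ji ki kj _] := cyclic3_neq c.
have sqe l : sq (e_ i : 'rV[R]_3) l = (l == i)%:R.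
  by rewrite /sq e_E; case: (l == i); rewrite ?expr1n ?expr0n.
have [_ Cj Ck] := crossE c p (sq (e_ i : 'rV[R]_3)).
have cj : cross p (sq (e_ i : 'rV[R]_3)) j = p k.
  by rewrite Cj !sqe eqxx (negPf ki) /=; ring.
have ck : cross p (sq (e_ i : 'rV[R]_3)) k = - p j.
  by rewrite Ck !sqe eqxx (negPf ji) /=; ring.
pose r (a : 'I_2) := if a == 0 then j else k.
pose B : 'M[R]_(2, 3) := \matrix_a e_ (r a).
pose D : 'rV[R]_2 := \row_a (if a == 0 then p k else - p j).
have rowB a : row a B = e_ (r a) by rewrite rowK.
have rE a b : (r a == r b) = (a == b).
  have jk : (j == k) = false by rewrite eq_sym (negPf kj).
  by move: a b => [[|[|//]] ha] [[|[|//]] hb]; rewrite /r /= ?eqxx ?(negPf kj) ?jk.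
exists B, (diag_mx D); split.
- apply/row_freeP; exists B^T; apply/row_matrixP => a.
  rewrite row_mul rowB; apply/rowP => b; rewrite !mxE (bigD1 (r a))//= big1 => [|m ma].
    by rewrite addr0 !mxE !eqxx mul1r /= rE eq_sym.
  by rewrite mxE (negPf ma) andbF mul0r.
- apply/matrixP => a b; rewrite !mxE big1// => m _; rewrite !mxE (ord1 b) eqxx /=.
  case: eqVneq => [->|]; last by rewrite mul0r.
  by rewrite /r; case: ifP => _; rewrite ?(negPf ji) ?(negPf ki) mulr0.
- apply/row_matrixP => a; rewrite !row_mul rowB.
  have ri : r a != i by rewrite /r; case: ifP.
  rewrite jacobian_vertex// row_diag_mx -scalemxAl -rowE rowB mxE.
  by congr (_ *: _); rewrite /r; case: ifP.
- rewrite char_poly_trig ?diag_mx_is_trig// !big_ord_recl big_ord0 mulr1.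
  by rewrite !mxE !eqxx.
Qed.

End Vertices.

(** * Interior limits from monotone quantities *)

Section MonotoneLimits.
Variable R : realType.
Implicit Types (x y Q A B : 'rV[R]_3) (p : 'I_3 -> R) (g : R -> 'rV[R]_3).

Lemma le_limit (f : R -> R) (a l : R) :
  (\forall t \near +oo, a <= f t) -> f t @[t --> +oo] --> l -> a <= l.
Proof.
move=> af fl; apply: (closed_cvg [set r | a <= r] _ af _ fl); exact: closed_ge.
Qed.

Lemma ge_limit (f : R -> R) (a l : R) :
  (\forall t \near +oo, f t <= a) -> f t @[t --> +oo] --> l -> l <= a.
Proof.
move=> af fl; apply: (closed_cvg [set r | r <= a] _ af _ fl); exact: closed_le.
Qed.

Lemma homo_le_limit (f : R -> R) (l : R) : {homo f : s t / s <= t} ->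
  f t @[t --> +oo] --> l -> forall t, f t <= l.
Proof.
move=> fh fl t; apply: le_limit fl; near=> s; apply: fh.
by near: s; apply: nbhs_pinfty_ge; rewrite num_real.
Unshelve. all: by end_near. Qed.

Lemma homo_ge_limitNy (f : R -> R) (l : R) : {homo f : s t / s <= t} ->
  f t @[t --> -oo] --> l -> forall t, l <= f t.
Proof.
move=> fh /cvgNyE fl t; apply: ge_limit fl; near=> s; apply: fh.
by rewrite lerNl; near: s; apply: nbhs_pinfty_ge; rewrite num_real.
Unshelve. all: by end_near. Qed.

Lemma coord_cvg (F : set_system R) {FF : Filter F} g Q i :
  g t @[t --> F] --> Q -> g t 0 i @[t --> F] --> Q 0 i.
Proof. by move/cvg_rowP. Qed.

Lemma sq_cvg (F : set_system R) {FF : Filter F} g Q i :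
  g t @[t --> F] --> Q -> sq (g t) i @[t --> F] --> sq Q i.
Proof. by move=> gQ; rewrite /sq expr2; apply: cvgM; exact: coord_cvg. Qed.

Lemma monotone_bounded_cvg (f : R -> R) (B : R) : (forall t, `|f t| <= B) ->
  {homo f : s t / s <= t} \/ {homo f : s t /~ s <= t} ->
  exists l : R, f t @[t --> +oo] --> l.
Proof.
have inc (k : R -> R) : (forall t, `|k t| <= B) -> {homo k : s t / s <= t} ->
    exists l : R, k t @[t --> +oo] --> l.
  move=> kB kh; exists (sup (range k)); apply: nondecreasing_cvgr => //.
  by exists B => _ [t _ <-]; have := kB t; rewrite ler_norml => /andP[].
move=> fB [|fh]; first exact: inc.
have [l kl] : exists l : R, - f t @[t --> +oo] --> l.
  apply: (inc (fun t => - f t)) => [t|s t st]; first by rewrite normrN.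
  by rewrite lerN2; exact: fh.
exists (- l); rewrite (_ : f = fun t => - - f t); first exact: cvgN.
by apply/funext => t; rewrite opprK.
Qed.

(** When [p i3 = 0] the growth rates of the first two coordinates have constant
    signs, so both are monotone and converge; the third one is determined by them. *)
Lemma two_monotone_cvg p g : sphere_sol p g -> p i3 = 0 ->
  exists Q, g t @[t --> +oo] --> Q.
Proof.
move=> sg p3.
have g0 t i : 0 <= g t 0 i by have /S2pE[+ _] := sg.1 t; exact.
have mono i : i != i3 -> exists l : R, g t 0 i @[t --> +oo] --> l.
  move=> i3'; apply: (@monotone_bounded_cvg _ 1).
    by move=> t; apply: S2p_norm_le1; exact: sg.1.
  have dN (t : R) : is_derive t 1 (fun t => - g t 0 i) (- (g t 0 i * cross p (sq (g t)) i)).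
    by have ? := sg.2 t i; deriv_ring.
  have sgn : (forall t, 0 <= g t 0 i * cross p (sq (g t)) i) \/
             (forall t, 0 <= - (g t 0 i * cross p (sq (g t)) i)).
    move: i i3' {dN}; apply: ord3_ind => // _.
    + have C1 t : cross p (sq (g t)) i1 = p i2 * sq (g t) i3.
        by rewrite /cross vec3E p3; ring.
      have [p2|/ltW p2] := leP 0 (p i2); [left|right] => t; rewrite C1.
        by rewrite !mulr_ge0// sqr_ge0.
      by rewrite -mulrN -mulNr !mulr_ge0 ?oppr_ge0// sqr_ge0.
    + have C2 t : cross p (sq (g t)) i2 = - (p i1 * sq (g t) i3).
        by rewrite /cross vec3E p3; ring.
      have [p1|/ltW p1] := leP 0 (p i1); [right|left] => t; rewrite C2.
        by rewrite mulrN opprK !mulr_ge0// sqr_ge0.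
      by rewrite -mulNr !mulr_ge0 ?oppr_ge0// sqr_ge0.
  case: sgn => sgn; [left|right].
    exact: homo_of_derive (fun t => sg.2 t i) sgn.
  by move=> s t st; have := homo_of_derive dN sgn st; rewrite lerN2.
have [l1 c1] := mono i1 isT; have [l2 c2] := mono i2 isT.
exists (row3 l1 l2 (Num.sqrt (1 - l1 * l1 - l2 * l2))).
apply/cvg_rowP; apply: ord3_ind; rewrite row3E//.
have gE : (fun t => g t 0 i3) =
    fun t => Num.sqrt (1 - g t 0 i1 * g t 0 i1 - g t 0 i2 * g t 0 i2).
  apply/funext => t; have /S2pE[_] := sg.1 t; rewrite sum3 /sq -!expr2 => s1.
  have -> : 1 - g t 0 i1 ^+ 2 - g t 0 i2 ^+ 2 = g t 0 i3 ^+ 2 by rewrite -s1; ring.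
  by rewrite sqrtr_sqr ger0_norm.
rewrite gE.
have c3 : 1 - g t 0 i1 * g t 0 i1 - g t 0 i2 * g t 0 i2 @[t --> +oo] -->
    1 - l1 * l1 - l2 * l2.
  by apply: cvgB; [apply: cvgB; [exact: cvg_cst|exact: cvgM]|exact: cvgM].
by apply: cvg_comp c3 _; exact: sqrt_continuous.
Qed.

Lemma two_monotone_cvgNy p g : sphere_sol p g -> p i3 = 0 ->
  exists Q, g t @[t --> -oo] --> Q.
Proof.
move=> sg p3; have [|Q gQ] := two_monotone_cvg (sphere_sol_reflect sg).
  by rewrite p3 oppr0.
by exists Q; apply/cvgNyE.
Qed.

Lemma coord_homo p g i : sphere_sol p g -> (forall t, 0 <= cross p (sq (g t)) i) ->
  {homo (fun t => g t 0 i) : s t / s <= t}.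
Proof.
move=> sg c0; apply: (homo_of_derive (fun t => sg.2 t i)) => t.
by rewrite mulr_ge0//; have /S2pE[+ _] := sg.1 t; exact.
Qed.

Lemma heteroclinicI alpha d p g A B : p = exponents alpha d -> sphere_sol p g ->
  g t @[t --> -oo] --> A -> g t @[t --> +oo] --> B -> A <> B ->
  heteroclinic_orbit alpha d A B (range g).
Proof.
move=> pE sg gA gB AB; rewrite pE in sg.
have [SA eA] := limit_stationaryNy sg gA.
have [SB eB] := limit_stationary sg gB.
split=> //; try exact/equilibriumE.
by exists g; split=> //; have [] := (sphere_solP alpha d g).2 sg.
Qed.

Lemma Gamma_sym (i j : 'I_3) : @Gamma R i j = Gamma j i.
Proof.
have sub (k l : 'I_3) : @Gamma R k l `<=` Gamma l k.
  move=> x [x0 xkl xm]; split=> [//||m ml mk]; first by rewrite addrC.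
  exact: xm.
by apply/seteqP; split; exact: sub.
Qed.

Lemma GammaE (i j k : 'I_3) x : cyclic3 i j k -> Gamma i j x <-> S2p x /\ x 0 k = 0.
Proof.
move=> c; have [ji ki kj _] := cyclic3_neq c.
split=> [[x0 xij xk]|[/S2pE[x0 x1] xk]].
  have xk0 := xk k ki kj; split=> //; apply/S2pE; split=> //.
  by rewrite (cyclic3_sum c) {3}/sq xk0 expr0n addr0.
split=> //; last by apply: (cyclic3_all c); rewrite ?eqxx.
by move: x1; rewrite (cyclic3_sum c) {3}/sq xk expr0n addr0.
Qed.

Lemma infinite_of_injection (T : Type) (A : set T) (f : nat -> T) :
  injective f -> (forall n, A (f n)) -> infinite_set A.
Proof.
move=> fi fA Af; apply: infinite_nat.
rewrite (_ : setT = f @^-1` A); last by apply/seteqP; split=> n // _; exact: fA.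
by apply: finite_preimage => // ? ? _ _; exact: fi.
Qed.

Lemma Gamma_infinite (i j : 'I_3) : i != j -> infinite_set (@Gamma R i j).
Proof.
move=> ij; pose s (n : nat) : R := n.+1%:R^-1.
have s0 n : 0 < s n by rewrite invr_gt0.
have s1 n : s n <= 1 by rewrite invf_le1 ?ler1n.
have s2 n : 0 <= 1 - s n ^+ 2 by rewrite subr_ge0 expr_le1// ltW.
pose f n : 'rV[R]_3 := \row_l (if l == i then s n else
  if l == j then Num.sqrt (1 - s n ^+ 2) else 0).
apply: (@infinite_of_injection _ _ f) => [m n mn|n].
  have := congr1 (fun x : 'rV[R]_3 => x 0 i) mn; rewrite !mxE eqxx.
  by move/invr_inj/eqP; rewrite eqr_nat => /eqP[].
split=> [l||l li lj]; rewrite !mxE.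
- by case: ifP => _; [exact: ltW|case: ifP => _; rewrite ?sqrtr_ge0].
- by rewrite eqxx eq_sym (negPf ij) eqxx sqr_sqrtr// subrKC.
- by rewrite (negPf li) (negPf lj).
Qed.

End MonotoneLimits.

Section OmegaOfPoints.
Variable R : realType.
Variables (alpha : R) (d : 'I_3 -> R).
Hypothesis alpha0 : 0 < alpha.
Let p := exponents alpha d.
Implicit Types (x y Q A B : 'rV[R]_3) (g : R -> 'rV[R]_3).

Lemma interior_omega x : IntR3p x -> exists g, [/\ sphere_sol p g,
  forall t i, 0 < g t 0 i & omega_limit alpha d x = Omega g].
Proof.
move=> x0; have xn0 : x != 0.
  by apply/eqP => xz; have := x0 i1; rewrite xz mxE ltxx.
have xR : R3p x by move=> i; exact/ltW/x0.
have [g [sg g0 gP]] := sphere_sol_exists p (enorm_normalize xR xn0).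
exists g; split=> //; last exact: omega_limitE.
move=> t i; apply: (@sphere_sol_gt0 _ p _ _ 0) => //.
by rewrite g0 mxE mulr_gt0 ?invr_gt0 ?enorm_gt0.
Qed.

Lemma boundary_omega x : (bdR3p `\ 0) x ->
  (exists i, omega_limit alpha d x = [set e_ i]) \/
  (exists k Q, [/\ p k = 0, S2p Q, Q 0 k = 0 & omega_limit alpha d x = [set Q]]).
Proof.
move=> [[xR xb] /eqP xn0].
have [g [sg g0 _]] := sphere_sol_exists p (enorm_normalize xR xn0).
rewrite (omega_limitE alpha0 xn0 sg g0).
have [k gk] : exists k, g 0 0 k = 0.
  apply: contrapT => /forallNP h; apply: xb => i.
  have xi := xR i; rewrite lt_def xi andbT; apply/eqP => xi0.
  by apply: (h i); rewrite g0 mxE xi0 mulr0.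
have [[i gi]|[l [pl gl gc]]] := boundary_limit sg (ex_intro _ k gk).
  by left; exists i; exact: Omega_cvg.
right; exists l, (g 0); split=> //; first exact: sg.1.
by apply: Omega_cvg; under eq_fun do rewrite gc; exact: cvg_cst.
Qed.

End OmegaOfPoints.

Section CaseII.
Variable R : realType.
Variable p : 'I_3 -> R.
Hypotheses (p1 : p i1 < 0) (p2 : 0 < p i2) (p3 : p i3 < 0).
Implicit Types (g : R -> 'rV[R]_3).

(** The logarithmic derivatives of the coordinates are [cross q u], orthogonal to
    [q]. *)
Lemma log_integral (q : 'I_3 -> R) g : sphere_sol q g ->
  (forall t i, 0 < g t 0 i) -> forall t,
  \sum_i q i * ln (g t 0 i) = \sum_i q i * ln (g 0 0 i).
Proof.
move=> sg g0 t.
have dl i (s : R) : is_derive s 1 (fun s => ln (g s 0 i)) (cross q (sq (g s)) i).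
  have h := is_derive_comp1 (g := fun s => g s 0 i) (is_derive1_ln (g0 s i)) (sg.2 s i).
  by move: h; rewrite mulrA mulVf ?mul1r// gt_eqF.
apply: (@cst_of_derive _ (fun t => \sum_i q i * ln (g t 0 i)) 
  (fun t => \sum_i q i * cross q (sq (g t)) i)); last by move=> s; rewrite cross_kernel.
move=> s; under eq_fun do rewrite sum3; rewrite sum3.
by have ? := dl i1 s; have ? := dl i2 s; have ? := dl i3 s; deriv_ring.
Qed.

(** The ratio of the third to the first coordinate decays because
    [p i2 * (u1 + u3) - (p i1 + p i3) * u2] is at least a positive constant on the simplex.  If the
    second coordinate is positive, the first integral then forces it to decay. *)
Lemma limit_ii g : sphere_sol p g -> 0 < g 0 0 i1 -> 0 < g 0 0 i3 ->
  g t @[t --> +oo] --> (e_ i1 : 'rV[R]_3).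
Proof.
move=> sg g1 g3.
have {}g1 := sphere_sol_gt0 sg g1; have {}g3 := sphere_sol_gt0 sg g3.
(* a lower bound of the two coefficients in the difference of growth rates, both
   being positive *)
pose m := Num.min (p i2) (- (p i1 + p i3)).
have m0 : 0 < m.
  by rewrite lt_min p2 oppr_gt0 /=; move: p1 p3; lra.
have diff t : 0 <= t -> m <= cross p (sq (g t)) i1 - cross p (sq (g t)) i3.
  move=> _; have /S2pE[_] := sg.1 t; rewrite sum3 => s1.
  have u i : 0 <= sq (g t) i by exact: sqr_ge0.
  have := u i1; have := u i2; have := u i3.
  have m1 : m <= p i2 by rewrite ge_min lexx.
  have m2 : m <= - (p i1 + p i3) by rewrite ge_min lexx orbT.
  rewrite /cross !vec3E => h3 h2 h1.
  have -> : m = m * (sq (g t) i1 + sq (g t) i2 + sq (g t) i3) by rewrite s1 mulr1.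
  have k13 : m * (sq (g t) i1 + sq (g t) i3) <= p i2 * (sq (g t) i1 + sq (g t) i3).
    by rewrite ler_wpM2r// addr_ge0.
  have k2 : m * sq (g t) i2 <= - (p i1 + p i3) * sq (g t) i2 by rewrite ler_wpM2r.
  by lra.
have [c hc] := ratio_decay sg g1 diff.
have c0 : 0 < c.
  have := hc 0 (lexx 0); rewrite mulr0 oppr0 expR0 mulr1; apply: lt_le_trans.
  by rewrite gtr0_norm.
apply: (cvg_e sg); apply: ord3_ind => // _; last exact: decay_cvg0 m0 hc.
have [g2|g2] := sphere_sol_sign sg i2.
  by under eq_fun do rewrite g2; exact: cvg_cst.
have gpos t i : 0 < g t 0 i by move: i; exact: ord3_ind.
pose K := \sum_i p i * ln (g 0 0 i).
apply: (@decay_cvg0 _ _ (expR ((K - p i3 * ln c) / p i2)) (- p i3 * m / p i2)).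
  by rewrite divr_gt0// mulr_gt0// oppr_gt0.
move=> t t0; rewrite gtr0_norm//.
have := log_integral sg gpos t; rewrite -/K sum3 => e.
have l1 : ln (g t 0 i1) <= 0.
  by apply: ln_le0; have := S2p_norm_le1 i1 (sg.1 t); rewrite gtr0_norm.
have l3 : ln (g t 0 i3) <= ln c - m * t.
  have := hc t t0; rewrite gtr0_norm// => h.
  have : ln (g t 0 i3) <= ln (c * expR (- (m * t))).
    by rewrite ler_ln ?posrE// mulr_gt0 ?expR_gt0.
  by rewrite lnM ?posrE ?expR_gt0// expRK.
rewrite -expRD -[leLHS]lnK ?posrE// ler_expR.
have -> : (K - p i3 * ln c) / p i2 - - p i3 * m / p i2 * t =
  (K - p i3 * (ln c - m * t)) / p i2 by field; rewrite gt_eqF.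
rewrite ler_pdivlMr//.
have := mulr_le0_ge0 (ltW p3) (_ : 0 <= (ln c - m * t) - ln (g t 0 i3)).
rewrite subr_ge0 => /(_ l3).
have := mulr_le0 (ltW p1) l1.
by lra.
Qed.

End CaseII.

Section TwoMonotone.
Variable R : realType.
Variable p : 'I_3 -> R.
Implicit Types (g : R -> 'rV[R]_3).

Let g_ge0 g t i : sphere_sol p g -> 0 <= g t 0 i.
Proof. by move=> sg; have /S2pE[+ _] := sg.1 t; exact. Qed.

(** The quantity [p i2 * u1 - p i1 * u2] strictly increases, so the two limits
    differ.  Were it not positive at the end point [B], the third coordinate would
    increase all along, whereas it tends to 0. *)
Lemma limits_iiia g : 0 < p i1 -> 0 < p i2 -> p i3 = 0 -> sphere_sol p g ->
  (forall t i, 0 < g t 0 i) -> exists A B : 'rV[R]_3, [/\ g t @[t --> -oo] --> A,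
    g t @[t --> +oo] --> B, A <> B, B 0 i3 = 0 &
    p i1 * sq B i2 < p i2 * sq B i1].
Proof.
move=> p1 p2 p3 sg g0.
have [A gA] := two_monotone_cvgNy sg p3; have [B gB] := two_monotone_cvg sg p3.
pose V (x : 'rV[R]_3) := p i2 * sq x i1 - p i1 * sq x i2 : R.
have C1 t : cross p (sq (g t)) i1 = p i2 * sq (g t) i3.
  by rewrite /cross !vec3E p3; ring.
have C2 t : cross p (sq (g t)) i2 = - (p i1 * sq (g t) i3).
  by rewrite /cross !vec3E p3; ring.
have C3 t : cross p (sq (g t)) i3 = - V (g t) by rewrite /cross !vec3E /V; ring.
have sq0 t i : 0 < sq (g t) i by rewrite exprn_gt0.
have dV (t : R) : is_derive t 1 (fun t => V (g t))
    (2 * (p i2 ^+ 2 * sq (g t) i1 + p i1 ^+ 2 * sq (g t) i2) * sq (g t) i3).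
  have ? := sphere_sol_sq sg t i1; have ? := sphere_sol_sq sg t i2.
  by rewrite /V; apply: is_derive_eq; rewrite C1 C2 /GRing.scale/=; ring.
have V' t : 0 < 2 * (p i2 ^+ 2 * sq (g t) i1 + p i1 ^+ 2 * sq (g t) i2) * sq (g t) i3.
  by rewrite !mulr_gt0// addr_gt0// mulr_gt0// exprn_gt0.
have Vs := shomo_of_derive dV V'.
have Vh := homo_of_derive dV (fun t => ltW (V' t)).
have cB i : g t 0 i @[t --> +oo] --> B 0 i by exact: coord_cvg.
have VB : V (g t) @[t --> +oo] --> V B.
  by apply: cvgB; (apply: cvgM; first exact: cvg_cst); exact: sq_cvg.
have VA : V (g t) @[t --> -oo] --> V A.
  by apply: cvgB; (apply: cvgM; first exact: cvg_cst); exact: sq_cvg.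
have B1 : 0 < B 0 i1.
  have h1 : {homo (fun t => g t 0 i1) : s t / s <= t}.
    by apply: (coord_homo sg) => t; rewrite C1 mulr_ge0 ?ltW.
  exact: lt_le_trans (g0 0 i1) (homo_le_limit h1 (cB i1) 0).
have [SB eB] := limit_stationary sg gB.
have B3 : B 0 i3 = 0.
  have := eB i1; rewrite /cross vec3E p3 mul0r subr0.
  move/eqP; rewrite mulf_eq0 (gt_eqF B1)/= mulf_eq0 (gt_eqF p2)/= /sq sqrf_eq0.
  by move/eqP.
exists A, B; split=> //.
- move=> AB; have := homo_ge_limitNy Vh VA 0; have := homo_le_limit Vh VB 1.
  by have := Vs 0 1 ltr01; rewrite AB; lra.
- rewrite -subr_gt0 -/(V B) ltNge; apply/negP => VB0.
  have : 0 < B 0 i3.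
    have h3 : {homo (fun t => g t 0 i3) : s t / s <= t}.
      apply: (coord_homo sg) => t; rewrite C3 oppr_ge0.
      exact: le_trans (homo_le_limit Vh VB t) VB0.
    exact: lt_le_trans (g0 0 i3) (homo_le_limit h3 (cB i3) 0).
  by rewrite B3 ltxx.
Qed.

(** The first coordinate is constant, the second one increases and the third one
    decreases; a stationary limit leaves room for only one of the last two. *)
Lemma limits_iv g : p i1 < 0 -> p i2 = 0 -> p i3 = 0 -> sphere_sol p g ->
  0 < g 0 0 i2 -> 0 < g 0 0 i3 -> exists A B : 'rV[R]_3, [/\ g t @[t --> -oo] --> A,
    g t @[t --> +oo] --> B, A <> B &
    [/\ B 0 i3 = 0, A 0 i2 = 0, A 0 i1 = g 0 0 i1 & B 0 i1 = g 0 0 i1]].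
Proof.
move=> p1 p2 p3 sg /(sphere_sol_gt0 sg) g2 /(sphere_sol_gt0 sg) g3.
have [A gA] := two_monotone_cvgNy sg p3; have [B gB] := two_monotone_cvg sg p3.
have cB i : g t 0 i @[t --> +oo] --> B 0 i by exact: coord_cvg.
have C1 t : cross p (sq (g t)) i1 = 0 by rewrite /cross !vec3E p3 p2; ring.
have C2 t : cross p (sq (g t)) i2 = - p i1 * sq (g t) i3.
  by rewrite /cross !vec3E p3; ring.
have C3 t : cross p (sq (g t)) i3 = p i1 * sq (g t) i2.
  by rewrite /cross !vec3E p2; ring.
have g1 t : g t 0 i1 = g 0 0 i1.
  by apply: (cst_of_derive (fun t => sg.2 t i1)) => s; rewrite C1 mulr0.
have sq0 t i : 0 <= sq (g t) i by exact: sqr_ge0.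
have h2 : {homo (fun t => g t 0 i2) : s t / s <= t}.
  by apply: (coord_homo sg) => t; rewrite C2 mulr_ge0// oppr_ge0 ltW.
have d3 (t : R) : is_derive t 1 (fun t => - g t 0 i3) (- (g t 0 i3 * cross p (sq (g t)) i3)).
  by have ? := sg.2 t i3; deriv_ring.
have h3 : {homo (fun t => - g t 0 i3) : s t / s <= t}.
  apply: (homo_of_derive d3) => t.
  by rewrite C3 -mulrN -mulNr !mulr_ge0// ?oppr_ge0 ltW.
have B2 : 0 < B 0 i2.
  exact: lt_le_trans (g2 0) (homo_le_limit h2 (cB i2) 0).
have A3 : 0 < A 0 i3.
  have : - A 0 i3 <= - g 0 0 i3.
    apply: (homo_ge_limitNy h3 _ 0); apply: cvgN; exact: coord_cvg.
  by rewrite lerN2; exact: lt_le_trans.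
have [SB eB] := limit_stationary sg gB; have [SA eA] := limit_stationaryNy sg gA.
have B3 : B 0 i3 = 0.
  have := eB i2; rewrite /cross vec3E p3 mul0r sub0r -mulNr.
  move/eqP; rewrite mulf_eq0 (gt_eqF B2)/= mulf_eq0 oppr_eq0 (lt_eqF p1)/= sqrf_eq0.
  by move/eqP.
have A2 : A 0 i2 = 0.
  have := eA i3; rewrite /cross vec3E p2 mul0r subr0.
  move/eqP; rewrite mulf_eq0 (gt_eqF A3)/= mulf_eq0 (lt_eqF p1)/= sqrf_eq0.
  by move/eqP.
exists A, B; split=> //.
  by move=> AB; move: B2; rewrite -AB A2 ltxx.
have cst (F : set_system R) (FF : ProperFilter F) (Q : 'rV[R]_3) : g t @[t --> F] --> Q ->
      Q 0 i1 = g 0 0 i1.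
    move=> gQ; have gQ1 : g t 0 i1 @[t --> F] --> Q 0 i1 by exact: coord_cvg.
    apply: (cvg_unique (@norm_hausdorff _ _) gQ1).
    rewrite (_ : (fun t => g t 0 i1) = cst (g 0 0 i1)); last exact/funext.
    exact: cvg_cst.
  by split=> //; [exact: cst gA|exact: cst gB].
Qed.

(** Both other coordinates decay exponentially compared with the second one. *)
Lemma limit_iiib g : p i1 < 0 -> p i2 = 0 -> 0 < p i3 -> sphere_sol p g ->
  0 < g 0 0 i2 -> g t @[t --> +oo] --> (e_ i2 : 'rV[R]_3).
Proof.
move=> p1 p2 p3 sg /(sphere_sol_gt0 sg) g2.
pose m := Num.min (p i3) (- p i1).
have m0 : 0 < m by rewrite lt_min p3 /= oppr_gt0.
have m1 : m <= - p i1 by rewrite ge_min lexx orbT.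
have m3 : m <= p i3 by rewrite ge_min lexx.
have main t : [/\ 0 <= sq (g t) i1, 0 <= sq (g t) i2, 0 <= sq (g t) i3 &
    m = m * sq (g t) i1 + m * sq (g t) i2 + m * sq (g t) i3].
  split; try exact: sqr_ge0.
  by have /S2pE[_] := sg.1 t; rewrite sum3 -!mulrDr => ->; rewrite mulr1.
have dec j : j != i2 -> g t 0 j @[t --> +oo] --> (0 : R).
  move=> j2.
  have diff t : 0 <= t -> m <= cross p (sq (g t)) i2 - cross p (sq (g t)) j.
    move=> _; have [u1 u2 u3 ->] := main t.
    have := ler_wpM2r u1 m3; have := ler_wpM2r u1 m1.
    have := ler_wpM2r u2 m3; have := ler_wpM2r u2 m1.
    have := ler_wpM2r u3 m3; have := ler_wpM2r u3 m1.
    by move: j j2; apply: ord3_ind => //= _; rewrite /cross !vec3E p2; lra.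
  have [c hc] := ratio_decay sg g2 diff; exact: decay_cvg0 m0 hc.
exact: (cvg_e sg).
Qed.

End TwoMonotone.

(** * Connecting orbits on the edges *)

Section EdgeOrbits.
Variable R : realType.
Implicit Types (x y Q A B : 'rV[R]_3) (p : 'I_3 -> R) (g : R -> 'rV[R]_3).

Lemma ivt_line (f : R -> R) (s t v : R) : continuous f -> f s <= v <= f t ->
  exists c, f c = v.
Proof.
move=> cf /andP[sv vt].
have seg a b : a <= b -> Num.min (f a) (f b) <= v <= Num.max (f a) (f b) ->
    exists c, f c = v.
  by move=> ab h; have [c _ <-] := IVT ab (continuous_subspaceT cf) h; exists c.
have h : Num.min (f s) (f t) <= v <= Num.max (f s) (f t).
  by rewrite ge_min sv le_max vt orbT.
have [st|/ltW ts] := leP s t; first exact: seg st h.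
by apply: seg ts _; rewrite minC maxC.
Qed.

Lemma coord_lim0 (F : set_system R) (FF : ProperFilter F) g Q i :
  (forall t, g t 0 i = 0) -> g t @[t --> F] --> Q -> Q 0 i = 0.
Proof.
move=> g0 gQ; have gQi : g t 0 i @[t --> F] --> Q 0 i by exact: coord_cvg.
apply: (cvg_unique (@norm_hausdorff _ _) gQi).
rewrite (_ : (fun t => g t 0 i) = cst 0); last exact/funext.
exact: cvg_cst.
Qed.

Definition open_edge (i j k : 'I_3) : set 'rV[R]_3 :=
  [set x | [/\ S2p x, x 0 k = 0, 0 < x 0 i & 0 < x 0 j]].

(** An orbit joining the two vertices takes every intermediate value of one
    coordinate, which determines the point of the edge. *)
Lemma edge_cover p g i j k x : cyclic3 i j k -> p k != 0 -> sphere_sol p g ->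
  open_edge i j k (g 0) -> open_edge i j k x -> range g x.
Proof.
move=> c pk sg [_ gk0 gi0 gj0] [xS xk xi xj].
have gk := sphere_sol_eq0 sg gk0; have gi := sphere_sol_gt0 sg gi0.
have gj := sphere_sol_gt0 sg gj0.
have [ji ki kj _] := cyclic3_neq c.
have [h1 h2] := edge_limit c sg gk gi gj; have [h3 h4] := edge_limitNy c sg gk gi gj.
have xi1 : x 0 i < 1.
  move: xS => /S2pE[_]; rewrite (cyclic3_sum c) /sq xk expr0n addr0 => x1.
  rewrite ltNge; apply/negP => x1i; have := exprn_gt0 2 xj; move: x1; nra.
have near1 (F : set_system R) (FF : ProperFilter F) : g t @[t --> F] --> (e_ i : 'rV[R]_3) ->
    exists t, x 0 i <= g t 0 i.
  move=> gF; have gFi : g t 0 i @[t --> F] --> (1 : R).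
    by have : g t 0 i @[t --> F] --> (e_ i : 'rV[R]_3) 0 i by [exact: coord_cvg];
       rewrite e_E eqxx.
  have d0 : 0 < 1 - x 0 i by rewrite subr_gt0.
  have /cvgrPdist_le/(_ _ d0) := gFi => nF.
  have [t ht] := filter_ex nF; exists t; move: ht; rewrite ler_norml; lra.
have near0 (F : set_system R) (FF : ProperFilter F) : g t @[t --> F] --> (e_ j : 'rV[R]_3) ->
    exists t, g t 0 i <= x 0 i.
  move=> gF; have gFi : g t 0 i @[t --> F] --> (0 : R).
    by have : g t 0 i @[t --> F] --> (e_ j : 'rV[R]_3) 0 i by [exact: coord_cvg];
       rewrite e_E eq_sym (negPf ji).
  have /cvgrPdist_le/(_ _ xi) := gFi => nF.
  have [t ht] := filter_ex nF; exists t; move: ht; rewrite ler_norml; lra.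
have [[s hs] [t ht]] : (exists s, g s 0 i <= x 0 i) /\ (exists t, x 0 i <= g t 0 i).
  move: pk; rewrite neq_lt => /orP[pk|pk]; split.
  - exact: near0 (h4 pk).
  - exact: near1 (h2 pk).
  - exact: near0 (h1 pk).
  - exact: near1 (h3 pk).
have ci : continuous (fun t => g t 0 i).
  by move=> u; exact: is_derive_continuous (sg.2 u i).
have [u ui] := ivt_line ci (introT andP (conj hs ht)).
exists u => //; apply: sq_inj => //; first exact: sg.1.
have /S2pE[_] := sg.1 u; have /S2pE[_] := xS; rewrite !(cyclic3_sum c).
have sk : sq (g u) k = sq x k by rewrite /sq gk xk.
have si : sq (g u) i = sq x i by rewrite /sq ui.
by rewrite sk si => <- h; apply/funext; apply: (cyclic3_all c) => //; lra.
Qed.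

Lemma open_edge_point i j k : cyclic3 i j k -> exists x, open_edge i j k x.
Proof.
move=> c; have [ji ki kj _] := cyclic3_neq c.
have h0 : 0 <= 2^-1 :> R by rewrite invr_ge0.
exists (\row_l if l == k then 0 else Num.sqrt (2^-1)); split.
- apply/S2pE; split=> [l|]; first by rewrite mxE; case: ifP => _ //; exact: sqrtr_ge0.
  rewrite (cyclic3_sum c) /sq !mxE eqxx ![_ == k]eq_sym (negPf ki) (negPf kj).
  by rewrite sqr_sqrtr//; field.
- by rewrite mxE eqxx.
- by rewrite mxE eq_sym (negPf ki) sqrtr_gt0 invr_gt0.
- by rewrite mxE eq_sym (negPf kj) sqrtr_gt0 invr_gt0.
Qed.

Lemma e_inj : injective (@e_ R).
Proof.
move=> i j /(congr1 (fun x : 'rV[R]_3 => x 0 i)); rewrite !e_E eqxx.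
by case: eqVneq => // _ /eqP; rewrite oner_eq0.
Qed.

Lemma open_edge_flow p g i j k : cyclic3 i j k -> sphere_sol p g ->
  open_edge i j k (g 0) -> range g `<=` open_edge i j k.
Proof.
move=> c sg [_ gk gi gj] _ [t _ <-]; split; first exact: sg.1.
- exact: sphere_sol_eq0 sg gk t.
- exact: sphere_sol_gt0 sg gi t.
- exact: sphere_sol_gt0 sg gj t.
Qed.

Lemma open_edge_heteroclinic alpha (d : 'I_3 -> R) i j k : cyclic3 i j k ->
  (0 < exponents alpha d k -> heteroclinic_orbit alpha d (e_ i) (e_ j) (open_edge i j k)) /\
  (exponents alpha d k < 0 -> heteroclinic_orbit alpha d (e_ j) (e_ i) (open_edge i j k)).
Proof.
move=> c; have [x xe] := open_edge_point c; have xS : S2p x by case: xe.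
have [g [sg g0 _]] := sphere_sol_exists (exponents alpha d) xS.
rewrite -g0 in xe.
have [ji ki kj _] := cyclic3_neq c.
have rE : exponents alpha d k != 0 -> open_edge i j k = range g.
  move=> pk; apply/seteqP; split; last exact: open_edge_flow sg xe.
  by move=> y; exact: edge_cover pk sg xe.
have [_ gk0 gi0 gj0] := xe.
have gk := sphere_sol_eq0 sg gk0; have gi := sphere_sol_gt0 sg gi0.
have gj := sphere_sol_gt0 sg gj0.
have [h1 h2] := edge_limit c sg gk gi gj; have [h3 h4] := edge_limitNy c sg gk gi gj.
have eij : (e_ i : 'rV[R]_3) <> e_ j by move/e_inj => ij; rewrite ij eqxx in ji.
split=> pk; (rewrite rE; last by rewrite neq_lt pk ?orbT).
- apply: (@heteroclinicI _ alpha d _ g (e_ i) (e_ j) erefl sg) => //; [exact: h3|exact: h1].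
- apply: (@heteroclinicI _ alpha d _ g (e_ j) (e_ i) erefl sg); [exact: h4|exact: h2|].
  by move/esym.
Qed.

Lemma bdS2pE x : bdS2p x <-> S2p x /\ exists k, x 0 k = 0.
Proof.
split=> [[xS [xR xb]]|[xS [k xk]]].
  split=> //; apply: contrapT => /forallNP h; apply: xb => i.
  have xi := xR i; rewrite lt_def xi andbT; exact/eqP/h.
split=> //; split; first by case: xS.
by move=> /(_ k); rewrite xk ltxx.
Qed.

Lemma bdS2p_cases x : bdS2p x -> (exists i, x = e_ i) \/
  exists i j k, cyclic3 i j k /\ open_edge i j k x.
Proof.
move=> /bdS2pE[xS [k xk]]; have [i [j c]] := cyclic3_third k.
have [xi0|xi0] := eqVneq (x 0 i) 0; first by left; exists j; exact: S2p_eqE c _ _ _.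
have [xj0|xj0] := eqVneq (x 0 j) 0.
  by left; exists i; exact: S2p_eqE (cyclic3_rot (cyclic3_rot c)) xS xj0 xk.
have /S2pE[xR _] := xS.
by right; exists i, j, k; split=> //; split; rewrite // lt_def ?xi0 ?xj0 xR.
Qed.

Lemma bdS2p_e i : bdS2p (e_ i : 'rV[R]_3).
Proof.
apply/bdS2pE; split; first exact: S2p_e.
by exists (ordS i); rewrite e_E; move: i; apply: ord3_ind.
Qed.

Lemma open_edge_bd i j k : open_edge i j k `<=` bdS2p.
Proof. by move=> x [xS xk _ _]; apply/bdS2pE; split=> //; exists k. Qed.

Lemma cyclic3_ordS (i : 'I_3) : cyclic3 i (ordS i) (ordS (ordS i)).
Proof.
have S1 : ordS i1 = i2 by exact: val_inj.
have S2 : ordS i2 = i3 by exact: val_inj.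
have S3 : ordS i3 = i1 by exact: val_inj.
by move: i; apply: ord3_ind; rewrite ?S1 ?S2 ?S3 ?S1 ?S2; constructor.
Qed.

Lemma boundary_polycycle alpha (d : 'I_3 -> R) :
  (forall k, 0 < exponents alpha d k) -> heteroclinic_polycycle alpha d bdS2p.
Proof.
move=> p0; exists 3%N, (@e_ R), (fun i => open_edge i (ordS i) (ordS (ordS i))).
split=> //; first exact: e_inj.
  by move=> i; have [+ _] := open_edge_heteroclinic alpha d (cyclic3_ordS i); apply.
apply/seteqP; split=> [x /bdS2p_cases[[i ->]|[i [j [k [c xe]]]]]|x [i _ [->|]]].
- by exists i => //; left.
- exists i => //; right.
  have [_ _ _ ->] := cyclic3_neq c.
  by have [_ _ _ ->] := cyclic3_neq (cyclic3_rot c).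
- exact: bdS2p_e.
- exact: open_edge_bd.
Qed.

End EdgeOrbits.

(** * The portraits without periodic orbits *)

Section PhasePortraits.
Variable R : realType.
Variables (alpha : R) (d : 'I_3 -> R).
Hypothesis alpha0 : 0 < alpha.
Let p := exponents alpha d.
Implicit Types (x y Q A B : 'rV[R]_3) (g : R -> 'rV[R]_3).

Let p1E : p i1 = alpha + d i3. Proof. by rewrite /p exponentsE. Qed.
Let p2E : p i2 = alpha + d i2. Proof. by rewrite /p exponentsE. Qed.
Let p3E : p i3 = alpha + d i1. Proof. by rewrite /p exponentsE. Qed.

Let equilibrium_e i : equilibrium alpha d (e_ i).
Proof. by apply/equilibriumE => [|l]; [exact: S2p_e|exact: stationary_e]. Qed.

Let not_lim_e (F : set_system R) (FF : ProperFilter F) g i :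
  (forall t, g t 0 i = 0) -> ~ (g t @[t --> F] --> (e_ i : 'rV[R]_3)).
Proof.
move=> g0 ge; have /eqP : (e_ i : 'rV[R]_3) 0 i = 0 by exact: coord_lim0 g0 ge.
by rewrite e_E eqxx oner_eq0.
Qed.

Lemma boundary_omega_vertex : (forall k, p k != 0) ->
  forall x, (bdR3p `\ 0) x -> exists i, omega_limit alpha d x = [set e_ i].
Proof.
move=> p0 x xb; have [//|[k [Q [pk _ _ _]]]] := boundary_omega d alpha0 xb.
by have := p0 k; rewrite /p pk eqxx.
Qed.

Lemma equilibria_edge i j k : cyclic3 i j k -> p k = 0 ->
  Gamma i j `<=` equilibrium alpha d.
Proof.
move=> c pk x /(GammaE _ c)[xS xk]; apply/equilibriumE => //.
exact: stationary_edge c xk pk.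
Qed.

Lemma portrait_ii : in_case P_ii alpha d ->
    [/\ stable_node alpha d (e_ i1), unstable_node alpha d (e_ i3),
        saddle alpha d (e_ i2)
      & forall gamma, complete_solution alpha d gamma -> range gamma `<=` S2p ->
          gamma t @[t --> -oo] --> (e_ i3 : 'rV[R]_3) ->
          (gamma t @[t --> +oo] --> (e_ i1 : 'rV[R]_3) <->
           ~ range gamma `<=` Gamma i2 i3)] /\
    (forall x, IntR3p x -> omega_limit alpha d x = [set e_ i1]) /\
    (forall x, (bdR3p `\ 0) x -> exists i, omega_limit alpha d x = [set e_ i]).
Proof.
rewrite /in_case -p1E -p2E -p3E => -[p3 p2 p1].
split; [split|split].
- split; first exact: equilibrium_e.
  exists (p i3), (- p i2); split; [exact: tangent_eigenvalues_e Cyclic123|by []|].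
  by rewrite oppr_lt0.
- split; first exact: equilibrium_e.
  exists (p i2), (- p i1); split; [exact: tangent_eigenvalues_e Cyclic312|by []|].
  by rewrite oppr_gt0.
- split; first exact: equilibrium_e.
  exists (p i1), (- p i3); split; [exact: tangent_eigenvalues_e Cyclic231|by []|].
  by rewrite oppr_gt0.
- move=> g cs gS g3; have sg := (sphere_solP alpha d g).1 (conj cs gS).
  split=> [g1 sub|nsub].
    have g0 t : g t 0 i1 = 0.
      by have /(GammaE _ Cyclic231)[] : Gamma i2 i3 (g t) by apply: sub; exists t.
    exact: not_lim_e g0 g1.
  apply: (limit_ii p1 p2 p3 sg).
    have [g0|//] := sphere_sol_sign sg i1.
    exfalso; apply: nsub => _ [t _ <-]; apply/(GammaE _ Cyclic231).
    by split; [exact: sg.1|exact: g0].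
  have [g0|//] := sphere_sol_sign sg i3.
  by exfalso; exact: not_lim_e g0 g3.
- move=> x xI; have [g [sg g0 ->]] := interior_omega d alpha0 xI.
  by apply: Omega_cvg; exact: (limit_ii p1 p2 p3 sg (g0 0 i1) (g0 0 i3)).
- by apply: boundary_omega_vertex; apply: ord3_ind; rewrite neq_lt ?p1 ?p2 ?p3 ?orbT.
Qed.

Lemma portrait_v : in_case P_v alpha d ->
    S2p `<=` equilibrium alpha d /\
    (forall x, (R3p `\ 0) x ->
       exists2 Q, ray x `&` S2p = [set Q] & omega_limit alpha d x = [set Q]).
Proof.
rewrite /in_case -p1E -p2E -p3E => -[p3 p2 p1].
have st x i : x 0 i * cross p (sq x) i = 0.
  by move: i; apply: ord3_ind; rewrite /cross vec3E ?p1 ?p2 ?p3; ring.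
split=> [x xS|x [xR /eqP xn0]]; first by apply/equilibriumE.
have xS := enorm_normalize xR xn0; have e0 := enorm_gt0 xn0.
exists ((enorm x)^-1 *: x).
  apply/seteqP; split=> [_ [[l l0 <-] lS]|_ ->].
    congr (_ *: _); have := S2p_enorm lS.
    have : enorm (l *: x) ^+ 2 = (l * enorm x) ^+ 2.
      rewrite enormE exprMn enormE mulr_sumr; apply: eq_bigr => i _.
      by rewrite /sq mxE exprMn.
    move=> /[swap] ->; rewrite expr1n => /esym/eqP; rewrite sqrf_eq1 => /orP[|] /eqP h.
      by rewrite -[RHS]mul1r -h mulfK// gt_eqF.
    by have := mulr_gt0 l0 e0; rewrite h ltr0N1.
  by split=> //; exists (enorm x)^-1 => //=; rewrite invr_gt0.
have [g [sg g0 _]] := sphere_sol_exists p xS.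
rewrite (omega_limitE alpha0 xn0 sg g0); apply: Omega_cvg.
have gc := stationary_cst sg (st (g 0)).
by under eq_fun do rewrite gc g0; exact: cvg_cst.
Qed.

Lemma portrait_iiib : in_case P_iiib alpha d ->
    [/\ stable_node alpha d (e_ i2)
      & forall x, S2p x -> (goes_to alpha d x (e_ i2) <-> ~ Gamma i1 i3 x)] /\
    (forall x, IntR3p x -> omega_limit alpha d x = [set e_ i2]) /\
    (forall x, (bdR3p `\ 0) x ->
       omega_limit alpha d x = [set e_ i2] \/
       exists2 Q, Gamma i1 i3 Q & omega_limit alpha d x = [set Q]).
Proof.
rewrite /in_case -p1E -p2E -p3E => -[p3 p2 p1].
split; [split|split].
- split; first exact: equilibrium_e.
  exists (p i1), (- p i3); split; [exact: tangent_eigenvalues_e Cyclic231|by []|].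
  by rewrite oppr_lt0.
- move=> x xS; have [g [sg g0 _]] := sphere_sol_exists p xS.
  rewrite (goes_toE _ sg g0) Gamma_sym.
  split=> [g2 /(GammaE _ Cyclic312)[_ x2]|nG].
    have gz : forall t, g t 0 i2 = 0 by apply: (@sphere_sol_eq0 _ p g i2 0); rewrite ?g0.
    exact: not_lim_e gz g2.
  apply: (limit_iiib p1 p2 p3 sg).
  have [gz|//] := sphere_sol_sign sg i2.
  by exfalso; apply: nG; apply/(GammaE _ Cyclic312); split=> //; rewrite -g0.
- move=> x xI; have [g [sg g0 ->]] := interior_omega d alpha0 xI.
  by apply: Omega_cvg; exact: (limit_iiib p1 p2 p3 sg (g0 0 i2)).
- move=> x xb.
  have G k Q : k != i2 -> S2p Q -> Q = e_ k -> Gamma i1 i3 Q.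
    move=> k2 QS ->; rewrite Gamma_sym; apply/(GammaE _ Cyclic312); split; first exact: S2p_e.
    by rewrite e_E eq_sym (negPf k2).
  have [[i ->]|[k [Q [pk QS Qk ->]]]] := boundary_omega d alpha0 xb.
    have [->|i2'] := eqVneq i i2; first by left.
    by right; exists (e_ i) => //; apply: G i2' _ erefl; exact: S2p_e.
  right; exists Q => //; rewrite Gamma_sym; apply/(GammaE _ Cyclic312); split=> //.
  move: k pk Qk; apply: ord3_ind => //.
    by move=> pk; move: p1; rewrite /p pk ltxx.
  by move=> pk; move: p3; rewrite /p pk ltxx.
Qed.

(** Infinitely many orbits: those through the points [x n] on the diagonal
    [x1 = x2] have pairwise distinct values of the first integral. *)
Lemma portrait_iiia : in_case P_iiia alpha d ->
    [/\ IntS2p = \bigcup_(G in heteroclinic_orbit_in alpha d IntS2p) G,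
        infinite_set (heteroclinic_orbit_in alpha d IntS2p),
        infinite_set (@Gamma R i1 i2) /\ Gamma i1 i2 `<=` equilibrium alpha d
      & equilibrium alpha d (e_ i3) /\
        bdS2p = Gamma i1 i2 `|` [set e_ i3]
                `|` \bigcup_(G in heteroclinic_orbit_in alpha d bdS2p) G] /\
    (forall x, IntR3p x ->
       exists2 Q, Gamma12p alpha d Q & omega_limit alpha d x = [set Q]) /\
    (forall x, (bdR3p `\ 0) x ->
       omega_limit alpha d x = [set e_ i3] \/
       exists2 Q, Gamma i1 i2 Q & omega_limit alpha d x = [set Q]).
Proof.
rewrite /in_case -p1E -p2E -p3E => -[p3 p2 p1].
have het g : sphere_sol p g -> (forall t i, 0 < g t 0 i) ->
    heteroclinic_orbit_in alpha d IntS2p (range g).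
  move=> sg g0; have [A [B [gA gB AB _ _]]] := limits_iiia p1 p2 p3 sg g0.
  split; last by move=> _ [t _ <-]; split; [exact: sg.1|move=> i; exact: g0].
  by exists A, B; exact: (@heteroclinicI _ alpha d p g A B erefl sg).
have flow x : IntS2p x -> exists g, [/\ sphere_sol p g, g 0 = x & forall t i, 0 < g t 0 i].
  move=> [xS xI]; have [g [sg g0 _]] := sphere_sol_exists p xS; exists g; split=> // t i.
  by apply: (@sphere_sol_gt0 _ p _ _ 0) => //; rewrite g0; exact: xI.
split; [split|split].
- apply/seteqP; split=> [x xI|x [G [_ GI] /GI]//].
  have [g [sg g0 gpos]] := flow x xI.
  by exists (range g); [exact: het|exists 0].
- pose s n : R := n.+2%:R^-1.
  have s0 n : 0 < s n by rewrite invr_gt0.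
  have s2 n : 0 < 1 - s n ^+ 2 - s n ^+ 2.
    have : s n <= 2^-1 by rewrite lef_pV2 ?posrE// ler_nat.
    by have := s0 n; nra.
  pose x n : 'rV[R]_3 := row3 (s n) (s n) (Num.sqrt (1 - s n ^+ 2 - s n ^+ 2)).
  have xI n : IntS2p (x n).
    have xp : forall i, 0 < x n 0 i by apply: ord3_ind; rewrite row3E ?sqrtr_gt0.
    split=> //; apply/S2pE; split=> [i|]; first exact: ltW.
    by rewrite sum3 /sq !row3E sqr_sqrtr ?ltW//; ring.
  have /choice[g gP] := fun n => flow (x n) (xI n).
  apply: (@infinite_of_injection _ _ (fun n => range (g n))) => [m n mn|n]; last first.
    by have [sg g0 gpos] := gP n; exact: het.
  have [sm m0 mpos] := gP m; have [sn n0 npos] := gP n.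
  have : range (g n) (x m) by rewrite -mn; exists 0.
  move=> [t _ gt]; have := log_integral sn npos t; rewrite gt n0 !sum3 !row3E p3 !mul0r !addr0.
  have p12 : p i1 + p i2 != 0 by rewrite gt_eqF//; exact: addr_gt0 p1 p2.
  rewrite -!mulrDl => /(mulfI p12) ln_eq.
  have := ln_inj _ _ ln_eq; rewrite !posrE !s0 => /(_ isT isT) /invr_inj /eqP.
  by rewrite eqr_nat => /eqP[].
- split; first exact: Gamma_infinite.
  exact: equilibria_edge Cyclic123 p3.
- split; first exact: equilibrium_e.
  have vtx i : i != i3 -> Gamma i1 i2 (e_ i : 'rV[R]_3).
    move=> i3'; apply/(GammaE _ Cyclic123); split; first exact: S2p_e.
    by rewrite e_E eq_sym (negPf i3').
  apply/seteqP; split=> [x /[dup] xb /bdS2p_cases[[i ->]|[i [j [k [c xe]]]]]|x].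
  + have [->|i3'] := eqVneq i i3; first by left; right.
    by left; left; exact: vtx.
  + have [pk|pk] := eqVneq (p k) 0.
      left; left; apply/(GammaE _ Cyclic123); have [xS xk _ _] := xe; split=> //.
      move: k pk xk {c xe}; apply: ord3_ind => //.
        by move=> pk; move: p1; rewrite pk ltxx.
      by move=> pk; move: p2; rewrite pk ltxx.
    right; exists (open_edge i j k) => //; split; last exact: open_edge_bd.
    have [h1 h2] := open_edge_heteroclinic alpha d c.
    by move: pk; rewrite neq_lt => /orP[/h2|/h1] h; [exists (e_ j), (e_ i)|exists (e_ i), (e_ j)].
  + move=> [[/(GammaE _ Cyclic123)[xS x3]|->]|[G [_ Gb] /Gb]//].
      by apply/bdS2pE; split=> //; exists i3.
    exact: bdS2p_e.
- move=> x xI; have [g [sg g0 ->]] := interior_omega d alpha0 xI.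
  have [A [B [gA gB AB B3 Bq]]] := limits_iiia p1 p2 p3 sg g0.
  have [BS _] := limit_stationary sg gB.
  exists B; last exact: Omega_cvg.
  split; first by apply/(GammaE _ Cyclic123).
  have /S2pE[B0] := BS; rewrite sum3 {3}/sq B3 expr0n addr0 => B1 /=.
  rewrite /qbar1 -p1E (_ : 2 * alpha + d i2 + d i3 = p i1 + p i2); last first.
    by rewrite p1E p2E; ring.
  have p12 : 0 < p i1 + p i2 by exact: addr_gt0 p1 p2.
  rewrite -[ltRHS]ger0_norm// -sqrtr_sqr ltr_sqrt ?exprn_gt0 ?ltr_pdivrMr//; last first.
    rewrite lt_def B0 andbT; apply/eqP => B10; move: Bq.
    by rewrite /sq B10 expr0n mulr0 ltNge mulr_ge0 ?sqr_ge0// ltW.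
  by move: Bq; rewrite -/(sq B i1) (_ : sq B i2 = 1 - sq B i1); [lra|rewrite -B1; ring].
- move=> x xb.
  have [[i ->]|[k [Q [pk QS Qk ->]]]] := boundary_omega d alpha0 xb.
    have [->|i3'] := eqVneq i i3; first by left.
    right; exists (e_ i) => //; apply/(GammaE _ Cyclic123); split; first exact: S2p_e.
    by rewrite e_E eq_sym (negPf i3').
  right; exists Q => //; apply/(GammaE _ Cyclic123); split=> //.
  move: k pk Qk; apply: ord3_ind => //.
    by move=> pk; move: p1; rewrite /p pk ltxx.
  by move=> pk; move: p2; rewrite /p pk ltxx.
Qed.

Lemma portrait_iv : in_case P_iv alpha d ->
    [/\ IntS2p = \bigcup_(G in heteroclinic_orbit_in alpha d IntS2p) G,
        infinite_set (@Gamma R i1 i2) /\ Gamma i1 i2 `<=` equilibrium alpha d,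
        infinite_set (@Gamma R i1 i3) /\ Gamma i1 i3 `<=` equilibrium alpha d
      & exists2 G, heteroclinic_orbit alpha d (e_ i3) (e_ i2) G &
          bdS2p = Gamma i1 i2 `|` Gamma i1 i3 `|` G] /\
    (forall x, IntR3p x ->
       exists2 Q, Gamma i1 i2 Q & omega_limit alpha d x = [set Q]) /\
    (forall x, (bdR3p `\ 0) x ->
       exists2 Q, (Gamma i1 i2 `|` Gamma i1 i3) Q &
         omega_limit alpha d x = [set Q]).
Proof.
rewrite /in_case -p1E -p2E -p3E => -[p3 p2 p1].
have G12 Q : S2p Q -> Q 0 i3 = 0 -> Gamma i1 i2 Q.
  by move=> QS Q3; apply/(GammaE _ Cyclic123).
have G13 Q : S2p Q -> Q 0 i2 = 0 -> Gamma i1 i3 Q.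
  by move=> QS Q2; rewrite Gamma_sym; apply/(GammaE _ Cyclic312).
have vtx i : (Gamma i1 i2 `|` Gamma i1 i3) (e_ i : 'rV[R]_3).
  move: i; apply: ord3_ind; [left; apply: G12|left; apply: G12|right; apply: G13];
    by rewrite ?e_E//; exact: S2p_e.
split; [split|split].
- apply/seteqP; split=> [x [xS xI]|x [G [_ GI] /GI]//].
  have [g [sg g0 _]] := sphere_sol_exists p xS.
  have gpos t i : 0 < g t 0 i.
    by apply: (@sphere_sol_gt0 _ p _ _ 0) => //; rewrite g0; exact: xI.
  have [A [B [gA gB AB _]]] := limits_iv p1 p2 p3 sg (gpos 0 i2) (gpos 0 i3).
  exists (range g); last by exists 0.
  split; last by move=> _ [t _ <-]; split; [exact: sg.1|exact: gpos].
  by exists A, B; exact: (@heteroclinicI _ alpha d p g A B erefl sg).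
- split; first exact: Gamma_infinite.
  exact: equilibria_edge Cyclic123 p3.
- split; first exact: Gamma_infinite.
  by rewrite Gamma_sym; exact: equilibria_edge Cyclic312 p2.
- exists (open_edge i2 i3 i1).
    by have [_] := open_edge_heteroclinic alpha d Cyclic231; apply.
  apply/seteqP; split=> [x /bdS2p_cases[[i ->]|[i [j [k [c xe]]]]]|x].
  + by left; exact: vtx.
  + case: c xe => xe; last first.
    * by left; right; case: xe => xS x2 _ _; exact: G13.
    * by right.
    * by left; left; case: xe => xS x3 _ _; exact: G12.
  + move=> [[/(GammaE _ Cyclic123)[xS x3]|]|/open_edge_bd//].
      by apply/bdS2pE; split=> //; exists i3.
    rewrite Gamma_sym => /(GammaE _ Cyclic312)[xS x2].
    by apply/bdS2pE; split=> //; exists i2.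
- move=> x xI; have [g [sg gpos ->]] := interior_omega d alpha0 xI.
  have [A [B [gA gB AB [B3 _ _ _]]]] := limits_iv p1 p2 p3 sg (gpos 0 i2) (gpos 0 i3).
  have [BS _] := limit_stationary sg gB.
  by exists B; [exact: G12|exact: Omega_cvg].
- move=> x xb.
  have [[i ->]|[k [Q [pk QS Qk ->]]]] := boundary_omega d alpha0 xb.
    by exists (e_ i).
  exists Q => //; move: k pk Qk; apply: ord3_ind.
  + by move=> pk; move: p1; rewrite /p pk ltxx.
  + by move=> _ Q2; right; exact: G13.
  + by move=> _ Q3; left; exact: G12.
Qed.

End PhasePortraits.

(** * Weighted geometric means on the simplex *)

Section AbsPower.
Variable R : realType.

(** The absolute value extends the power to the whole line, so that continuity holds
    without sign conditions, including at 0. *)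
Lemma abs_powR_continuous (a : R) : 0 <= a ->
  continuous (fun y : R => Num.sqrt (y ^+ 2) `^ a).
Proof.
rewrite le_eqVlt => /predU1P[<-|a0] y.
  rewrite (_ : (fun y : R => _) = cst 1); first exact: cvg_cst.
  by apply/funext => z; rewrite powRr0.
have cabs : {for y, continuous (fun y : R => Num.sqrt (y ^+ 2))}.
  by apply: cts_comp; [apply: cts_sqr; exact: cvg_id|exact: sqrt_continuous].
have [y0|yn0] := eqVneq y 0.
  rewrite y0; apply/cvgrPdist_le => e e0.
  have d0 : 0 < e `^ a^-1 by rewrite powR_gt0.
  exists (e `^ a^-1) => //= z /=; rewrite sub0r normrN => ze.
  rewrite expr0n sqrtr0 powR0 ?gt_eqF// sub0r normrN ger0_norm ?powR_ge0//.
  rewrite sqrtr_sqr.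
  have -> : e = (e `^ a^-1) `^ a by rewrite -powRrM mulVf ?gt_eqF// powRr1// ltW.
  by apply: ge0_ler_powR; rewrite ?nnegrE ?(ltW a0) ?(ltW d0)// ltW.
have hp : {for Num.sqrt (y ^+ 2), continuous (fun z : R => z `^ a)}.
  apply: differentiable_continuous; apply/derivable1_diffP.
  by apply: derivable_powR; rewrite in_itv/= andbT sqrtr_gt0 exprn_even_gt0.
exact: cts_comp cabs hp.
Qed.

End AbsPower.

Section GeometricMean.
Variable R : realType.
Variable w : 'I_3 -> R.
Hypotheses (w0 : forall i, 0 <= w i) (w1 : \sum_i w i = 1).
Implicit Types (u v : 'I_3 -> R).

Definition simplex u := (forall i, 0 <= u i) /\ \sum_i u i = 1.

Lemma simplex_le1 u i : simplex u -> 0 <= u i <= 1.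
Proof.
move=> [u0 u1]; rewrite u0 -u1 sum3; have := u0 i1; have := u0 i2; have := u0 i3.
by move: i; apply: ord3_ind; lra.
Qed.

Definition gmean u : R := \prod_i u i `^ w i.

Definition segment u (s : R) : 'I_3 -> R := fun i => (1 - s) * w i + s * u i.

Lemma gmean_ge0 u : 0 <= gmean u.
Proof. by rewrite /gmean prodr_ge0// => i _; rewrite powR_ge0. Qed.

Lemma gmean_eq0 u i : 0 < w i -> u i = 0 -> gmean u = 0.
Proof.
move=> wi ui; rewrite /gmean (bigD1 i)//= ui powR0 ?mul0r//.
by rewrite gt_eqF.
Qed.

Lemma gmean_eq0P u : gmean u = 0 -> exists2 i, 0 < w i & u i = 0.
Proof.
rewrite /gmean prod3 => /eqP; rewrite !mulf_eq0 !powR_eq0 -orbA.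
by move=> /or3P[] /andP[/eqP ui wi]; [exists i1|exists i2|exists i3];
  rewrite // lt_def wi w0.
Qed.

Lemma gmean_gt0 u : (forall i, 0 < w i -> 0 < u i) -> 0 < gmean u.
Proof.
move=> u0; rewrite lt_def gmean_ge0 andbT; apply/eqP => /gmean_eq0P[i wi ui].
by have := u0 i wi; rewrite ui ltxx.
Qed.

Lemma simplex_segment u s : simplex u -> 0 <= s <= 1 -> simplex (segment u s).
Proof.
move=> [u0 u1] /andP[s0 s1]; split=> [i|].
  by rewrite addr_ge0// mulr_ge0// subr_ge0.
by rewrite big_split/= -!mulr_sumr w1 u1; ring.
Qed.

(** Comparison of a single factor.  The exponentials multiply to at most 1 over all
    the factors, since their exponents have sum [(1 - s) * (sum u - sum w)] over the
    indices of positive weight.  The bound is [ln z <= z - 1] for [z = v / u]. *)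
Let factor (a v s : R) : 0 < a -> 0 <= v -> 0 <= s < 1 ->
  v `^ a <= ((1 - s) * a + s * v) `^ a * expR ((1 - s) * (v - a)) ?= iff (v == a).
Proof.
move=> a0 v0 /andP[s0 s1].
set u := (1 - s) * a + s * v.
have u0 : 0 < u by rewrite ltr_pwDl ?mulr_ge0// mulr_gt0// subr_gt0.
have [->|vn0] := eqVneq v 0.
  apply/leifP; rewrite eq_sym gt_eqF// powR0 ?gt_eqF//.
  by rewrite mulr_gt0 ?powR_gt0 ?expR_gt0.
have vp : 0 < v by rewrite lt_def vn0.
have vE : v = u * (v / u) by rewrite mulrCA divff ?mulr1 ?gt_eqF.
have vu : 0 < v / u by rewrite divr_gt0.
rewrite {1}vE powRM ?ltW//.
have upos : 0 < u `^ a by rewrite powR_gt0.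
have le1 : a * (v / u - 1) <= (1 - s) * (v - a).
  have -> : a * (v / u - 1) = (1 - s) * (v - a) - (1 - s) * s * (v - a) ^+ 2 / u.
    by rewrite /u; field; rewrite -/u gt_eqF.
  by rewrite gerBl divr_ge0 ?(ltW u0)// mulr_ge0 ?sqr_ge0// mulr_ge0// subr_ge0 ltW.
have powE : (v / u) `^ a = expR (a * ln (v / u)) by rewrite /powR gt_eqF.
have lnE : v / u <= expR (v / u - 1) by have := expR_ge1Dx (v / u - 1); rewrite addrCA subrr addr0.
apply/leifP; case: eqVneq => va.
  have uE : u = v by rewrite /u va; ring.
  by rewrite uE divff// powR1 va subrr mulr0 expR0.
rewrite ltr_pM2l//; apply: lt_le_trans (_ : expR (a * (v / u - 1)) <= _); last first.
  by rewrite ler_expR.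
rewrite powE ltr_expR ltr_pM2l// -ltr_expR lnK ?posrE//.
have := @expR_gt1Dx _ (v / u - 1); rewrite addrCA subrr addr0; apply.
have -> : v / u - 1 = (1 - s) * (v - a) / u by rewrite /u; field; rewrite -/u gt_eqF.
rewrite mulf_neq0 ?invr_eq0 ?(gt_eqF u0)// mulf_neq0// subr_eq0//.
by rewrite gt_eqF.
Qed.

(** Along each ray from [w] the weighted mean strictly decreases.  In particular [w]
    is its only maximum point, and a ray meets each level only once. *)
Lemma gmean_segment u s : simplex u -> u <> w -> 0 <= s < 1 ->
  gmean u < gmean (segment u s).
Proof.
move=> [u0 u1] uw /[dup] s01 /andP[s0 s1].
pose e i := if w i == 0 then 0 else (1 - s) * (u i - w i).
have fac i : u i `^ w i <= segment u s i `^ w i * expR (e i) ?= iff ((w i == 0) || (u i == w i)).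
  rewrite /e; case: eqVneq => [->|wi] /=.
    by apply/leifP; rewrite !powRr0 expR0 mulr1.
  by apply: factor => //; rewrite lt_def wi w0.
have e0 : e i1 + e i2 + e i3 <= 0.
  have ei i : e i <= (1 - s) * (u i - w i).
    rewrite /e; case: eqVneq => [->|_//].
    by rewrite subr0 mulr_ge0// subr_ge0 ltW.
  have := ei i1; have := ei i2; have := ei i3.
  move: u1 w1; rewrite !sum3 => u1' w1' *.
  have : (1 - s) * (u i1 - w i1) + (1 - s) * (u i2 - w i2) + (1 - s) * (u i3 - w i3) = 0.
    have -> : (1 - s) * (u i1 - w i1) + (1 - s) * (u i2 - w i2) + (1 - s) * (u i3 - w i3)
      = (1 - s) * ((u i1 + u i2 + u i3) - (w i1 + w i2 + w i3)) by ring.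
    by rewrite u1' w1' subrr mulr0.
  by lra.
have pos i : 0 < segment u s i `^ w i * expR (e i).
  rewrite mulr_gt0 ?expR_gt0//.
  have [->|wi] := eqVneq (w i) 0; first by rewrite powRr0.
  rewrite powR_gt0// ltr_pwDl ?mulr_ge0// mulr_gt0 ?subr_gt0//.
  by rewrite lt_def wi w0.
have lt : gmean u < \prod_i (segment u s i `^ w i * expR (e i)).
  rewrite /gmean !prod3.
  have f0 i : 0 <= u i `^ w i by exact: powR_ge0.
  have := fac i1; have := fac i2; have := fac i3.
  move=> l3 l2 l1.
  have l12 := leif_pM (f0 i1) (f0 i2) l1 l2.
  have l123 := leif_pM (mulr_ge0 (f0 i1) (f0 i2)) (f0 i3) l12 l3.
  rewrite lt_neqAle l123.1 andbT l123.2.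
  rewrite (gt_eqF (mulr_gt0 (mulr_gt0 (pos i1) (pos i2)) (pos i3))).
  rewrite (gt_eqF (mulr_gt0 (pos i1) (pos i2))) /=.
  apply: contra_notN uw => /andP[/andP[h1 h2] h3].
  have h i : (w i == 0) || (u i == w i) by move: i; exact: ord3_ind.
  have dz i : 0 <= u i - w i.
    by have /orP[/eqP ->|/eqP ->] := h i; rewrite ?subr0 ?subrr.
  have : \sum_i (u i - w i) = 0 by rewrite sumrB u1 w1 subrr.
  move/(psumr_eq0P (fun i _ => dz i)) => dd.
  by apply/funext => i; apply/eqP; rewrite -subr_eq0 dd.
apply: (lt_le_trans lt); rewrite big_split/= -[leRHS]mulr1 ler_wpM2l ?gmean_ge0//.
by rewrite prod3 -!expRD -expR0 ler_expR.
Qed.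

Lemma segment0 u : segment u 0 = w.
Proof. by apply/funext => i; rewrite /segment; ring. Qed.

Lemma segment1 u : segment u 1 = u.
Proof. by apply/funext => i; rewrite /segment; ring. Qed.

Lemma gmean_lt u : simplex u -> u <> w -> gmean u < gmean w.
Proof.
move=> us uw; have := @gmean_segment u 0 us uw.
by rewrite segment0 lexx ltr01; apply.
Qed.

Lemma gmean_center_gt0 : 0 < gmean w.
Proof. exact: gmean_gt0. Qed.

(** Every point lies on a segment from [w] to a point where the mean vanishes: the
    segment is prolonged until some ratio [u l / w l] reaches 0. *)
Lemma boundary_ray u : simplex u -> u <> w -> exists b s,
  [/\ simplex b, gmean b = 0, 0 < s <= 1 & u = segment b s].
Proof.
move=> us uw; have [u0 u1] := us.
(* a coordinate of weight 0 gets the ratio 1, which is not the minimum: some other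
   ratio is less than 1 *)
pose r i := if w i == 0 then 1 else u i / w i.
pose m := Num.min (r i1) (Num.min (r i2) (r i3)).
have mr i : m <= r i.
  by move: i; apply: ord3_ind; rewrite !ge_min lexx ?orbT.
have [l ml] : exists l, m = r l.
  by rewrite /m !minEle; case: ifP => _; [exists i1|case: ifP => _; [exists i2|exists i3]].
have r0 i : 0 <= r i by rewrite /r; case: ifP => _ //; rewrite divr_ge0.
have m0 : 0 <= m by rewrite ml.
have mw i : m * w i <= u i.
  have := mr i; rewrite /r; case: eqVneq => [->|wi]; first by rewrite mulr0.
  by rewrite ler_pdivlMr// lt_def wi w0.
have m1 : m < 1.
  rewrite ltNge; apply/negP => m1; apply: uw.
  have dz i : 0 <= u i - w i.
    by rewrite subr_ge0 (le_trans _ (mw i))// ler_peMl.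
  have : \sum_i (u i - w i) = 0 by rewrite sumrB u1 w1 subrr.
  move/(psumr_eq0P (fun i _ => dz i)) => dd.
  by apply/funext => i; apply/eqP; rewrite -subr_eq0 dd.
have wl : w l != 0.
  by apply/eqP => wl; move: m1; rewrite ml /r wl eqxx ltxx.
have nm : 1 - m != 0 by rewrite gt_eqF// subr_gt0.
exists (fun i => (u i - m * w i) / (1 - m)), (1 - m); split.
- split=> [i|]; first by rewrite divr_ge0 ?subr_ge0// ltW.
  by rewrite -mulr_suml sumrB -mulr_sumr u1 w1 mulr1 divff.
- apply: (@gmean_eq0 _ l); first by rewrite lt_def wl w0.
  by rewrite ml /r (negPf wl) divfK// subrr mul0r.
- by rewrite subr_gt0 m1 gerBl.
- by apply/funext => i; rewrite /segment; field.
Qed.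

Lemma gmean_segment_onto b (k : R) : simplex b -> gmean b = 0 -> 0 <= k <= gmean w ->
  exists2 s, 0 <= s <= 1 & gmean (segment b s) = k.
Proof.
move=> bs b0 /andP[k0 kw].
have sP s : 0 <= s <= 1 -> forall i, 0 <= segment b s i.
  by move=> s01; have [] := simplex_segment bs s01.
pose f (s : R) := gmean (fun i => Num.sqrt (segment b s i ^+ 2)).
have fE s : 0 <= s <= 1 -> f s = gmean (segment b s).
  move=> s01; apply: eq_bigr => i _.
  by rewrite sqrtr_sqr ger0_norm// sP.
have cf : continuous f.
  move=> s; rewrite /f /gmean; under eq_fun do rewrite prod3.
  have c i : {for s, continuous (fun s => Num.sqrt (segment b s i ^+ 2) `^ w i)}.
    apply: (@cts_comp _ _ (fun s => segment b s i) (fun y => Num.sqrt (y ^+ 2) `^ w i)).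
      apply: ctsD; apply: ctsM; try exact: cts_cst.
        by apply: ctsB; [exact: cts_cst|exact: cvg_id].
      exact: cvg_id.
    exact: abs_powR_continuous.
  exact: ctsM (ctsM (c i1) (c i2)) (c i3).
have f0 : f 0 = gmean w by rewrite fE ?lexx ?ler01// segment0.
have f1 : f 1 = 0 by rewrite fE ?lexx ?ler01// segment1.
have h : Num.min (f 0) (f 1) <= k <= Num.max (f 0) (f 1).
  by rewrite f0 f1 ge_min k0 orbT le_max kw.
have [s] := IVT ler01 (continuous_subspaceT cf) h.
by rewrite in_itv/= => s01 <-; exists s; rewrite ?fE.
Qed.

End GeometricMean.

Lemma cts_dominated (R : realType) (T : topologicalType) (f g : T -> R) x :
  {for x, continuous g} -> g x = 0 -> (forall y, `|f y| <= `|g y|) ->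
  {for x, continuous f}.
Proof.
move=> cg gx fg; have fx : f x = 0.
  by apply/eqP; rewrite -normr_le0 (le_trans (fg x))// gx normr0.
rewrite /prop_for /continuous_at fx; apply/cvgrPdist_le => e e0.
have : g y @[y --> x] --> (0 : R) by rewrite -gx.
move/cvgrPdist_le => /(_ e e0); apply: filterS => y.
by rewrite !sub0r !normrN; exact: le_trans.
Qed.

(** * Polar coordinates on the simplex *)

Section PolarModel.
Variable R : realType.
Implicit Types (x y : 'rV[R]_3) (u v w b c cx cy : 'I_3 -> R).

Definition lin c u : R := \sum_i c i * u i.

(** Normalized level of the mean: 0 at the centre and 1 where the mean vanishes. *)
Definition depth w u : R := 1 - gmean w u / gmean w w.

Definition modulus cx cy u : R := Num.sqrt (lin cx u ^+ 2 + lin cy u ^+ 2).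

(** Point of the unit disc with radius [depth] and with the direction of the pair of
    linear forms.  At the centre both factors vanish, so the value there is 0 although
    the direction is undefined. *)
Definition polar w cx cy u : 'rV[R]_3 :=
  row3 (depth w u * (lin cx u / modulus cx cy u))
       (depth w u * (lin cy u / modulus cx cy u)) 0.

(** The two forms are affine coordinates of the simplex with origin [w]. *)
Definition polar_frame w cx cy := [/\ simplex w, lin cx w = 0, lin cy w = 0 &
  forall u, \sum_i u i = 1 -> lin cx u = 0 -> lin cy u = 0 -> u = w].

(** Projective image of a diagonal map.  It carries the linear forms of one frame to
    those of another, up to a positive factor. *)
Definition rescale c u i := c i * u i / \sum_j c j * u j.

Lemma rescale_sum_gt0 c u : (forall i, 0 < c i) -> simplex u -> 0 < \sum_j c j * u j.
Proof.
move=> c0 [u0 u1]; have t i : 0 <= c i * u i by exact: mulr_ge0 (ltW (c0 i)) (u0 i).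
rewrite lt_def sumr_ge0 ?andbT//; apply/eqP => /(psumr_eq0P (fun i _ => t i)) z.
move: u1; rewrite big1 => [/esym/eqP|i _]; first by rewrite oner_eq0.
by have /eqP := z i isT; rewrite mulf_eq0 (gt_eqF (c0 i)) => /eqP.
Qed.

Lemma simplex_rescale c u : (forall i, 0 < c i) -> simplex u -> simplex (rescale c u).
Proof.
move=> c0 us; have S0 := rescale_sum_gt0 c0 us; split=> [i|].
  exact: divr_ge0 (mulr_ge0 (ltW (c0 i)) (us.1 i)) (ltW S0).
by rewrite -mulr_suml divff// gt_eqF.
Qed.

Lemma lin_rescale c b b' u : (forall i, 0 < c i) -> simplex u ->
  (forall i, b' i * c i = b i) -> lin b u = (\sum_j c j * u j) * lin b' (rescale c u).
Proof.
move=> c0 us bE; have S0 := rescale_sum_gt0 c0 us.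
rewrite /lin mulr_sumr; apply: eq_bigr => i _.
by rewrite -bE /rescale; field; rewrite gt_eqF.
Qed.

Lemma lin_segment c w u s : lin c w = 0 -> lin c (segment w u s) = s * lin c u.
Proof.
move=> cw; transitivity ((1 - s) * lin c w + s * lin c u); last by rewrite cw mulr0 add0r.
by rewrite /lin !sum3 /segment; ring.
Qed.

Lemma modulus_scale cx cy cx' cy' u v (k : R) : 0 < k ->
  lin cx u = k * lin cx' v -> lin cy u = k * lin cy' v ->
  modulus cx cy u = k * modulus cx' cy' v.
Proof.
move=> k0 ex ey; rewrite /modulus ex ey !exprMn -mulrDr sqrtrM ?sqr_ge0//.
by rewrite sqrtr_sqr gtr0_norm.
Qed.

Lemma polar_eq w cx cy w' cx' cy' u v (k : R) : 0 < k ->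
  lin cx u = k * lin cx' v -> lin cy u = k * lin cy' v -> depth w u = depth w' v ->
  polar w cx cy u = polar w' cx' cy' v.
Proof.
move=> k0 ex ey ed; rewrite /polar (modulus_scale k0 ex ey) ex ey ed.
have cancel (a m : R) : k * a / (k * m) = a / m.
  by rewrite invfM mulrACA divff ?mul1r// gt_eqF.
by rewrite !cancel.
Qed.

Lemma modulus_eq0 cx cy u : modulus cx cy u = 0 -> lin cx u = 0 /\ lin cy u = 0.
Proof.
move=> /eqP; rewrite sqrtr_eq0 => h.
have := sqr_ge0 (lin cx u); have := sqr_ge0 (lin cy u) => hy hx.
by split; apply/eqP; rewrite -sqrf_eq0; apply/eqP; lra.
Qed.

Section Frame.
Variables w cx cy : 'I_3 -> R.
Hypothesis frame : polar_frame w cx cy.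

Let ws : simplex w. Proof. by case: frame. Qed.
Let w0 i : 0 <= w i. Proof. by case: ws. Qed.
Let w1 : \sum_i w i = 1. Proof. by case: ws. Qed.
Let K0 : 0 < gmean w w. Proof. exact: gmean_center_gt0. Qed.

Lemma depth_center : depth w w = 0.
Proof. by rewrite /depth divff ?subrr ?gt_eqF. Qed.

Lemma depth_gt0 u : simplex u -> u <> w -> 0 < depth w u.
Proof.
move=> us uw; rewrite /depth subr_gt0 ltr_pdivrMr// mul1r.
exact: gmean_lt.
Qed.

Lemma depth_le1 u : depth w u <= 1.
Proof. by rewrite /depth gerBl divr_ge0 ?gmean_ge0. Qed.

Lemma depth_inj u v : depth w u = depth w v -> gmean w u = gmean w v.
Proof.
by move/addrI/oppr_inj/divIf; apply; rewrite gt_eqF.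
Qed.

Lemma modulus_gt0 u : simplex u -> u <> w -> 0 < modulus cx cy u.
Proof.
move=> [_ u1] uw; rewrite lt_def sqrtr_ge0 andbT; apply/eqP => /modulus_eq0[hx hy].
by have [_ _ _ inj] := frame; apply: uw; exact: inj.
Qed.

Lemma polar_sq u : simplex u -> u <> w ->
  polar w cx cy u 0 i1 ^+ 2 + polar w cx cy u 0 i2 ^+ 2 = depth w u ^+ 2.
Proof.
move=> us uw; have m0 := modulus_gt0 us uw.
have m2 : modulus cx cy u ^+ 2 = lin cx u ^+ 2 + lin cy u ^+ 2.
  by rewrite sqr_sqrtr// addr_ge0 ?sqr_ge0.
rewrite !row3E !exprMn -mulrDr !exprVn -mulrDl -m2 divff ?mulr1//.
by rewrite expf_neq0// gt_eqF.
Qed.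

Lemma polar_center : polar w cx cy w = 0.
Proof.
by apply: rowP3; rewrite row3E ?mxE ?depth_center ?mul0r.
Qed.

(** Equal directions put [u] on the segment from [w] to [v], where the level is
    attained only once. *)
Let same_direction u v (k : R) : simplex u -> simplex v -> 0 < k <= 1 ->
  lin cx u = k * lin cx v -> lin cy u = k * lin cy v -> gmean w u = gmean w v ->
  v <> w -> u = v.
Proof.
move=> us vs /andP[k0 k1] ex ey eK vw.
have [_ lx ly inj] := frame.
have uE : u = segment w v k.
  pose z i := u i - k * v i + k * w i.
  have zw : z = w.
    apply: inj.
    - transitivity (\sum_i u i - k * \sum_i v i + k * \sum_i w i).
        by rewrite !sum3 /z; ring.
      by rewrite w1; have [_ ->] := us; have [_ ->] := vs; ring.
    - transitivity (lin cx u - k * lin cx v + k * lin cx w); last by rewrite ex lx; ring.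
      by rewrite /lin !sum3 /z; ring.
    - transitivity (lin cy u - k * lin cy v + k * lin cy w); last by rewrite ey ly; ring.
      by rewrite /lin !sum3 /z; ring.
  apply/funext => i; have := congr1 (@^~ i) zw; rewrite /z /segment /=; lra.
move: k1; rewrite le_eqVlt => /predU1P[k1|k1]; first by rewrite uE k1 segment1.
have := gmean_segment w0 w1 vs vw (s := k); rewrite -uE eK ltxx.
by rewrite (ltW k0) k1 => /(_ isT).
Qed.

Lemma polar_inj u v : simplex u -> simplex v ->
  polar w cx cy u = polar w cx cy v -> u = v.
Proof.
move=> us vs e.
have zero z : simplex z -> polar w cx cy z = 0 -> z = w.
  move=> zs z0; apply: contrapT => zw; have := polar_sq zs zw.
  rewrite z0 !mxE expr0n addr0 => /esym/eqP; rewrite sqrf_eq0.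
  by rewrite gt_eqF// depth_gt0.
have [uw|uw] := pselect (u = w).
  by rewrite uw (zero v)// -e uw polar_center.
have [vw|vw] := pselect (v = w).
  by exfalso; apply: uw; apply: zero => //; rewrite e vw polar_center.
have du := depth_gt0 us uw; have dv := depth_gt0 vs vw.
have mu := modulus_gt0 us uw; have mv := modulus_gt0 vs vw.
have ed : depth w u = depth w v.
  by apply/eqP; rewrite -(@eqrXn2 _ 2) ?ltW// -!polar_sq// e.
have eK := depth_inj ed.
have [ex ey] : lin cx u / modulus cx cy u = lin cx v / modulus cx cy v /\
    lin cy u / modulus cx cy u = lin cy v / modulus cx cy v.
  split.
    have := congr1 (fun x : 'rV[R]_3 => x 0 i1) e; rewrite !row3E ed.
    by apply: mulfI; rewrite gt_eqF.
  have := congr1 (fun x : 'rV[R]_3 => x 0 i2) e; rewrite !row3E ed.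
  by apply: mulfI; rewrite gt_eqF.
have ratio (a b mu' mv' : R) : 0 < mu' -> 0 < mv' -> a / mu' = b / mv' -> a = mu' / mv' * b.
  by move=> h1 h2 h; rewrite -[LHS](divfK (lt0r_neq0 h1)) h; ring.
have [le|lt] := leP (modulus cx cy u) (modulus cx cy v).
  apply: (@same_direction u v (modulus cx cy u / modulus cx cy v)) => //; try exact: ratio.
  by rewrite divr_gt0// ler_pdivrMr// mul1r.
apply/esym/(@same_direction v u (modulus cx cy v / modulus cx cy u)) => //; try exact: ratio.
by rewrite divr_gt0// ler_pdivrMr// mul1r ltW.
Qed.

Let lin_sq_continuous c : continuous (fun x => lin c (sq x)).
Proof.
move=> x; rewrite /lin; under eq_fun do rewrite sum3.
have t i : {for x, continuous (fun x => c i * sq x i)}.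
  by apply: ctsM; [exact: cts_cst|apply: cts_sqr; exact: coord_continuous3].
exact: ctsD (ctsD (t i1) (t i2)) (t i3).
Qed.

Let depth_sq_continuous : continuous (fun x => depth w (sq x)).
Proof.
move=> x.
suff g : {for x, continuous (fun x => gmean w (sq x))}.
  have h : {for x, continuous (fun x => gmean w (sq x) / gmean w w)}.
    by apply: ctsM => //; exact: cts_cst.
  have h1 : {for x, continuous (fun _ : 'rV[R]_3 => 1 : R)} by exact: cts_cst.
  exact: ctsB h1 h.
have t i : {for x, continuous (fun x => sq x i `^ w i)}.
  rewrite (_ : (fun x : 'rV[R]_3 => sq x i `^ w i) = (fun x => Num.sqrt (sq x i ^+ 2) `^ w i)).
    have cq : {for x, continuous (fun x => sq x i)}.
      by apply: cts_sqr; exact: coord_continuous3.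
    exact: cts_comp cq (@abs_powR_continuous _ _ (w0 i) _).
  by apply/funext => y; rewrite sqrtr_sqr ger0_norm// sqr_ge0.
rewrite (_ : (fun x => gmean w (sq x)) =
  fun x => sq x i1 `^ w i1 * sq x i2 `^ w i2 * sq x i3 `^ w i3); last first.
  by apply/funext => y; rewrite /gmean prod3.
exact: ctsM (ctsM (t i1) (t i2)) (t i3).
Qed.

(** At the centre the depth tends to 0 and dominates, the direction being bounded. *)
Lemma polar_continuous x : S2p x -> {for x, continuous (fun x => polar w cx cy (sq x))}.
Proof.
move=> xS; have xs : simplex (sq x).
  by split; [move=> i; exact: sqr_ge0|have /S2pE[] := xS].
have dc := @depth_sq_continuous x.
have main c : (forall u, `|lin c u| <= modulus cx cy u) ->
    {for x, continuous (fun x => depth w (sq x) * (lin c (sq x) / modulus cx cy (sq x)))}.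
  move=> cm; have [xw|xw] := pselect (sq x = w); last first.
    apply: ctsM => //; apply: cts_div; first exact: lin_sq_continuous.
      have cq := ctsD (cts_sqr (@lin_sq_continuous cx x)) (cts_sqr (@lin_sq_continuous cy x)).
      exact: cts_comp cq (@sqrt_continuous _ _).
    by rewrite gt_eqF// modulus_gt0.
  have d0 : depth w (sq x) = 0 by rewrite xw depth_center.
  apply: (cts_dominated dc d0) => y.
  have M0 : 0 <= modulus cx cy (sq y) by exact: sqrtr_ge0.
  rewrite normrM ler_piMr// normrM normfV (ger0_norm M0).
  have [m0|m0] := eqVneq (modulus cx cy (sq y)) 0; first by rewrite m0 invr0 mulr0 ler01.
  by rewrite ler_pdivrMr ?mul1r// lt_def m0.
have sqrt_le (a b : R) : `|a| <= Num.sqrt (a ^+ 2 + b ^+ 2).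
  by rewrite -sqrtr_sqr ler_wsqrtr// lerDl sqr_ge0.
have coordE i f : (forall y, polar w cx cy (sq y) 0 i = f y) ->
    {for x, continuous f} -> {for x, continuous (fun y => polar w cx cy (sq y) 0 i)}.
  by move=> fE; rewrite (_ : (fun y => _) = f)//; apply/funext.
apply/continuous_rowP; apply: ord3_ind.
- apply: (coordE i1 (fun y => depth w (sq y) * (lin cx (sq y) / modulus cx cy (sq y)))).
    by move=> y; rewrite /polar row3E.
  by apply: main => u; exact: sqrt_le.
- apply: (coordE i2 (fun y => depth w (sq y) * (lin cy (sq y) / modulus cx cy (sq y)))).
    by move=> y; rewrite /polar row3E.
  by apply: main => u; rewrite /modulus addrC; exact: sqrt_le.
- apply: (coordE i3 (fun=> 0)); last exact: cts_cst.
  by move=> y; rewrite /polar row3E.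
Qed.

End Frame.

(** A boundary point of the first simplex is rescaled to a boundary point of the second
    one in the same direction, and every level is attained on the segment from the
    centre to it.  By symmetry the two images coincide. *)
Lemma polar_transfer w cx cy w' cx' cy' c : polar_frame w cx cy ->
  polar_frame w' cx' cy' -> (forall i, 0 < c i) ->
  (forall i, cx' i * c i = cx i) -> (forall i, cy' i * c i = cy i) ->
  (forall i, 0 < w i -> 0 < w' i) ->
  forall u, simplex u -> exists2 v, simplex v & polar w' cx' cy' v = polar w cx cy u.
Proof.
move=> fr fr' c0 ccx ccy ww u us.
have [ws lx ly _] := fr; have [ws' lx' ly' _] := fr'.
have [w0 w1] := ws; have [w0' w1'] := ws'.
have K0 : 0 < gmean w w by exact: gmean_center_gt0.
have K0' : 0 < gmean w' w' by exact: gmean_center_gt0.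
have [uw|uw] := pselect (u = w).
  by exists w' => //; rewrite uw !polar_center.
have [b [s [bs Kb /andP[s0 s1] ub]]] := boundary_ray w0 w1 us uw.
have [l wl bl] := gmean_eq0P w0 Kb.
have Z0 := rescale_sum_gt0 c0 bs; pose b' := rescale c b.
have bs' : simplex b' by exact: simplex_rescale.
have Kb' : gmean w' b' = 0.
  by apply: (gmean_eq0 (ww l wl)); rewrite /b' /rescale bl mulr0 mul0r.
pose k := gmean w' w' * (1 - depth w u).
have d0 : 0 < depth w u by have := @depth_gt0 w cx cy fr u us uw.
have d1 : depth w u <= 1 by exact: depth_le1.
have kb : 0 <= k <= gmean w' w'.
  rewrite mulr_ge0 ?(ltW K0') ?subr_ge0//= -[leRHS]mulr1 ler_wpM2l ?(ltW K0')//.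
  by rewrite gerBl ltW.
have [s' /andP[s0' s1'] Ks'] := gmean_segment_onto w0' w1' bs' Kb' kb.
have sp : 0 < s'.
  rewrite lt_def s0' andbT; apply/eqP => sz; move: Ks'; rewrite sz segment0 /k.
  move=> h; have : gmean w' w' * depth w u = 0 by move: h; lra.
  by move/eqP; rewrite mulf_eq0 !gt_eqF.
exists (segment w' b' s'); first by apply: simplex_segment => //; rewrite s0' s1'.
apply: (polar_eq (k := s' / (\sum_j c j * b j) / s)).
- by rewrite !divr_gt0.
- by rewrite ub !lin_segment// (lin_rescale c0 bs ccx); field; rewrite !gt_eqF.
- by rewrite ub !lin_segment// (lin_rescale c0 bs ccy); field; rewrite !gt_eqF.
- by rewrite {1}/depth Ks' /k; field; rewrite gt_eqF.
Qed.

End PolarModel.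

(** * Angle of a plane curve *)

Section Angles.
Variable R : realType.

Lemma polar_angle (a b : R) : a ^+ 2 + b ^+ 2 = 1 ->
  exists th, a = cos th /\ b = sin th.
Proof.
move=> ab.
have a1 : -1 <= a <= 1.
  by rewrite -ler_norml -(@expr_le1 _ 2)// real_normK ?num_real// -ab lerDl sqr_ge0.
have ca : cos (acos a) = a by rewrite acosK// in_itv.
have sa : sin (acos a) ^+ 2 = b ^+ 2.
  by have := cos2Dsin2 (acos a); rewrite ca -ab => /addrI.
have /eqP := sa; rewrite eqf_sqr => /orP[/eqP sb|/eqP sb].
  by exists (acos a).
by exists (- acos a); rewrite cosN sinN ca sb opprK.
Qed.

(** [Th] is the integral of the angular speed.  Rotated by [- Th] and divided by the
    exponential of the integral of the logarithmic radial speed, the curve becomes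
    constant; [P] and [Q] are the coordinates of this constant point. *)
Lemma polar_lift (X Y X' Y' : R -> R) :
  (forall t : R, is_derive t 1 X (X' t)) -> (forall t : R, is_derive t 1 Y (Y' t)) ->
  continuous X' -> continuous Y' -> (forall t, 0 < X t ^+ 2 + Y t ^+ 2) ->
  exists Th : R -> R, [/\ forall t : R, is_derive t 1 Th
      ((X t * Y' t - Y t * X' t) / (X t ^+ 2 + Y t ^+ 2)),
    forall t, X t = Num.sqrt (X t ^+ 2 + Y t ^+ 2) * cos (Th t) &
    forall t, Y t = Num.sqrt (X t ^+ 2 + Y t ^+ 2) * sin (Th t)].
Proof.
move=> dX dY cX' cY' pos.
have cX : continuous X by move=> t; exact: is_derive_continuous (dX t).
have cY : continuous Y by move=> t; exact: is_derive_continuous (dY t).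
pose N t := X t ^+ 2 + Y t ^+ 2.
have cN t : {for t, continuous N} by exact: ctsD (cts_sqr (cX t)) (cts_sqr (cY t)).
pose om t := (X t * Y' t - Y t * X' t) / N t.
pose ka t := (X t * X' t + Y t * Y' t) / N t.
have com : continuous om.
  move=> t; apply: cts_div (cN t) _; last by rewrite gt_eqF// pos.
  exact: ctsB (ctsM (cX t) (cY' t)) (ctsM (cY t) (cX' t)).
have cka : continuous ka.
  move=> t; apply: cts_div (cN t) _; last by rewrite gt_eqF// pos.
  exact: ctsD (ctsM (cX t) (cX' t)) (ctsM (cY t) (cY' t)).
have [A [A0 dA]] := primitive com; have [M [M0 dM]] := primitive cka.
have s0 : 0 < Num.sqrt (N 0) by rewrite sqrtr_gt0 pos.
have [th0 [hx hy]] : exists th, X 0 / Num.sqrt (N 0) = cos th /\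
    Y 0 / Num.sqrt (N 0) = sin th.
  apply: polar_angle; rewrite !expr_div_n -mulrDl sqr_sqrtr ?ltW ?pos// divff//.
  by rewrite gt_eqF// pos.
pose Th t := th0 + A t.
have dTh (t : R) : is_derive t 1 Th (om t) by have ? := dA t; rewrite /Th; deriv_ring.
have dcos (t : R) : is_derive t 1 (fun t => cos (Th t)) (- sin (Th t) * om t).
  exact: is_derive_comp1 (is_derive_cos (Th t)) (dTh t).
have dsin (t : R) : is_derive t 1 (fun t => sin (Th t)) (cos (Th t) * om t).
  exact: is_derive_comp1 (is_derive_sin (Th t)) (dTh t).
have de (t : R) : is_derive t 1 (fun t => expR (- M t)) (- expR (- M t) * ka t).
  by have ? := dM t; deriv_ring.
have X'E t : X' t = ka t * X t - om t * Y t.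
  rewrite /ka /om /N; field; rewrite gt_eqF//; exact: pos.
have Y'E t : Y' t = ka t * Y t + om t * X t.
  rewrite /ka /om /N; field; rewrite gt_eqF//; exact: pos.
pose P t := (X t * cos (Th t) + Y t * sin (Th t)) * expR (- M t).
pose Q t := (Y t * cos (Th t) - X t * sin (Th t)) * expR (- M t).
have dP (t : R) : is_derive t 1 P 0.
  have ? := dX t; have ? := dY t; have ? := dcos t; have ? := dsin t; have ? := de t.
  by rewrite /P; apply: is_derive_eq; rewrite /GRing.scale/= X'E Y'E; ring.
have dQ (t : R) : is_derive t 1 Q 0.
  have ? := dX t; have ? := dY t; have ? := dcos t; have ? := dsin t; have ? := de t.
  by rewrite /Q; apply: is_derive_eq; rewrite /GRing.scale/= X'E Y'E; ring.
have Th0 : Th 0 = th0 by rewrite /Th A0 addr0.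
have X0E : X 0 = Num.sqrt (N 0) * cos th0 by rewrite -hx mulrC divfK// gt_eqF.
have Y0E : Y 0 = Num.sqrt (N 0) * sin th0 by rewrite -hy mulrC divfK// gt_eqF.
have P0 t : P t = Num.sqrt (N 0).
  rewrite (cst_of_derive dP (fun=> erefl) t 0) /P Th0 M0 oppr0 expR0 mulr1 X0E Y0E.
  have := cos2Dsin2 th0; rewrite !expr2 => cs.
  by rewrite -!mulrA -mulrDr cs mulr1.
have Q0 t : Q t = 0.
  by rewrite (cst_of_derive dQ (fun=> erefl) t 0) /Q Th0 M0 oppr0 expR0 mulr1 X0E Y0E; ring.
pose r t := Num.sqrt (N 0) * expR (M t).
have r0 t : 0 < r t by rewrite mulr_gt0 ?expR_gt0.
have Pr t : X t * cos (Th t) + Y t * sin (Th t) = r t.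
  by rewrite /r -(P0 t) /P -mulrA -expRD addNr expR0 mulr1.
have Qr t : Y t * cos (Th t) - X t * sin (Th t) = 0.
  have := Q0 t; rewrite /Q => /eqP; rewrite mulf_eq0 (gt_eqF (expR_gt0 _)) orbF.
  by move/eqP.
have XE t : X t = r t * cos (Th t).
  have cs := cos2Dsin2 (Th t).
  have -> : X t = X t * (cos (Th t) ^+ 2 + sin (Th t) ^+ 2) by rewrite cs mulr1.
  have -> : r t = X t * cos (Th t) + Y t * sin (Th t) by rewrite Pr.
  have := congr1 (fun z => z * sin (Th t)) (Qr t); rewrite mul0r => q.
  by apply/eqP; rewrite -subr_eq0 -[X in _ == X]oppr0 -q; apply/eqP; ring.
have YE t : Y t = r t * sin (Th t).
  have cs := cos2Dsin2 (Th t).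
  have -> : Y t = Y t * (cos (Th t) ^+ 2 + sin (Th t) ^+ 2) by rewrite cs mulr1.
  have -> : r t = X t * cos (Th t) + Y t * sin (Th t) by rewrite Pr.
  have := congr1 (fun z => z * cos (Th t)) (Qr t); rewrite mul0r => q.
  by apply/eqP; rewrite -subr_eq0 -q; apply/eqP; ring.
have sE t : Num.sqrt (X t ^+ 2 + Y t ^+ 2) = r t.
  have -> : X t ^+ 2 + Y t ^+ 2 = r t ^+ 2.
    by rewrite XE YE !exprMn -mulrDr cos2Dsin2 mulr1.
  by rewrite sqrtr_sqr gtr0_norm.
by exists Th; split=> [t|t|t]; [exact: dTh|rewrite sE XE|rewrite sE YE].
Qed.

Lemma linear_growth_onto (f f' : R -> R) (m : R) : 0 < m ->
  (forall t : R, is_derive t 1 f (f' t)) -> (forall t, m <= f' t) ->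
  {homo f : s t / s < t} /\ forall v, exists t, f t = v.
Proof.
move=> m0 df fm; split.
  by apply: (shomo_of_derive df) => t; exact: lt_le_trans (fm t).
move=> v.
have cf : continuous f by move=> t; exact: is_derive_continuous (df t).
have dg (t : R) : is_derive t 1 (fun t => f t - m * t) (f' t - m).
  by have ? := df t; deriv_ring.
have gh : {homo (fun t => f t - m * t) : s t / s <= t}.
  by apply: (homo_of_derive dg) => t; rewrite subr_ge0.
pose s := - (`|v - f 0| / m); pose t := `|v - f 0| / m.
have t0 : 0 <= t by rewrite divr_ge0// ltW.
have hs : f s <= v.
  have := gh s 0 (_ : s <= 0); rewrite oppr_le0 => /(_ t0) /=.
  rewrite mulr0 subr0 /s mulrN mulrCA divff ?gt_eqF// mulr1.
  by have := ler_norm (- (v - f 0)); rewrite normrN; lra.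
have ht : v <= f t.
  have := gh 0 t t0; rewrite /= mulr0 subr0 /t mulrCA divff ?gt_eqF// mulr1.
  by have := ler_norm (v - f 0); lra.
by apply: (@ivt_line _ f s t v cf); rewrite hs ht.
Qed.

End Angles.

(** * Rotation about the interior equilibrium *)

Section Rotation.
Variable R : realType.
Variable p : 'I_3 -> R.
Hypothesis p0 : forall i, 0 < p i.
Implicit Types (x y : 'rV[R]_3) (g : R -> 'rV[R]_3).

Definition weights (p : 'I_3 -> R) : 'I_3 -> R := fun i => p i / \sum_j p j.

(** The ratios [u i / p i] agree exactly at the centre; the two forms compare them
    with the third ratio. *)
Definition frame_x (p : 'I_3 -> R) := vec3 (p i1)^-1 0 (- (p i3)^-1).
Definition frame_y (p : 'I_3 -> R) := vec3 0 (p i2)^-1 (- (p i3)^-1).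

Let W0 : 0 < \sum_j p j.
Proof. by rewrite sum3 !addr_gt0. Qed.

Lemma weights_gt0 i : 0 < weights p i.
Proof. by rewrite divr_gt0. Qed.

Lemma simplex_weights : simplex (weights p).
Proof.
by split=> [i|]; [exact/ltW/weights_gt0|rewrite -mulr_suml divff// gt_eqF].
Qed.

Lemma frameXY u : lin (frame_x p) u = u i1 / p i1 - u i3 / p i3 /\
  lin (frame_y p) u = u i2 / p i2 - u i3 / p i3.
Proof. by rewrite /lin !sum3 /frame_x /frame_y !vec3E; split; ring. Qed.

Lemma rotation_frame : polar_frame (weights p) (frame_x p) (frame_y p).
Proof.
have pn i : p i != 0 by rewrite gt_eqF.
have Wn : \sum_j p j != 0 by rewrite gt_eqF.
have wE i : weights p i / p i = (\sum_j p j)^-1.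
  by rewrite /weights mulrAC divff// mul1r.
split; first exact: simplex_weights.
- by have [-> _] := frameXY (weights p); rewrite !wE subrr.
- by have [_ ->] := frameXY (weights p); rewrite !wE subrr.
move=> u u1; have [-> ->] := frameXY u => /subr0_eq ex /subr0_eq ey.
pose k := u i3 / p i3.
have uE i : u i = k * p i.
  have : u i / p i = k by move: i; exact: ord3_ind.
  by move=> <-; rewrite divfK.
have kE : k = (\sum_j p j)^-1.
  have : k * \sum_j p j = 1.
    by rewrite -u1 mulr_sumr; apply: eq_bigr => i _; rewrite uE.
  by move=> h; rewrite -[LHS](mulfK Wn) h mul1r.
by apply/funext => i; rewrite uE kE mulrC.
Qed.

Lemma simplex_sq x : S2p x -> simplex (sq x).
Proof. by move=> /S2pE[_ x1]; split=> // i; exact: sqr_ge0. Qed.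

Lemma gmean_sq_exp x : (forall i, 0 < x 0 i) ->
  gmean (weights p) (sq x) = expR (2 / (\sum_j p j) * \sum_i p i * ln (x 0 i)).
Proof.
move=> x0; rewrite /gmean prod3.
have f i : sq x i `^ weights p i = expR (2 / (\sum_j p j) * (p i * ln (x 0 i))).
  rewrite /powR gt_eqF ?exprn_gt0// lnXn//; congr expR.
  by rewrite /weights -mulr_natl; ring.
by rewrite !f -!expRD -!mulrDr [X in _ = expR (_ * X)]sum3.
Qed.

Lemma gmean_le_factor (w u : 'I_3 -> R) i : (forall i, 0 <= w i) -> simplex u ->
  gmean w u <= u i `^ w i.
Proof.
move=> w0 us.
have f j : 0 <= u j `^ w j <= 1.
  have /andP[u0 u1] := simplex_le1 j us.
  rewrite powR_ge0/=; have : u j `^ w j <= 1 `^ w j by rewrite ge0_ler_powR ?nnegrE.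
  by rewrite powR1.
have drop (a b c : R) : 0 <= a <= 1 -> 0 <= b <= 1 -> 0 <= c <= 1 -> a * b * c <= a.
  move=> /andP[a0 a1] /andP[b0 b1] /andP[c0 c1].
  by rewrite -mulrA ler_piMr// mulr_ile1.
rewrite /gmean prod3; move: i; apply: ord3_ind.
- exact: drop.
- by rewrite [_ * u i2 `^ _]mulrC; exact: drop.
- by rewrite mulrC mulrA; exact: drop.
Qed.

Lemma gmean_flow g : sphere_sol p g -> (forall t i, 0 < g t 0 i) ->
  forall t, gmean (weights p) (sq (g t)) = gmean (weights p) (sq (g 0)).
Proof.
by move=> sg g0 t; rewrite !gmean_sq_exp// (log_integral sg g0).
Qed.

(** The mean is constant along the orbit and each of its factors is at most 1, so every
    factor is at least this constant. *)
Lemma gmean_lower_bound g : sphere_sol p g -> (forall t i, 0 < g t 0 i) ->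
  exists2 e, 0 < e & forall t i, e <= sq (g t) i.
Proof.
move=> sg g0; pose c := gmean (weights p) (sq (g 0)).
have c0 : 0 < c by rewrite /c gmean_sq_exp// expR_gt0.
pose e i := c `^ (weights p i)^-1.
have e0 i : 0 < e i by rewrite powR_gt0.
have eP t i : e i <= sq (g t) i.
  have h : c <= sq (g t) i `^ weights p i.
    rewrite /c -(gmean_flow sg g0 t); apply: gmean_le_factor.
      by move=> j; exact/ltW/weights_gt0.
    exact: simplex_sq (sg.1 t).
  have wi := weights_gt0 i.
  have -> : sq (g t) i = (sq (g t) i `^ weights p i) `^ (weights p i)^-1.
    by rewrite -powRrM divff ?gt_eqF// powRr1// sqr_ge0.
  by rewrite ge0_ler_powR ?invr_ge0 ?(ltW wi)// nnegrE ?powR_ge0// ltW.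
exists (Num.min (e i1) (Num.min (e i2) (e i3))); first by rewrite !lt_min !e0.
move=> t i; apply: le_trans (eP t i).
by move: i; apply: ord3_ind; rewrite !ge_min lexx ?orbT.
Qed.

(** In the frame, [X Y' - Y X'] is a combination of the squares of [X], [Y] and
    [Y - X] whose coefficients are positive multiples of the coordinates, hence bounded
    below along the orbit.  So the angle grows at least linearly, while the depth is
    constant. *)
Lemma rotation g : sphere_sol p g -> (forall t i, 0 < g t 0 i) ->
  sq (g 0) <> weights p -> exists Th : R -> R,
  [/\ {homo Th : s t / s < t}, forall v, exists t, Th t = v &
   forall t, polar (weights p) (frame_x p) (frame_y p) (sq (g t)) =
     row3 (depth (weights p) (sq (g 0)) * cos (Th t))
          (depth (weights p) (sq (g 0)) * sin (Th t)) 0].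
Proof.
move=> sg g0 gw; have fr := rotation_frame.
have gc := gmean_flow sg g0.
have gwt t : sq (g t) <> weights p.
  move=> h; have := gmean_lt (fun i => ltW (weights_gt0 i)) simplex_weights.2
    (simplex_sq (sg.1 0)) gw.
  by rewrite -(gc t) h ltxx.
pose X t := lin (frame_x p) (sq (g t)); pose Y t := lin (frame_y p) (sq (g t)).
pose X' t := - (2 * p i2 * p i3 * sq (g t) i1 / p i1) * Y t
  - 2 * p i1 * p i2 * sq (g t) i3 / p i3 * (Y t - X t).
pose Y' t := 2 * p i1 * p i3 * sq (g t) i2 / p i2 * X t
  - 2 * p i1 * p i2 * sq (g t) i3 / p i3 * (Y t - X t).
have pn i : p i != 0 by rewrite gt_eqF.
have XE t : X t = sq (g t) i1 / p i1 - sq (g t) i3 / p i3 by have [] := frameXY (sq (g t)).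
have YE t : Y t = sq (g t) i2 / p i2 - sq (g t) i3 / p i3 by have [] := frameXY (sq (g t)).
have dX (t : R) : is_derive t 1 X (X' t).
  have ? := sphere_sol_sq sg t i1; have ? := sphere_sol_sq sg t i3.
  rewrite (_ : X = fun t => sq (g t) i1 / p i1 - sq (g t) i3 / p i3); last exact/funext.
  apply: is_derive_eq; rewrite /X' XE YE /GRing.scale/= /cross !vec3E.
  by field; rewrite !pn.
have dY (t : R) : is_derive t 1 Y (Y' t).
  have ? := sphere_sol_sq sg t i2; have ? := sphere_sol_sq sg t i3.
  rewrite (_ : Y = fun t => sq (g t) i2 / p i2 - sq (g t) i3 / p i3); last exact/funext.
  apply: is_derive_eq; rewrite /Y' XE YE /GRing.scale/= /cross !vec3E.
  by field; rewrite !pn.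
have cu i : continuous (fun t => sq (g t) i).
  by move=> t; exact: is_derive_continuous (sphere_sol_sq sg t i).
have cX : continuous X by move=> t; exact: is_derive_continuous (dX t).
have cY : continuous Y by move=> t; exact: is_derive_continuous (dY t).
have k (a : R) f : continuous f -> continuous (fun t : R => a * f t).
  by move=> cf t; apply: ctsM; [exact: cts_cst|exact: cf].
have cX' : continuous X'.
  move=> t; have h1 := ctsM (k (- (2 * p i2 * p i3 / p i1)) _ (cu i1) t) (cY t).
  have h2 := ctsM (k (2 * p i1 * p i2 / p i3) _ (cu i3) t) (ctsB (cY t) (cX t)).
  have := ctsB h1 h2.
  rewrite (_ : (fun y : R => _) = X')//; apply/funext => s; rewrite /X'; ring.
have cY' : continuous Y'.
  move=> t; have h1 := ctsM (k (2 * p i1 * p i3 / p i2) _ (cu i2) t) (cX t).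
  have h2 := ctsM (k (2 * p i1 * p i2 / p i3) _ (cu i3) t) (ctsB (cY t) (cX t)).
  have := ctsB h1 h2.
  rewrite (_ : (fun y : R => _) = Y')//; apply/funext => s; rewrite /Y'; ring.
have mE t : modulus (frame_x p) (frame_y p) (sq (g t)) = Num.sqrt (X t ^+ 2 + Y t ^+ 2) by [].
have mpos t : 0 < modulus (frame_x p) (frame_y p) (sq (g t)).
  by have := modulus_gt0 fr (simplex_sq (sg.1 t)) (@gwt t).
have pos t : 0 < X t ^+ 2 + Y t ^+ 2 by have := mpos t; rewrite mE sqrtr_gt0.
have [Th [dTh Xc Ys]] := polar_lift dX dY cX' cY' pos.
have [e e0 eP] := gmean_lower_bound sg g0.
pose m1 := 2 * p i2 * p i3 * e / p i1; pose m2 := 2 * p i1 * p i3 * e / p i2.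
have m10 : 0 < m1 by rewrite divr_gt0// !mulr_gt0.
have m20 : 0 < m2 by rewrite divr_gt0// !mulr_gt0.
pose m := Num.min m1 m2.
have m0 : 0 < m by rewrite lt_min m10.
have mle1 : m <= m1 by rewrite ge_min lexx.
have mle2 : m <= m2 by rewrite ge_min lexx orbT.
have speed t : m <= (X t * Y' t - Y t * X' t) / (X t ^+ 2 + Y t ^+ 2).
  rewrite ler_pdivlMr//.
  have -> : X t * Y' t - Y t * X' t =
      (2 * p i1 * p i3 / p i2 * sq (g t) i2) * X t ^+ 2 +
      (2 * p i2 * p i3 / p i1 * sq (g t) i1) * Y t ^+ 2 +
      (2 * p i1 * p i2 / p i3 * sq (g t) i3) * (Y t - X t) ^+ 2.
    by rewrite /X' /Y'; ring.
  have h3 : 0 <= (2 * p i1 * p i2 / p i3 * sq (g t) i3) * (Y t - X t) ^+ 2.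
    by rewrite mulr_ge0 ?sqr_ge0// mulr_ge0 ?sqr_ge0// divr_ge0 ?(ltW (p0 _))//
      !mulr_ge0 ?(ltW (p0 _)).
  have h2 : m * X t ^+ 2 <= (2 * p i1 * p i3 / p i2 * sq (g t) i2) * X t ^+ 2.
    rewrite ler_wpM2r ?sqr_ge0// (le_trans mle2)// /m2 [leLHS]mulrAC.
    by rewrite ler_wpM2l ?eP// divr_ge0 ?(ltW (p0 _))// !mulr_ge0 ?(ltW (p0 _)).
  have h1 : m * Y t ^+ 2 <= (2 * p i2 * p i3 / p i1 * sq (g t) i1) * Y t ^+ 2.
    rewrite ler_wpM2r ?sqr_ge0// (le_trans mle1)// /m1 [leLHS]mulrAC.
    by rewrite ler_wpM2l ?eP// divr_ge0 ?(ltW (p0 _))// !mulr_ge0 ?(ltW (p0 _)).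
  by lra.
have [Thh Ths] := linear_growth_onto m0 dTh speed.
exists Th; split=> // t.
have dE : depth (weights p) (sq (g t)) = depth (weights p) (sq (g 0)).
  by rewrite /depth gc.
have Mn : modulus (frame_x p) (frame_y p) (sq (g t)) != 0 by rewrite gt_eqF.
rewrite /polar dE -/(X t) -/(Y t); congr row3; congr (_ * _).
  by rewrite Xc -mE mulrAC divff// mul1r.
by rewrite Ys -mE mulrAC divff// mul1r.
Qed.

End Rotation.

Section LevelCurves.
Variable R : realType.
Variable p : 'I_3 -> R.
Hypothesis p0 : forall i, 0 < p i.
Implicit Types (x y : 'rV[R]_3) (g : R -> 'rV[R]_3).

Lemma simplex_point (u : 'I_3 -> R) : simplex u -> exists2 x, S2p x & sq x = u.
Proof.
move=> [u0 u1]; have sqE : sq (\row_i Num.sqrt (u i)) = u.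
  by apply/funext => i; rewrite /sq mxE sqr_sqrtr.
by exists (\row_i Num.sqrt (u i)) => //; apply/S2pE; split=> [i|]; rewrite ?mxE ?sqrtr_ge0 ?sqE.
Qed.

Lemma gmean_sq_gt0 x : S2p x -> 0 < gmean (weights p) (sq x) -> forall i, 0 < x 0 i.
Proof.
move=> /S2pE[x0 _] h i; rewrite lt_def x0 andbT; apply/eqP => xi; move: h.
by rewrite (@gmean_eq0 _ _ _ i) ?ltxx ?weights_gt0// /sq xi expr0n.
Qed.

(** The angle takes all values, so the orbit meets every direction of its level; after
    a full turn it is back at its initial point and repeats itself. *)
Lemma level_curve g : sphere_sol p g -> (forall t i, 0 < g t 0 i) ->
  sq (g 0) <> weights p ->
  range g = [set x | S2p x /\ gmean (weights p) (sq x) = gmean (weights p) (sq (g 0))] /\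
  exists2 T, 0 < T & forall t, g (t + T) = g t.
Proof.
move=> sg g0 gw; have fr := rotation_frame p0; have gc := gmean_flow sg g0.
have [Th [Th1 Th2 ThP]] := rotation p0 sg g0 gw.
have k0 : depth (weights p) (sq (g 0)) > 0 by have := depth_gt0 fr (simplex_sq (sg.1 0)) gw.
have same x y : S2p x -> S2p y -> polar (weights p) (frame_x p) (frame_y p) (sq x) =
    polar (weights p) (frame_x p) (frame_y p) (sq y) -> x = y.
  move=> xS yS e; apply: sq_inj => //.
  exact: (polar_inj fr (simplex_sq xS) (simplex_sq yS) e).
split.
  apply/seteqP; split=> [_ [t _ <-]|x /= [xS xg]]; first by split; [exact: sg.1|exact: gc].
  have xw : sq x <> weights p.
    move=> h; have := gmean_lt (fun i => ltW (weights_gt0 p0 i)) (simplex_weights p0).2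
      (simplex_sq (sg.1 0)) gw.
    by rewrite -xg h ltxx.
  have dE : depth (weights p) (sq x) = depth (weights p) (sq (g 0)) by rewrite /depth xg.
  have := polar_sq fr (simplex_sq xS) xw; set P := polar _ _ _ _ => PE.
  have dn : depth (weights p) (sq (g 0)) != 0 by rewrite gt_eqF.
  have [th [ca sa]] : exists th, P 0 i1 / depth (weights p) (sq (g 0)) = cos th /\
      P 0 i2 / depth (weights p) (sq (g 0)) = sin th.
    apply: polar_angle; rewrite !expr_div_n -mulrDl PE dE divff//.
    by rewrite expf_neq0.
  have [t tth] := Th2 th; exists t => //; apply: same => //; first exact: sg.1.
  rewrite ThP tth -ca -sa; apply: rowP3; rewrite row3E.
  - by rewrite mulrC divfK.
  - by rewrite mulrC divfK.
  - by rewrite /P row3E.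
(* time of the first full turn *)
have [T TE] := Th2 (Th 0 + 2 * pi).
have T0 : 0 < T.
  rewrite ltNge; apply/negP => T0; have : Th T <= Th 0.
    by move: T0; rewrite le_eqVlt => /predU1P[->//|/Th1/ltW].
  by rewrite TE; have := pi_gt0 R; lra.
have gT : (fun t => g (t + T)) = g; last first.
  by exists T => // t; exact: (congr1 (fun f : R -> 'rV[R]_3 => f t) gT).
apply: (sphere_sol_unique (sphere_sol_shift T sg) sg) => /=.
rewrite add0r; apply: same; [exact: sg.1|exact: sg.1|].
by rewrite !ThP TE mulr_natl cosD2pi sinD2pi.
Qed.

End LevelCurves.

(** * The portrait with a centre *)

Section PortraitI.
Variable R : realType.
Variables (alpha : R) (d : 'I_3 -> R).
Hypothesis alpha0 : 0 < alpha.
Let p := exponents alpha d.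
Hypothesis p0 : forall i, 0 < p i.
Let w := weights p.
Implicit Types (x y : 'rV[R]_3) (g : R -> 'rV[R]_3).

Let sE : s_ alpha d = \sum_i p i.
Proof. by rewrite sum3 /p !exponentsE /s_; ring. Qed.

Let W0 : 0 < \sum_i p i.
Proof. by rewrite sum3; have := p0 i1; have := p0 i2; have := p0 i3; lra. Qed.

Let ws : simplex w. Proof. exact: simplex_weights. Qed.
Let wpos i : 0 < w i. Proof. exact: weights_gt0. Qed.
Let w0 i : 0 <= w i. Proof. exact/ltW/wpos. Qed.

Let QE i : Qstar alpha d 0 i = Num.sqrt (w i).
Proof. by rewrite mxE sE. Qed.

Let sqQ : sq (Qstar alpha d) = w.
Proof. by apply/funext => i; rewrite /sq QE sqr_sqrtr. Qed.

Let Qpos i : 0 < Qstar alpha d 0 i.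
Proof. by rewrite QE sqrtr_gt0. Qed.

Let QS : S2p (Qstar alpha d).
Proof. by apply/S2pE; split=> [i|]; [exact/ltW/Qpos|rewrite sqQ; case: ws]. Qed.

Let crossQ i : cross p (sq (Qstar alpha d)) i = 0.
Proof. by rewrite sqQ /w /weights; move: i; apply: ord3_ind; rewrite /cross !vec3E; ring. Qed.

Let expE i : - (2 * (alpha + d (rev_ord i))) / s_ alpha d = - (2 * w i).
Proof. by rewrite sE /w /weights /p /exponents; ring. Qed.

Let H1E x : H1 alpha d x = enorm x ^+ 2 * \prod_i x 0 i `^ (- (2 * w i)).
Proof. by rewrite /H1; congr (_ * _); apply: eq_bigr => i _; rewrite expE. Qed.

Let H1_sphere x : S2p x -> (forall i, 0 < x 0 i) -> H1 alpha d x = (gmean w (sq x))^-1.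
Proof.
move=> xS x0; rewrite H1E (S2p_enorm xS) expr1n mul1r /gmean -prodfV.
apply: eq_bigr => i _; rewrite powRN; congr (_^-1).
by rewrite powRrM /sq -powR_mulrn ?ltW.
Qed.

(** The exponents have sum -2, so [H1] is homogeneous of degree 0. *)
Let H1_scale x (l : R) : 0 < l -> (forall i, 0 < x 0 i) -> H1 alpha d (l *: x) = H1 alpha d x.
Proof.
move=> l0 x0; rewrite !H1E.
have -> : enorm (l *: x) ^+ 2 = l ^+ 2 * enorm x ^+ 2.
  by rewrite !enormE mulr_sumr; apply: eq_bigr => i _; rewrite /sq mxE exprMn.
have f i : (l *: x) 0 i `^ (- (2 * w i)) = l `^ (- (2 * w i)) * x 0 i `^ (- (2 * w i)).
  by rewrite mxE powRM// ltW.
under eq_bigr do rewrite f.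
rewrite big_split/= [X in _ * (X * _)]prod3 -!powRD ?(gt_eqF l0) ?implybT//.
have -> : - (2 * w i1) + - (2 * w i2) + - (2 * w i3) = - 2%:R.
  by have [_] := ws; rewrite sum3 => h; rewrite -[RHS]mulr1 -h; ring.
by rewrite powRN powR_mulrn ?ltW//; field; exact: lt0r_neq0.
Qed.

Let hstarE' : hstar alpha d = (gmean w w)^-1.
Proof. by rewrite /hstar H1_sphere ?sqQ. Qed.

Let GhE h x : hstar alpha d < h -> Gamma_h alpha d h x <-> S2p x /\ gmean w (sq x) = h^-1.
Proof.
move=> hh; have h0 : 0 < h by apply: lt_trans hh; rewrite hstarE' invr_gt0 gmean_center_gt0.
split=> [[xS [x0]] /= xh|[xS xh]].
  by split=> //; rewrite -xh H1_sphere// invrK.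
have x0 : forall i, 0 < x 0 i by apply: (gmean_sq_gt0 p0) => //; rewrite xh invr_gt0.
by split=> //; split=> //=; rewrite H1_sphere// xh invrK.
Qed.

Let lt_hstar h : hstar alpha d < h -> 0 < h^-1 < gmean w w.
Proof.
rewrite hstarE' => hh; have g0 : 0 < gmean w w by exact: gmean_center_gt0.
have h0 : 0 < h by apply: lt_trans hh; rewrite invr_gt0.
by rewrite invr_gt0 h0 -[ltRHS]invrK ltf_pV2// posrE invr_gt0.
Qed.

Let level_flow g h : hstar alpha d < h -> sphere_sol p g -> Gamma_h alpha d h (g 0) ->
  range g = Gamma_h alpha d h /\
  exists2 T, 0 < T & forall t, g (t + T) = g t.
Proof.
move=> hh sg /[dup] g0h /(GhE _ hh)[_ gE]; have [_ [g0 _]] := g0h.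
have gp t i : 0 < g t 0 i by exact: (sphere_sol_gt0 sg (g0 i)).
have gw : sq (g 0) <> weights p.
  by move=> e; have /andP[_] := lt_hstar hh; rewrite -gE e ltxx.
have [rE TP] := level_curve p0 sg gp gw; split=> //.
rewrite rE; apply/seteqP; split=> x; rewrite -/w gE; first by move/(GhE _ hh).
by move/(GhE _ hh).
Qed.

Let Gh_neq0 h : hstar alpha d < h -> exists x, Gamma_h alpha d h x.
Proof.
move=> hh; have /andP[h0 hw] := lt_hstar hh.
(* any boundary point would do: the segment from the centre to it meets every level *)
pose b := sq (e_ i1 : 'rV[R]_3).
have bs : simplex b by apply: simplex_sq; exact: S2p_e.
have b0 : gmean w b = 0.
  by apply: (@gmean_eq0 _ _ _ i2) => //; rewrite /b /sq e_E expr0n.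
have [|s s01 sE'] := gmean_segment_onto w0 ws.2 bs b0 (k := h^-1); first by rewrite !ltW.
have [x xS xE] := simplex_point (simplex_segment w0 ws.2 bs s01).
by exists x; apply/(GhE _ hh); rewrite xE.
Qed.

Let cross_eq0 u : \sum_i u i = 1 -> (forall i, cross p u i = 0) -> u = w.
Proof.
move=> u1 c0; apply/funext => i.
have prop (a b : 'I_3) : p a * u b = p b * u a.
  have e1 := c0 i1; have e2 := c0 i2; have e3 := c0 i3.
  move: e1 e2 e3; rewrite /cross !vec3E => e1 e2 e3.
  by move: b; apply: ord3_ind; move: a; apply: ord3_ind; lra.
apply: (mulIf (x := \sum_j p j)); first by rewrite gt_eqF.
rewrite /w /weights divfK ?gt_eqF// mulr_sumr -[RHS]mulr1 -u1 mulr_sumr.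
by apply: eq_bigr => j _; rewrite prop mulrC.
Qed.

Let stationary_interior x : S2p x -> (forall i, 0 < x 0 i) ->
  (forall i, x 0 i * cross p (sq x) i = 0) -> x = Qstar alpha d.
Proof.
move=> xS x0 c0; apply: sq_inj => //; rewrite sqQ; apply: cross_eq0.
  by have /S2pE[] := xS.
by move=> i; have /eqP := c0 i; rewrite mulf_eq0 gt_eqF//= => /eqP.
Qed.

Let interior_equilibrium x : IntR3p x -> equilibrium alpha d x -> x = Qstar alpha d.
Proof.
move=> x0 /(congr1 (fun y : 'rV[R]_3 => fun i => y 0 i)) eq.
have c0 i : alpha * (1 - \sum_j sq x j) + cross p (sq x) i = 0.
  have := congr1 (fun f => f i) eq; rewrite field_DE mxE => /eqP.
  by rewrite mulf_eq0 gt_eqF//= => /eqP.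
have r1 : \sum_j sq x j = 1.
  have := cross_kernel p (sq x).
  have -> : \sum_i p i * cross p (sq x) i = - (alpha * (1 - \sum_j sq x j)) * \sum_i p i.
    rewrite mulr_sumr; apply: eq_bigr => i _; rewrite mulrC; congr (_ * _).
    by have := c0 i; lra.
  move=> /eqP; rewrite mulf_eq0 (gt_eqF W0) orbF oppr_eq0 mulf_eq0 gt_eqF//= => /eqP.
  by lra.
apply: stationary_interior => //; first by apply/S2pE; split=> // i; exact/ltW/x0.
by move=> i; have := c0 i; rewrite r1 subrr mulr0 add0r => ->; rewrite mulr0.
Qed.

Lemma portrait_i :
    [/\ global_attractor alpha d (R3p `\ 0) S2p,
        S2p = \bigcup_(h in [set h | hstar alpha d < h]) Gamma_h alpha d h
              `|` [set Qstar alpha d] `|` bdS2p,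
        forall h, hstar alpha d < h ->
          periodic_orbit alpha d (Gamma_h alpha d h),
        IntR3p `&` equilibrium alpha d = [set Qstar alpha d]
      & heteroclinic_polycycle alpha d bdS2p] /\
    [/\ forall h x, hstar alpha d < h -> Lambda1 alpha d h x ->
          omega_limit alpha d x = Gamma_h alpha d h,
        forall x, ray (Qstar alpha d) x ->
          omega_limit alpha d x = [set Qstar alpha d]
      & forall x, (bdR3p `\ 0) x -> exists i, omega_limit alpha d x = [set e_ i]].
Proof.
have Qeq i : Qstar alpha d 0 i * cross p (sq (Qstar alpha d)) i = 0.
  by rewrite crossQ mulr0.
split; split.
- exact: sphere_attractor.
- apply/seteqP; split=> [x xS|x [[[h hh [xS _]]|->]|[]]//].
  have [xb|xb] := pselect (bdS2p x); [by right|left].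
  have x0 i : 0 < x 0 i.
    have /S2pE[xg _] := xS; rewrite lt_def xg andbT; apply/eqP => xi.
    by apply: xb; apply/bdS2pE; split=> //; exists i.
  have [xQ|xQ] := pselect (x = Qstar alpha d); [by right|left].
  have glt : gmean w (sq x) < gmean w w.
    apply: gmean_lt => //; [exact: ws.2|exact: simplex_sq|].
    by move=> e; apply: xQ; apply: sq_inj => //; rewrite sqQ.
  have g0 : 0 < gmean w (sq x) by apply: gmean_gt0 => // i _; rewrite exprn_gt0.
  have hh : hstar alpha d < (gmean w (sq x))^-1.
    by rewrite hstarE' ltf_pV2// posrE gmean_center_gt0.
  by exists (gmean w (sq x))^-1 => //; apply/(GhE _ hh); rewrite invrK.
- move=> h hh; have [x xh] := Gh_neq0 hh.
  have [g [sg gx _]] := sphere_sol_exists p xh.1.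
  have [rE [T T0 gT]] : range g = Gamma_h alpha d h /\ exists2 T, 0 < T & forall t, g (t + T) = g t.
    by apply: level_flow => //; rewrite gx.
  have /sphere_solP[cg _] := sg.
  exists g, T; split=> //; rewrite gx => /(equilibriumE _ _ xh.1) xeq.
  have xQ := stationary_interior xh.1 xh.2.1 xeq.
  have /(GhE _ hh)[_] := xh; rewrite xQ sqQ => e.
  by have /andP[_] := lt_hstar hh; rewrite e ltxx.
- apply/seteqP; split=> [x [x0 xe]|_ ->]; first exact: interior_equilibrium.
  by split; [exact: Qpos|apply/equilibriumE].
- exact: boundary_polycycle.
- move=> h x hh [x0 /= xh].
  have xn : x != 0 by apply/eqP => xz; have := x0 i1; rewrite xz mxE ltxx.
  have e0 := enorm_gt0 xn.
  pose th := (enorm x)^-1 *: x.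
  have thS : S2p th by apply: enorm_normalize => // i; exact: ltW.
  have th0 i : 0 < th 0 i by rewrite mxE mulr_gt0 ?invr_gt0.
  have thG : Gamma_h alpha d h th.
    by split=> //; split=> //=; rewrite H1_scale ?invr_gt0.
  have [g [sg gx _]] := sphere_sol_exists p thS.
  have [rE [T T0 gT]] : range g = Gamma_h alpha d h /\ exists2 T, 0 < T & forall t, g (t + T) = g t.
    by apply: level_flow => //; rewrite gx.
  rewrite (omega_limitE alpha0 xn sg gx) (Omega_periodic _ T0 gT)//.
  exact: sphere_sol_continuous sg.
- move=> _ [l l0 <-].
  have xn : l *: Qstar alpha d != 0.
    by rewrite scaler_eq0 negb_or gt_eqF//=; exact: S2p_neq0.
  have sg := sphere_sol_cst QS Qeq.
  rewrite (omega_limitE alpha0 xn sg).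
    by apply: Omega_cvg; exact: cvg_cst.
  have -> : enorm (l *: Qstar alpha d) = l.
    rewrite /enorm; under eq_bigr do rewrite mxE exprMn.
    have /S2pE[_ Q1] := QS; rewrite -mulr_sumr.
    by have -> : \sum_i Qstar alpha d 0 i ^+ 2 = 1; [exact: Q1|rewrite mulr1 sqrtr_sqr gtr0_norm].
  by rewrite scalerA mulVf ?scale1r// gt_eqF.
- move=> x xb; apply: boundary_omega_vertex => // k; rewrite gt_eqF//.
Qed.

End PortraitI.

(** * Conjugacies between flows on the sphere *)

Section Conjugacy.
Variable R : realType.
Implicit Types (p q r : 'I_3 -> R) (b c : bool) (x y : 'rV[R]_3).
Implicit Types (g eta : R -> 'rV[R]_3) (tau : R -> R) (h k : 'rV[R]_3 -> 'rV[R]_3).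

(** Increasing or decreasing bijections of the line, according to [b]. *)
Definition time_change b tau :=
  (forall s t, s < t -> if b then tau s < tau t else tau t < tau s) /\
  range tau = setT.

Definition sphere_homeo h k :=
  [/\ {within S2p, continuous h}, {within S2p, continuous k},
      set_fun S2p S2p h, set_fun S2p S2p k &
      {in S2p, cancel h k} /\ {in S2p, cancel k h}].

(** As in the definition of topological equivalence, with [b] telling whether the
    direction of time is kept. *)
Definition carries b p q h := forall g, sphere_sol p g ->
  exists eta tau, [/\ sphere_sol q eta, time_change b tau &
    forall t, h (g t) = eta (tau t)].

Definition conjugate b p q :=
  exists2 hk, sphere_homeo hk.1 hk.2 & carries b p q hk.1.

Lemma sphere_homeo_sym h k : sphere_homeo h k -> sphere_homeo k h.
Proof. by move=> [? ? ? ? []]; split. Qed.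

(** An orbit onto which an orbit of the sphere is mapped lies in the sphere, since the
    change of time is onto. *)
Lemma topologically_equivalentP alpha d alpha' d' :
  topologically_equivalent alpha d alpha' d' <->
  exists b, conjugate b (exponents alpha d) (exponents alpha' d').
Proof.
split=> [[h [k [ch ck hS kS [hk kh orb]]]]|[b [[h k] /= [ch ck hS kS [hk kh]] cr]]].
  have H b : (forall gamma, complete_solution alpha d gamma -> range gamma `<=` S2p ->
      exists eta tau, [/\ complete_solution alpha' d' eta,
        forall s t, s < t -> if b then tau s < tau t else tau t < tau s,
        range tau = setT & forall t, h (gamma t) = eta (tau t)]) ->
      conjugate b (exponents alpha d) (exponents alpha' d').
    move=> cr; exists (h, k) => // g sg; have /sphere_solP[cg rg] := sg.
    have [eta [tau [ce mt rt e]]] := cr g cg rg.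
    exists eta, tau; split=> //; apply/sphere_solP; split=> // _ [s _ <-].
    have [t _ <-] : range tau s by rewrite rt.
    by rewrite -e; apply: hS; exact: sg.1.
  case: orb => cr; [exists true|exists false]; apply: H => g cg rg;
    by have [eta [tau [ce mt rt e]]] := cr g cg rg; exists eta, tau; split=> // s t st; apply: mt.
exists h, k; split=> //; split=> //.
have H g : complete_solution alpha d g -> range g `<=` S2p -> exists eta tau,
    [/\ complete_solution alpha' d' eta, 
        forall s t, s < t -> if b then tau s < tau t else tau t < tau s,
        range tau = setT & forall t, h (g t) = eta (tau t)].
  move=> cg rg; have /cr[eta [tau [/sphere_solP[ce _] [mt rt] e]]] : sphere_sol (exponents alpha d) g.
    exact/sphere_solP.
  by exists eta, tau.
by case: b H {cr} => H; [left|right] => g cg rg;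
  have [eta [tau [ce mt rt e]]] := H g cg rg; exists eta, tau; split=> // s t; exact: mt.
Qed.

Lemma time_changeK b tau : time_change b tau ->
  exists2 sig, time_change b sig & cancel tau sig /\ cancel sig tau.
Proof.
move=> [mt rt].
have inj : injective tau.
  move=> s t e; apply: contrapT => /eqP; rewrite neq_lt => /orP[] /mt;
  by case: b {mt rt} => /=; rewrite e ltxx.
have [sig sigK] : exists sig, cancel sig tau.
  have /choice[sig sigK] : forall v, exists t, tau t = v.
    by move=> v; have [t _ <-] : range tau v by [rewrite rt]; exists t.
  by exists sig.
have tauK : cancel tau sig by move=> t; apply: inj; rewrite sigK.
exists sig => //; split; last by apply/seteqP; split=> // t _; exists (tau t).
move=> s t st.
have nle : if b then ~ sig t <= sig s else ~ sig s <= sig t.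
  have H u v : u <= v -> if b then tau u <= tau v else tau v <= tau u.
    by rewrite le_eqVlt => /predU1P[->|/mt]; case: b {mt rt} => // /ltW.
  by move: H; case: b {mt rt} => H /H; rewrite !sigK leNgt st.
by move: nle; case: b {mt rt} => /negP; rewrite -ltNge.
Qed.

(** Through the preimage of [eta 0] there is an orbit of [p], whose image must be
    [eta] up to a shift of time; the inverse change of time serves for [k]. *)
Lemma carries_inv b p q h k : sphere_homeo h k -> carries b p q h -> carries b q p k.
Proof.
move=> [ch ck hS kS [hk kh]] cr eta se.
have xS : S2p (k (eta 0)) by apply: kS; exact: se.1.
have [g [sg gx _]] := sphere_sol_exists p xS.
have [eta1 [tau [se1 tt e]]] := cr g sg.
have [sig [ms rs] [tauK sigK]] := time_changeK tt.
have eE : eta = fun t => eta1 (t + tau 0).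
  apply: (sphere_sol_unique se (sphere_sol_shift (tau 0) se1)) => /=.
  by rewrite add0r -e gx kh// inE; exact: se.1.
exists g, (fun s => sig (s + tau 0)); split=> //.
  split; first by move=> s t st; apply: ms; rewrite ltrD2r.
  by apply/seteqP; split=> // t _; exists (tau t - tau 0); rewrite ?subrK.
move=> s; rewrite eE -[X in eta1 X]sigK -e hk// inE; exact: sg.1.
Qed.

Lemma sphere_homeo_comp h k h' k' : sphere_homeo h k -> sphere_homeo h' k' ->
  sphere_homeo (h' \o h) (k \o k').
Proof.
move=> [ch ck hS kS [hk kh]] [ch' ck' hS' kS' [hk' kh']].
have comp (u v : 'rV[R]_3 -> 'rV[R]_3) : {within S2p, continuous u} -> {within S2p, continuous v} ->
    set_fun S2p S2p u -> {within S2p, continuous (v \o u : 'rV[R]_3 -> 'rV[R]_3)}.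
  move=> /subspace_continuousP cu /subspace_continuousP cv uS.
  apply/subspace_continuousP => x xS.
  move=> A /(cv _ (uS _ xS)) nA; have := cu x xS _ nA.
  rewrite /= /within /= !nbhs_simpl /=.
  by apply: filterS => y yP yS; apply: yP => //; exact: uS.
split.
- exact: comp.
- exact: comp.
- by move=> x xS; apply: hS'; exact: hS.
- by move=> x xS; apply: kS; exact: kS'.
split=> x; rewrite inE => xS /=.
- by rewrite hk' ?inE ?hk ?inE//; exact: hS.
- by rewrite kh ?inE ?kh' ?inE//; exact: kS'.
Qed.

Lemma conjugate_sym b p q : conjugate b p q -> conjugate b q p.
Proof.
move=> [[h k] /= hh cr]; exists (k, h); first exact: sphere_homeo_sym.
exact: carries_inv hh cr.
Qed.

Lemma conjugate_trans b c p q r : conjugate b p q -> conjugate c q r ->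
  conjugate (b == c) p r.
Proof.
move=> [[h k] /= hh cr] [[h' k'] /= hh' cr']; exists (h' \o h, k \o k').
  exact: sphere_homeo_comp.
move=> g /cr[eta [tau [/cr'[eta' [tau' [se [m' r'] e']]] [m r_] e]]].
exists eta', (tau' \o tau); split=> //; last by move=> t; rewrite /= e e'.
split=> [s t /m|].
  by case: b c m' {m cr cr'} => [] [] m' /m'.
apply/seteqP; split=> // v _.
have [t' _ <-] : range tau' v by [rewrite r'].
by have [t _ <-] : range tau t' by [rewrite r_]; exists t.
Qed.

Lemma time_change_scale (a : R) : a != 0 -> time_change (0 < a) (fun t => a * t).
Proof.
move=> a0; split=> [s t st|].
  case: ltrP => [a0'|]; first by rewrite ltr_pM2l.
  by rewrite le_eqVlt (negbTE a0)/= => a0'; rewrite ltr_nM2l.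
by apply/seteqP; split=> // v _; exists (v / a) => //; rewrite mulrC divfK.
Qed.

(** The scale [a] is the ratio of the speeds; a negative one reverses time. *)
Lemma conjugate_permute p q (s s' : 'I_3 -> 'I_3) (a : R) : cancel s s' -> cancel s' s ->
  a != 0 -> (forall u i, cross q (fun j => u (s j)) i = a * cross p u (s i)) ->
  conjugate (0 < a) p q.
Proof.
move=> sK sK' a0 cs.
pose P (s : 'I_3 -> 'I_3) x : 'rV[R]_3 := \row_i x 0 (s i).
have cP t : {within S2p, continuous P t}.
  apply: continuous_subspaceT => x; apply/continuous_rowP => i.
  by rewrite (_ : (fun y => _) = fun y : 'rV[R]_3 => y 0 (t i));
    [exact: coord_continuous3|apply/funext => y; rewrite mxE].
have PS t t' : cancel t t' -> cancel t' t -> set_fun S2p S2p (P t).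
  move=> tK tK' x /S2pE[x0 x1]; apply/S2pE; split=> [i|]; first by rewrite mxE.
  rewrite -x1 [RHS](reindex t); last by exists t' => j _.
  by apply: eq_bigr => i _; rewrite /sq mxE.
have PK t t' : cancel t t' -> cancel (P t') (P t).
  by move=> tK x; apply/rowP => i; rewrite !mxE tK.
exists (P s, P s') => /=.
  by split; [exact: cP|exact: cP|exact: PS sK sK'|exact: PS sK' sK|split=> x _; exact: PK].
move=> g sg; exists (fun t => P s (g (a * t))), (fun t => a^-1 * t); split.
- split=> [t|t i]; first by apply: (PS _ _ sK sK'); exact: sg.1.
  have dl : is_derive t 1 (fun t : R => a * t) a.
    by apply: is_derive_eq; rewrite /GRing.scale/= mulr1.
  have := is_derive_comp1 (sg.2 (a * t) (s i)) dl.
  rewrite (_ : (fun t => P s (g (a * t)) 0 i) = fun t => g (a * t) 0 (s i)).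
    move=> h; apply: is_derive_eq; have := cs (sq (g (a * t))) i.
    have -> : (fun j => sq (g (a * t)) (s j)) = sq (P s (g (a * t))).
      by apply/funext => j; rewrite /sq mxE.
    by move=> ->; rewrite mxE; ring.
  by apply/funext => v; rewrite mxE.
- have -> : (0 < a) = (0 < a^-1) by rewrite invr_gt0.
  by apply: time_change_scale; rewrite invr_eq0.
by move=> t; rewrite mulrA divff// mul1r.
Qed.

Lemma conjugate_scale p (a : R) : a != 0 -> conjugate (0 < a) p (fun i => a * p i).
Proof.
move=> a0; apply: (@conjugate_permute _ _ id id a) => // u.
by apply: ord3_ind; rewrite /cross !vec3E; ring.
Qed.

(** If [V] is a neighbourhood of [h x], the set of points of the sphere outside [V]
    has a compact image under [N'], which misses [N x]. *)
Let model_homeo_continuous (N N' : 'rV[R]_3 -> 'rV[R]_3) h :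
  (forall x, S2p x -> {for x, continuous N}) -> (forall x, S2p x -> {for x, continuous N'}) ->
  (forall x y, S2p x -> S2p y -> N' x = N' y -> x = y) ->
  (forall x, S2p x -> S2p (h x) /\ N' (h x) = N x) -> {within S2p, continuous h}.
Proof.
move=> cN cN' inj hP; apply/subspace_continuousP => x xS U /=.
rewrite nbhsE => -[V [oV Vx] VU].
pose K := S2p `&` ~` V.
have cK : compact K.
  apply: (@subclosed_compact _ _ (@S2p R)); last by move=> ? [].
    by apply: closedI; [exact: S2p_closed|exact: open_closedC].
  exact: S2p_compact.
have clK : closed (N' @` K).
  apply: compact_closed; first exact: norm_hausdorff.
  apply: continuous_compact cK; apply/subspace_continuousP => y [yS _].
  by apply: cvg_within_filter; exact: cN'.
have NxK : ~ (N' @` K) (N x).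
  move=> [y [yS yV] yx]; apply: yV; have [hS hE] := hP _ xS.
  by rewrite (inj _ _ yS hS)// yx hE.
have := cN x xS (~` (N' @` K)); rewrite /= nbhs_simpl/= => /(_ _).
have o : nbhs (N x) (~` (N' @` K)) by apply: open_nbhs_nbhs; split=> //; exact: closed_openC.
move=> /(_ o); rewrite /within /= !nbhs_simpl /=.
apply: filterS => z zK zS; apply: VU; apply: contrapT => hV.
by have [hS hE] := hP _ zS; apply: zK; exists (h z).
Qed.

(** The homeomorphism is [N'] inverted after [N]: a continuous injective map on a
    compact space has a continuous inverse, and orbits are compared in the common
    image. *)
Lemma conjugate_model b p q (N N' : 'rV[R]_3 -> 'rV[R]_3) :
  (forall x, S2p x -> {for x, continuous N}) -> (forall x, S2p x -> {for x, continuous N'}) ->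
  (forall x y, S2p x -> S2p y -> N x = N y -> x = y) ->
  (forall x y, S2p x -> S2p y -> N' x = N' y -> x = y) ->
  (forall x, S2p x -> exists2 y, S2p y & N' y = N x) ->
  (forall y, S2p y -> exists2 x, S2p x & N x = N' y) ->
  (forall g, sphere_sol p g -> exists eta tau, [/\ sphere_sol q eta, time_change b tau &
     forall t, N (g t) = N' (eta (tau t))]) ->
  conjugate b p q.
Proof.
move=> cN cN' injN injN' NN' N'N orb.
have pick (M M' : 'rV[R]_3 -> 'rV[R]_3) : (forall x, S2p x -> exists2 y, S2p y & M' y = M x) ->
    exists h, forall x, S2p x -> S2p (h x) /\ M' (h x) = M x.
  move=> e; have /choice[h hP] : forall x, exists y, S2p x -> S2p y /\ M' y = M x.
    move=> x; have [/e[y yS yE]|xS] := pselect (S2p x); first by exists y.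
    by exists 0 => /xS.
  by exists h.
have [h hP] := pick N N' NN'; have [k kP] := pick N' N N'N.
exists (h, k) => /=.
  split; [exact: model_homeo_continuous hP|exact: model_homeo_continuous kP|
    by move=> x /hP[]|by move=> x /kP[]|split=> x; rewrite inE => xS].
    have [hS hE] := hP _ xS; have [kS kE] := kP _ hS.
    by apply: injN => //; rewrite kE.
  have [kS kE] := kP _ xS; have [hS hE] := hP _ kS.
  by apply: injN' => //; rewrite hE.
move=> g sg; have [eta [tau [se tt e]]] := orb g sg.
exists eta, tau; split=> // t; have [hS hE] := hP _ (sg.1 t).
by apply: injN' => //; [exact: se.1|rewrite hE].
Qed.

End Conjugacy.

(** * Reduction to six sign patterns *)

Section Classification.
Variable R : realType.
Implicit Types (p q : 'I_3 -> R) (a b c : R).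

(** Indices are reversed with respect to [in_case], as they are in [exponents]. *)
Definition sign_case (c : portrait) p :=
  match c with
  | P_i => [/\ 0 < p i3, 0 < p i2 & 0 < p i1]
  | P_ii => [/\ p i3 < 0, 0 < p i2 & p i1 < 0]
  | P_iiia => [/\ p i3 = 0, 0 < p i2 & 0 < p i1]
  | P_iiib => [/\ 0 < p i3, p i2 = 0 & p i1 < 0]
  | P_iv => [/\ p i3 = 0, p i2 = 0 & p i1 < 0]
  | P_v => [/\ p i3 = 0, p i2 = 0 & p i1 = 0]
  end.

Lemma in_caseE (c : portrait) alpha d : in_case c alpha d <-> sign_case c (exponents alpha d).
Proof. by case: c; rewrite /= !exponentsE. Qed.

Lemma exponents_onto (alpha : R) p : exists d, exponents alpha d = p.
Proof.
exists (fun i => p (rev_ord i) - alpha); apply/funext => i.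
by rewrite /exponents rev_ordK; ring.
Qed.

Let good p := exists (k : portrait) q s, sign_case k q /\ conjugate s p q.

Let good_conjugate s p q : conjugate s p q -> good q -> good p.
Proof.
by move=> pq [c [r [t [cr qr]]]]; exists c, r, (s == t); split=> //; exact: conjugate_trans pq qr.
Qed.

Let triple (a b c : 'I_3) (i : 'I_3) : 'I_3 := nth a [:: a; b; c] i.

Let good_rot a b c : good (vec3 b c a) -> good (vec3 a b c).
Proof.
apply: good_conjugate.
apply: (@conjugate_permute _ _ _ (triple i2 i3 i1) (triple i3 i1 i2) 1) => //.
- by apply: ord3_ind.
- by apply: ord3_ind.
- by move=> u; apply: ord3_ind; rewrite /cross /triple /= !vec3E; ring.
Qed.

Let good_swap a b c : good (vec3 b a c) -> good (vec3 a b c).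
Proof.
apply: good_conjugate.
apply: (@conjugate_permute _ _ _ (triple i2 i1 i3) (triple i2 i1 i3) (-1)); rewrite ?oppr_eq0 ?oner_eq0 //.
- by apply: ord3_ind.
- by apply: ord3_ind.
- by move=> u; apply: ord3_ind; rewrite /cross /triple /= !vec3E; ring.
Qed.

Let good_opp a b c : good (vec3 (- a) (- b) (- c)) -> good (vec3 a b c).
Proof.
apply: good_conjugate.
have -> : vec3 (- a) (- b) (- c) = fun i => -1 * vec3 a b c i.
  by apply/funext; apply: ord3_ind; rewrite /= !vec3E; ring.
by apply: conjugate_scale; rewrite oppr_eq0 oner_eq0.
Qed.

Let good_case (c : portrait) p : sign_case c p -> good p.
Proof.
move=> cp; exists c, p, (0 < (1 : R)); split=> //.
have := @conjugate_scale R p 1; rewrite oner_eq0 => /(_ isT).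
by rewrite (_ : (fun i => _) = p)//; apply/funext => i; rewrite mul1r.
Qed.

Let good_sorted a b c : a <= b <= c -> good (vec3 a b c).
Proof.
move=> /andP[ab bc]; have [c0|c0|c0] := ltrgtP c 0.
- by apply/good_opp/(@good_case P_i); rewrite /= !vec3E; split; lra.
- have [a0|a0|a0] := ltrgtP a 0.
  + have [b0|b0|b0] := ltrgtP b 0.
    * apply/good_rot/(@good_case P_ii).
      by rewrite /= !vec3E; split; lra.
    * apply/good_opp/good_swap/(@good_case P_ii).
      by rewrite /= !vec3E; split; lra.
    * by apply/(@good_case P_iiib); rewrite /= !vec3E; split; lra.
  + by apply/(@good_case P_i); rewrite /= !vec3E; split; lra.
  + have [b0|b0|b0] := ltrgtP b 0; first by lra.
      by apply/good_rot/(@good_case P_iiia); rewrite /= !vec3E; split; lra.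
    apply/good_opp/good_rot/good_rot/(@good_case P_iv).
    by rewrite /= !vec3E; split; lra.
- have [a0|a0|a0] := ltrgtP a 0; [|lra|].
    have [b0|b0|b0] := ltrgtP b 0; [|lra|].
      by apply/good_opp/(@good_case P_iiia); rewrite /= !vec3E; split; lra.
    by apply/(@good_case P_iv); rewrite /= !vec3E; split; lra.
  by apply/(@good_case P_v); rewrite /= !vec3E; split; lra.
Qed.

(** After sorting the coordinates, the pattern of signs determines which permutation and
    which global sign lead to one of the six cases. *)
Lemma classification p : exists (k : portrait) q s, sign_case k q /\ conjugate s p q.
Proof.
have -> : p = vec3 (p i1) (p i2) (p i3) by apply/funext; exact: ord3_ind.
rewrite -/(good _); move: (p i1) (p i2) (p i3) => a b c.
have [ab|/ltW ba] := lerP a b; have [bc|/ltW cb] := lerP b c;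
  have [ac|/ltW ca] := lerP a c.
- by apply: good_sorted; rewrite ab bc.
- by apply: good_sorted; rewrite ab bc.
- by apply/good_rot/good_swap/good_rot/good_rot/good_sorted; rewrite ?ac ?cb.
- by apply/good_rot/good_rot/good_sorted; rewrite ca ab.
- by apply/good_swap/good_sorted; rewrite ba ac.
- by apply/good_rot/good_sorted; rewrite bc ca.
- by apply/good_rot/good_swap/good_sorted; rewrite cb ba.
- by apply/good_rot/good_swap/good_sorted; rewrite cb ba.
Qed.

End Classification.

(** * Orbits followed at a varying speed *)

Section FollowingOrbits.
Variable R : realType.
Implicit Types (p q u v : 'I_3 -> R) (g : R -> 'rV[R]_3) (l : R -> R).

(** Normalizing a vector with growth rates [2 a i] subtracts the mean rate.  Hence only
    differences of rates matter, and the mean of [cross q V] is 0 by [cross_skew]. *)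
Lemma normalized_derive q (w : R -> 'I_3 -> R) (a : 'I_3 -> R) (t c : R) :
  0 < \sum_i w t i -> (forall i, is_derive t 1 (w ^~ i) (2 * w t i * a i)) ->
  (forall i j, w t i * w t j * (a i - a j) = w t i * w t j * (c *
     (cross q (fun k => w t k / \sum_m w t m) i - cross q (fun k => w t k / \sum_m w t m) j))) ->
  forall i, is_derive t 1 (fun s => w s i / \sum_j w s j)
    (c * (2 * (w t i / \sum_j w t j) * cross q (fun k => w t k / \sum_m w t m) i)).
Proof.
move=> S0 dw; set V := fun k => w t k / \sum_m w t m => ac i.
have Sn : \sum_j w t j != 0 by rewrite gt_eqF.
have skew := cross_skew q V.
have dS : is_derive t 1 (fun s => \sum_j w s j) (\sum_j 2 * w t j * a j).
  rewrite (_ : (fun s => _) = fun s => w s i1 + w s i2 + w s i3); last first.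
    by apply/funext => s; rewrite sum3.
  by have ? := dw i1; have ? := dw i2; have ? := dw i3;
    apply: is_derive_eq; rewrite sum3.
have := is_deriveM (dw i) (is_deriveV Sn dS).
rewrite (_ : (w ^~ i * (fun s => (\sum_j w s j)^-1))%R = fun s => w s i / \sum_j w s j)//.
move=> h; apply: is_derive_eq; rewrite /GRing.scale/=.
have VE j : w t j = V j * \sum_m w t m by rewrite /V divfK.
have V1 : \sum_j V j = 1 by rewrite -mulr_suml divff.
transitivity (2 * \sum_j V i * V j * (a i - a j)).
  rewrite [w t i]VE.
  have -> : \sum_j 2 * w t j * a j = 2 * (\sum_m w t m) * \sum_j V j * a j.
    by rewrite mulr_sumr; apply: eq_bigr => j _; rewrite [w t j]VE; ring.
  have -> : \sum_j V i * V j * (a i - a j) = V i * (a i - \sum_j V j * a j).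
    rewrite -[X in X - _]mul1r -V1 !sum3; ring.
  by field.
transitivity (2 * \sum_j V i * V j * (c * (cross q V i - cross q V j))).
  congr (_ * _); apply: eq_bigr => j _.
  have := ac i j; rewrite [w t i]VE [w t j]VE => e.
  have SS : (\sum_m w t m) * (\sum_m w t m) != 0 by rewrite mulf_neq0.
  by apply: (mulIf SS); move: e; lra.
have -> : \sum_j V i * V j * (c * (cross q V i - cross q V j)) =
    V i * c * (cross q V i * \sum_j V j - \sum_j V j * cross q V j).
  by rewrite !sum3; ring.
by rewrite V1 skew -/(V i); ring.
Qed.

(** The change of time is the integral of the speed; uniqueness identifies the
    reparametrized solution with the given curve. *)
Lemma follow_time_changed q (V : R -> 'I_3 -> R) l (m M : R) :
  continuous l -> 0 < m -> (forall t, m <= l t <= M) -> (forall t, simplex (V t)) ->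
  (forall (t : R) i, is_derive t 1 (V ^~ i) (l t * (2 * V t i * cross q (V t) i))) ->
  exists eta tau, [/\ sphere_sol q eta, time_change true tau &
    forall t, sq (eta (tau t)) = V t].
Proof.
move=> cl m0 lb sV dV.
have [tau [tau0 dtau]] := primitive cl.
have [tau1 tau2] := linear_growth_onto m0 dtau (fun t => proj1 (andP (lb t))).
have [y yS yE] := simplex_point (sV 0).
have [eta [se ey _]] := sphere_sol_exists q yS.
exists eta, tau; split=> //.
  by split=> //; apply/seteqP; split=> // v _; have [t <-] := tau2 v; exists t.
have bnd u : simplex u -> forall i, `|u i| <= 1.
  by move=> us i; have /andP[h1 h2] := simplex_le1 i us; rewrite ger0_norm.
have e : (fun t => sq (eta (tau t))) = V.
  apply: (@replicator_unique _ q l M) => //.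
  - by move=> t; have /andP[h1 h2] := lb t; rewrite ger0_norm// (le_trans (ltW m0)).
  - by move=> t; apply: bnd; exact: simplex_sq (se.1 _).
  - by move=> t; exact: bnd.
  - move=> t i; have := is_derive_comp1 (sphere_sol_sq se (tau t) i) (dtau t).
    by rewrite mulrC.
  - by rewrite tau0 ey yE.
by move=> t; have := congr1 (fun f => f t) e.
Qed.

End FollowingOrbits.

(** * Power maps *)

Section PowerMap.
Variable R : realType.
Variable k : 'I_3 -> R.
Hypothesis k0 : forall i, 0 < k i.
Implicit Types (p q u v : 'I_3 -> R) (x : 'rV[R]_3) (g : R -> 'rV[R]_3).

Let S u := \sum_j u j `^ k j.

Definition power_map u i := u i `^ k i / S u.

Let S_gt0 u : simplex u -> 0 < S u.
Proof.
move=> [u0 u1]; rewrite lt_def sumr_ge0 ?andbT; last by move=> i _; exact: powR_ge0.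
apply/eqP => /eqP; rewrite psumr_eq0; last by move=> i _; exact: powR_ge0.
move=> /allP z; have : \sum_i u i = 0.
  apply: big1 => i _; have := z i; rewrite mem_index_enum => /(_ isT).
  by rewrite powR_eq0 => /andP[/eqP].
by rewrite u1 => /eqP; rewrite oner_eq0.
Qed.

Lemma simplex_power_map u : simplex u -> simplex (power_map u).
Proof.
move=> us; have S0 := S_gt0 us; split=> [i|].
  by rewrite divr_ge0 ?powR_ge0 ?ltW.
by rewrite -mulr_suml divff// gt_eqF.
Qed.

(** If the normalizing sum of [u] is the smaller one, every coordinate of [u] is at most
    that of [v]; both have sum 1. *)
Lemma power_map_inj u v : simplex u -> simplex v -> power_map u = power_map v -> u = v.
Proof.
have half a b : simplex a -> simplex b -> power_map a = power_map b -> S a <= S b -> a = b.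
  move=> sa sb e Sab; have [a0 a1] := sa; have [b0 b1] := sb.
  have Sa := S_gt0 sa; have Sb := S_gt0 sb.
  have le i : a i <= b i.
    rewrite leNgt; apply/negP => ba.
    have : b i `^ k i < a i `^ k i by apply: gt0_ltr_powR; rewrite ?nnegrE.
    have := congr1 (fun f => f i) e; rewrite /power_map => ei.
    have aE : a i `^ k i = b i `^ k i / S b * S a by rewrite -ei divfK// gt_eqF.
    rewrite aE ltNge => /negP; apply.
    by rewrite mulrAC ler_pdivrMr// ler_wpM2l ?powR_ge0.
  have h1 := le i1; have h2 := le i2; have h3 := le i3.
  apply/funext => i; move: a1 b1; rewrite !sum3 => a1 b1.
  by move: i; apply: ord3_ind; lra.
move=> su sv e; have [h|/ltW h] := lerP (S u) (S v); first exact: half.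
by apply/esym/half.
Qed.

(** The inverse is [u i = (c * v i) ^ (1 / k i)], where the intermediate value theorem
    provides a [c] for which these numbers have sum 1. *)
Lemma power_map_onto v : simplex v -> exists2 u, simplex u & power_map u = v.
Proof.
move=> sv; have [v0 v1] := sv.
pose f (c : R) := \sum_i Num.sqrt ((v i * c) ^+ 2) `^ (k i)^-1.
have cf : continuous f.
  have term i : continuous (fun c : R => Num.sqrt ((v i * c) ^+ 2) `^ (k i)^-1).
    move=> c; have cl : {for c, continuous (fun c : R => v i * c)}.
      by apply: ctsM; [exact: cts_cst|exact: cvg_id].
    have ki : 0 <= (k i)^-1 by rewrite invr_ge0 ltW.
    exact: (cts_comp cl (@abs_powR_continuous _ _ ki _)).
  rewrite (_ : f = fun c => Num.sqrt ((v i1 * c) ^+ 2) `^ (k i1)^-1 +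
    Num.sqrt ((v i2 * c) ^+ 2) `^ (k i2)^-1 + Num.sqrt ((v i3 * c) ^+ 2) `^ (k i3)^-1).
    by move=> c; exact: (ctsD (ctsD (term i1 c) (term i2 c)) (term i3 c)).
  by apply/funext => c; rewrite /f sum3.
have f0 : f 0 = 0.
  by apply: big1 => i _; rewrite mulr0 expr0n sqrtr0 powR0// invr_eq0 gt_eqF.
have [j vj] : exists j, v j != 0.
  apply: contrapT => h; have : \sum_i v i = 0.
    by apply: big1 => i _; apply/eqP/negP => vi; apply: h; exists i; exact/negP.
  by rewrite v1 => /eqP; rewrite oner_eq0.
have f1 : 1 <= f (v j)^-1.
  rewrite /f (bigD1 j)//= divff// expr1n sqrtr1 powR1 lerDl sumr_ge0//.
have f01 : f 0 <= 1 <= f (v j)^-1 by apply/andP; split; [rewrite f0 ler01|exact: f1].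
have [c fc] := ivt_line cf f01.
pose u i := Num.sqrt ((v i * c) ^+ 2) `^ (k i)^-1.
have uk i : u i `^ k i = v i * `|c|.
  by rewrite /u -powRrM mulVf ?gt_eqF// powRr1 ?sqrtr_ge0// sqrtr_sqr normrM ger0_norm.
have us : simplex u by split=> // i; exact: powR_ge0.
have SE : S u = `|c|.
  by rewrite /S; under eq_bigr do rewrite uk; rewrite -mulr_suml v1 mul1r.
have c0 : 0 < `|c| by rewrite -SE; exact: S_gt0.
exists u => //; apply/funext => i.
by rewrite /power_map uk SE mulfK// gt_eqF.
Qed.

Lemma power_map_continuous x : S2p x ->
  {for x, continuous (fun x => \row_i power_map (sq x) i : 'rV[R]_3)}.
Proof.
move=> xS.
have term i : {for x, continuous (fun y : 'rV[R]_3 => sq y i `^ k i)}.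
  have cs : {for x, continuous (fun y : 'rV[R]_3 => sq y i)}.
    by apply: cts_sqr; exact: coord_continuous3.
  have := cts_comp cs (@abs_powR_continuous _ _ (ltW (k0 i)) _).
  rewrite (_ : (fun y => _) = fun y : 'rV[R]_3 => sq y i `^ k i)//.
  by apply/funext => y; rewrite sqrtr_sqr ger0_norm// sqr_ge0.
have cS : {for x, continuous (fun y : 'rV[R]_3 => S (sq y))}.
  rewrite (_ : (fun y => _) = fun y : 'rV[R]_3 =>
      sq y i1 `^ k i1 + sq y i2 `^ k i2 + sq y i3 `^ k i3).
    exact: (ctsD (ctsD (term i1) (term i2)) (term i3)).
  by apply/funext => y; rewrite /S sum3.
apply/continuous_rowP => i.
rewrite (_ : (fun y => _) = fun y : 'rV[R]_3 => sq y i `^ k i / S (sq y)).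
  by apply: cts_div => //; rewrite gt_eqF//; apply: S_gt0; exact: simplex_sq.
by apply/funext => y; rewrite mxE.
Qed.

Let sq_power_derive p g (t : R) i : sphere_sol p g ->
  is_derive t 1 (fun s => sq (g s) i `^ k i)
    (2 * sq (g t) i `^ k i * (k i * cross p (sq (g t)) i)).
Proof.
move=> sg; have [z|pos] := sphere_sol_sign sg i.
  rewrite (_ : (fun s => _) = fun=> 0); last first.
    by apply/funext => s; rewrite /sq z expr0n/= powR0// gt_eqF.
  rewrite /sq z expr0n/= powR0 ?gt_eqF// mulr0 mul0r.
  exact: is_derive_cst.
have ? := sphere_sol_sq sg t i.
have u0 s : 0 < sq (g s) i by rewrite exprn_gt0.
rewrite (_ : (fun s => _) = fun s => expR (k i * ln (sq (g s) i))); last first.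
  by apply/funext => s; rewrite /powR gt_eqF.
have dl := @is_derive_comp1 R (@ln R) (fun s => sq (g s) i) t _ _ (is_derive1_ln (u0 t)) (sphere_sol_sq sg t i).
have dk : is_derive t 1 (fun s => k i * ln (sq (g s) i)) (2 * (k i * cross p (sq (g t)) i)).
  apply: is_derive_eq; rewrite /GRing.scale/=.
  have un : sq (g t) i != 0 by rewrite gt_eqF.
  by field.
have := is_derive_comp1 (is_derive_expR _) dk.
by move=> h; apply: is_derive_eq; rewrite /powR gt_eqF//; ring.
Qed.

(** The image of an orbit has growth rates [2 k i * cross p u i]; the hypothesis says
    that their differences are those of the model, up to a speed that is a positive
    linear form in [u] and so is bounded above and away from 0. *)
Lemma conjugate_power p q (c : 'I_3 -> R) : (forall i, 0 < c i) ->
  (forall u v i j, \sum_l v l = 1 -> k i * cross p u i - k j * cross p u j =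
     (\sum_l c l * u l) * (cross q v i - cross q v j)) ->
  conjugate true p q.
Proof.
move=> c0 cE; pose M := c i1 + c i2 + c i3.
pose m := Num.min (c i1) (Num.min (c i2) (c i3)).
have m0 : 0 < m by rewrite !lt_min !c0.
have cb u : simplex u -> m <= \sum_l c l * u l <= M.
  move=> us; have [u0 u1] := us.
  have mc i : m * u i <= c i * u i.
    rewrite ler_wpM2r//; move: i; apply: ord3_ind; by rewrite /m !ge_min lexx ?orbT.
  have cM i : c i * u i <= c i.
    by have /andP[_ h] := simplex_le1 i us; rewrite ler_piMr// ltW.
  rewrite -[m in leLHS]mulr1 -u1 !sum3 !mulrDr !lerD//.
apply: (@conjugate_model _ true p q (fun x => \row_i power_map (sq x) i)
  (fun x => \row_i sq x i)).
- exact: power_map_continuous.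
- move=> x xS; apply/continuous_rowP => i.
  rewrite (_ : (fun y => _) = fun y : 'rV[R]_3 => sq y i).
    by apply: cts_sqr; exact: coord_continuous3.
  by apply/funext => y; rewrite mxE.
- move=> x y xS yS e; apply: sq_inj => //.
  apply: power_map_inj; [exact: simplex_sq|exact: simplex_sq|].
  by apply/funext => i; have := congr1 (fun r : 'rV[R]_3 => r 0 i) e; rewrite !mxE.
- move=> x y xS yS e; apply: sq_inj => //.
  by apply/funext => i; have := congr1 (fun r : 'rV[R]_3 => r 0 i) e; rewrite !mxE.
- move=> x xS; have [y yS yE] := simplex_point (simplex_power_map (simplex_sq xS)).
  by exists y => //; apply/rowP => i; rewrite !mxE yE.
- move=> y yS; have [u us uE] := power_map_onto (simplex_sq yS).
  have [x xS xE] := simplex_point us.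
  by exists x => //; apply/rowP => i; rewrite !mxE xE uE.
move=> g sg; pose l t := \sum_i c i * sq (g t) i.
have cl : continuous l.
  move=> t; have ct i : {for t, continuous (fun t => c i * sq (g t) i)}.
    apply: ctsM; first exact: cts_cst.
    exact: is_derive_continuous (sphere_sol_sq sg t i).
  have := ctsD (ctsD (ct i1) (ct i2)) (ct i3).
  by rewrite (_ : (fun y : R => _) = l)//; apply/funext => s; rewrite /l sum3.
have [eta [tau [se tt e]]] : exists eta tau, [/\ sphere_sol q eta, time_change true tau &
    forall t, sq (eta (tau t)) = power_map (sq (g t))].
  apply: (follow_time_changed cl m0 (M := M)) => [t|t|t i].
  - exact: cb (simplex_sq (sg.1 t)).
  - exact: simplex_power_map (simplex_sq (sg.1 t)).
  have us := simplex_sq (sg.1 t); have S0 := S_gt0 us.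
  apply: (@normalized_derive _ q (fun t i => sq (g t) i `^ k i)
    (fun i => k i * cross p (sq (g t)) i) t (l t)) => //.
    by move=> j; exact: sq_power_derive.
  move=> a b; congr (_ * _); apply: cE.
  by have [] := simplex_power_map us.
by exists eta, tau; split=> // t; rewrite e.
Qed.

End PowerMap.

Section SaddleCases.
Variable R : realType.
Implicit Types p q : 'I_3 -> R.

(** The model [q] satisfies [k i * q i = 2 * p i], so that first integrals correspond. *)
Lemma conjugate_ii p : sign_case P_ii p -> conjugate true p (vec3 (-1) 2 (-1)).
Proof.
move=> [p3 p2 p1].
apply: (@conjugate_power _ (vec3 (- 2 * p i1) (p i2) (- 2 * p i3)) _ _ _
  (vec3 (- (p i2 * p i3)) (2 * p i1 * p i3) (- (p i1 * p i2)))).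
- by apply: ord3_ind; rewrite !vec3E; move: p1 p2 p3; lra.
- apply: ord3_ind; rewrite !vec3E ?oppr_gt0.
  + by rewrite pmulr_rlt0.
  + by rewrite -mulrA mulr_gt0// nmulr_rgt0.
  + by rewrite nmulr_rlt0.
move=> u v i j; rewrite !sum3 => v1; have v3 : v i3 = 1 - v i1 - v i2 by move: v1; lra.
by move: j; apply: ord3_ind; move: i; apply: ord3_ind; rewrite /cross !vec3E ?v3; ring.
Qed.

Lemma conjugate_iiib p : sign_case P_iiib p -> conjugate true p (vec3 (-1) 0 1).
Proof.
move=> [p3 p2 p1].
apply: (@conjugate_power _ (vec3 (- p i1) 1 (p i3)) _ _ _
  (vec3 (p i3) (- (p i1 * p i3)) (- p i1))).
- by apply: ord3_ind; rewrite !vec3E; move: p1 p3; lra.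
- by apply: ord3_ind; rewrite !vec3E ?oppr_gt0// pmulr_llt0.
move=> u v i j; rewrite !sum3 => v1; have v3 : v i3 = 1 - v i1 - v i2 by move: v1; lra.
by move: j; apply: ord3_ind; move: i; apply: ord3_ind; rewrite /cross !vec3E ?v3 ?p2; ring.
Qed.

Lemma conjugate_multiple p q (a : R) : 0 < a -> (forall i, q i = a * p i) -> conjugate true p q.
Proof.
move=> a0 qE; have := @conjugate_scale _ p a; rewrite gt_eqF// => /(_ isT).
by rewrite a0 (_ : (fun i => _) = q)//; apply/funext.
Qed.

End SaddleCases.

(** * Conjugacies through polar coordinates *)

Section PolarConjugacy.
Variable R : realType.
Implicit Types (p q u v w c : 'I_3 -> R) (x : 'rV[R]_3) (g : R -> 'rV[R]_3).

Lemma time_change_comp (tau tau' : R -> R) : time_change true tau ->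
  time_change true tau' -> time_change true (tau' \o tau).
Proof.
move=> [m r] [m' r']; split=> [s t /m /m'//|]; apply/seteqP; split=> // v _.
have [s _ <-] : range tau' v by rewrite r'.
by have [t _ <-] : range tau s by [rewrite r]; exists t.
Qed.

Lemma time_change_id : time_change true (@id R).
Proof. by split=> //; apply/seteqP; split=> // v _; exists v. Qed.

Lemma conjugate_polar p q w cx cy w' cx' cy' c : 
  polar_frame w cx cy -> polar_frame w' cx' cy' -> (forall i, 0 < c i) ->
  (forall i, cx' i * c i = cx i) -> (forall i, cy' i * c i = cy i) ->
  (forall i, (0 < w i) = (0 < w' i)) ->
  (forall g, sphere_sol p g -> exists eta tau, [/\ sphere_sol q eta, time_change true tau &
     forall t, polar w cx cy (sq (g t)) = polar w' cx' cy' (sq (eta (tau t)))]) ->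
  conjugate true p q.
Proof.
move=> fr fr' c0 ccx ccy ww orb.
apply: (conjugate_model (polar_continuous fr) (polar_continuous fr')) => //.
- by move=> x y xS yS e; apply: sq_inj => //; exact: polar_inj fr _ _ (simplex_sq xS) (simplex_sq yS) e.
- by move=> x y xS yS e; apply: sq_inj => //; exact: polar_inj fr' _ _ (simplex_sq xS) (simplex_sq yS) e.
- move=> x xS; have [|v vs ve] := polar_transfer fr fr' c0 ccx ccy _ (simplex_sq xS).
    by move=> i; rewrite ww.
  by have [y yS yE] := simplex_point vs; exists y => //; rewrite yE.
move=> y yS; have [i|i|i|i|v vs ve] := polar_transfer fr' fr (c := fun i => (c i)^-1) _ _ _ _ (simplex_sq yS).
- by rewrite invr_gt0.
- by rewrite -ccx mulfK// gt_eqF.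
- by rewrite -ccy mulfK// gt_eqF.
- by rewrite ww.
by have [x xS xE] := simplex_point vs; exists x => //; rewrite xE.
Qed.

Lemma depth_polar w cx cy u : polar_frame w cx cy -> simplex u -> u <> w ->
  depth w u = Num.sqrt (polar w cx cy u 0 i1 ^+ 2 + polar w cx cy u 0 i2 ^+ 2).
Proof.
move=> fr us uw; have d0 : 0 < depth w u by have := depth_gt0 fr us uw.
by rewrite (polar_sq fr us uw) sqrtr_sqr gtr0_norm.
Qed.

Lemma depth_eq_gmean_gt0 w w' u v : simplex w -> simplex w' -> depth w' v = depth w u ->
  0 < gmean w u -> 0 < gmean w' v.
Proof.
move=> [w0 _] [w0' _] dE gu; have g := gmean_center_gt0 w0; have g' := gmean_center_gt0 w0'.
have : gmean w' v / gmean w' w' = gmean w u / gmean w w by move: dE; rewrite /depth; lra.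
move=> /(congr1 (fun z => z * gmean w' w')).
by rewrite divfK ?gt_eqF// => ->; exact: mulr_gt0 (divr_gt0 gu g) g'.
Qed.

Lemma onto_range (f : R -> R) : (forall z, exists t, f t = z) -> range f = setT.
Proof. by move=> h; apply/seteqP; split=> // z _; have [t <-] := h z; exists t. Qed.

(** On the edge [u k = 0] the difference of the growth rates is the constant [p k], and
    that of the model is [q k]; the speed is their ratio. *)
Lemma edge_follow p q c g i j k : cyclic3 i j k -> (forall i, 0 < c i) ->
  0 < p k -> 0 < q k -> sphere_sol p g -> (forall t, g t 0 k = 0) ->
  exists eta tau, [/\ sphere_sol q eta, time_change true tau &
    forall t, sq (eta (tau t)) = rescale c (sq (g t))].
Proof.
move=> ijk c0 pk qk sg gk; have l0 : 0 < p k / q k by rewrite divr_gt0.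
apply: (@follow_time_changed _ _ _ (fun=> p k / q k) (p k / q k) (p k / q k)) => //.
- by move=> t; exact: cvg_cst.
- by move=> t; rewrite lexx.
- by move=> t; apply: simplex_rescale => //; exact: simplex_sq (sg.1 t).
move=> t; have us := simplex_sq (sg.1 t); have S0 := rescale_sum_gt0 c0 us.
have [_ V1] := simplex_rescale c0 us; have [_ u1] := us.
apply: (@normalized_derive _ q (fun t i => c i * sq (g t) i) (cross p (sq (g t))) t) => //.
  move=> a; have ? := sphere_sol_sq sg t a.
  by apply: is_derive_eq; rewrite /GRing.scale/=; ring.
have uk : sq (g t) k = 0 by rewrite /sq gk expr0n.
have Vk : rescale c (sq (g t)) k = 0 by rewrite /rescale uk mulr0 mul0r.
rewrite -/(rescale c (sq (g t))).
have [ui uj _] := crossE ijk p (sq (g t)).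
have [vi vj _] := crossE ijk q (rescale c (sq (g t))).
have qn : q k != 0 by rewrite gt_eqF.
have ij : cross p (sq (g t)) i - cross p (sq (g t)) j = p k / q k *
    (cross q (rescale c (sq (g t))) i - cross q (rescale c (sq (g t))) j).
  rewrite ui uj vi vj uk Vk !mulr0; move: u1 V1; rewrite !(cyclic3_sum ijk) uk Vk.
  rewrite !addr0 => u1 V1.
  transitivity (- p k * (sq (g t) i + sq (g t) j)); first by ring.
  rewrite u1; transitivity (- (p k / q k) * q k *
    (rescale c (sq (g t)) i + rescale c (sq (g t)) j)); last by ring.
  by rewrite V1; field.
by apply: (cyclic3_all ijk); apply: (cyclic3_all ijk); rewrite ?uk ?mulr0 ?mul0r ?subrr ?mulr0//;
  rewrite ?ij// -[X in _ * X]opprB ij; ring.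
Qed.

Lemma polar_rescale w cx cy w' cx' cy' c u : (forall i, 0 < c i) -> simplex u ->
  (forall i, cx' i * c i = cx i) -> (forall i, cy' i * c i = cy i) ->
  gmean w u = 0 -> gmean w' (rescale c u) = 0 ->
  polar w cx cy u = polar w' cx' cy' (rescale c u).
Proof.
move=> c0 us ccx ccy gu gu'; have S0 := rescale_sum_gt0 c0 us.
apply: (polar_eq S0 (lin_rescale c0 us ccx) (lin_rescale c0 us ccy)).
by rewrite /depth gu gu' !mul0r.
Qed.

End PolarConjugacy.

Section CentreCase.
Variable R : realType.
Variables p q : 'I_3 -> R.
Hypotheses (p0 : forall i, 0 < p i) (q0 : forall i, 0 < q i).
Implicit Types (u v : 'I_3 -> R) (x : 'rV[R]_3) (g : R -> 'rV[R]_3).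

Let c i := q i / p i.

Let c0 i : 0 < c i. Proof. by rewrite divr_gt0. Qed.
Let pn i : p i != 0. Proof. by rewrite gt_eqF. Qed.
Let qn i : q i != 0. Proof. by rewrite gt_eqF. Qed.

Let cx i : frame_x q i * c i = frame_x p i.
Proof. by rewrite /c; move: i; apply: ord3_ind; rewrite /frame_x !vec3E; field; rewrite ?qn ?pn. Qed.

Let cy i : frame_y q i * c i = frame_y p i.
Proof. by rewrite /c; move: i; apply: ord3_ind; rewrite /frame_y !vec3E; field; rewrite ?qn ?pn. Qed.

Let frp := rotation_frame p0.
Let frq := rotation_frame q0.

Let cross_weights (r : 'I_3 -> R) i : cross r (weights r) i = 0.
Proof. by rewrite /weights; move: i; apply: ord3_ind; rewrite /cross !vec3E; ring. Qed.

(** Boundary orbits are followed by rescaling; interior ones turn around the centre at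
    constant depth, and equal angles define the change of time. *)
Lemma conjugate_centres : conjugate true p q.
Proof.
apply: (conjugate_polar frp frq c0 cx cy) => [i|g sg]; first by rewrite !weights_gt0.
have [[k gk]|gp] := pselect (exists k, g 0 0 k = 0).
  have gk' t : g t 0 k = 0 by exact: sphere_sol_eq0 sg gk t.
  have [i [j ijk]] := cyclic3_third k.
  have [eta [tau [se tt e]]] := edge_follow ijk c0 (p0 k) (q0 k) sg gk'.
  exists eta, tau; split=> // t; rewrite e.
  have us := simplex_sq (sg.1 t); have uk : sq (g t) k = 0 by rewrite /sq gk' expr0n.
  apply: (polar_rescale c0 us cx cy); apply: (@gmean_eq0 _ _ _ k) => //; rewrite ?weights_gt0//.
  by rewrite /rescale uk mulr0 mul0r.
have g0 t i : 0 < g t 0 i.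
  have [z|//] := sphere_sol_sign sg i; by case: gp; exists i; rewrite z.
have [gw|gw] := pselect (sq (g 0) = weights p).
  have [y yS yE] := simplex_point (simplex_weights q0).
  exists (fun=> y), id; split; last 2 first.
  - exact: time_change_id.
  - move=> t; rewrite (stationary_cst sg) ?gw ?yE.
      by rewrite (polar_center frp) (polar_center frq).
    by move=> i; rewrite cross_weights mulr0.
  by apply: sphere_sol_cst => // i; rewrite yE cross_weights mulr0.
have us := simplex_sq (sg.1 0).
have [|v vs ve] := polar_transfer frp frq c0 cx cy _ us.
  by move=> i _; exact: weights_gt0.
have vw : v <> weights q.
  move=> h; have := polar_sq frp us gw; rewrite -ve h (polar_center frq) !mxE expr0n addr0.
  move=> /esym/eqP; rewrite sqrf_eq0 gt_eqF//.
  by have := depth_gt0 frp us gw.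
have dE : depth (weights q) v = depth (weights p) (sq (g 0)).
  by rewrite (depth_polar frq vs vw) (depth_polar frp us gw) ve.
have [y yS yE] := simplex_point vs.
have [eta [se ey _]] := sphere_sol_exists q yS.
have y0 i : 0 < y 0 i.
  apply: (gmean_sq_gt0 q0) => //; rewrite yE.
  apply: (depth_eq_gmean_gt0 (simplex_weights p0) (simplex_weights q0) dE).
  by rewrite gmean_sq_exp// expR_gt0.
have eta0 t i : 0 < eta t 0 i by apply: (sphere_sol_gt0 se (t := 0)); rewrite ey.
have [Th [Th1 Th2 ThE]] := rotation p0 sg g0 gw.
have ew : sq (eta 0) <> weights q by rewrite ey yE.
have [Ph [Ph1 Ph2 PhE]] := rotation q0 se eta0 ew.
have [sig ts [_ sigK]] := @time_changeK _ true Ph (conj Ph1 (onto_range Ph2)).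
exists eta, (sig \o Th); split=> //.
  exact: time_change_comp (conj Th1 (onto_range Th2)) ts.
by move=> t; rewrite /= ThE PhE sigK ey yE dE.
Qed.

End CentreCase.

Section ParabolicCase.
Variable R : realType.
Implicit Types (p q u v : 'I_3 -> R) (x : 'rV[R]_3) (g : R -> 'rV[R]_3).

(** When [p i3 = 0] the centre [weights p] lies on the edge [u3 = 0] of equilibria, and
    the simplex becomes a half-disc. *)
Definition slit_x p := vec3 (p i1)^-1 (- (p i2)^-1) 0.
Definition slit_y : 'I_3 -> R := vec3 0 0 1.

Lemma slitXY p u : lin (slit_x p) u = u i1 / p i1 - u i2 / p i2 /\ lin slit_y u = u i3.
Proof. by rewrite /lin !sum3 /slit_x /slit_y !vec3E; split; ring. Qed.

Lemma slit_simplex p : sign_case P_iiia p -> simplex (weights p).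
Proof.
move=> [p3 p2 p1]; have W0 : 0 < \sum_j p j by rewrite sum3 p3 addr0 addr_gt0.
split; last by rewrite -mulr_suml divff// gt_eqF.
by apply: ord3_ind; rewrite divr_ge0 ?(ltW W0)// ?p3// ltW.
Qed.

Lemma slit_weights p : sign_case P_iiia p -> [/\ weights p i3 = 0,
  0 < weights p i2 & 0 < weights p i1].
Proof.
move=> [p3 p2 p1]; have W0 : 0 < \sum_j p j by rewrite sum3 p3 addr0 addr_gt0.
by rewrite /weights p3 mul0r; split=> //; exact: divr_gt0.
Qed.

Lemma slit_frame p : sign_case P_iiia p -> polar_frame (weights p) (slit_x p) slit_y.
Proof.
move=> pc; have ws := slit_simplex pc; have [w3 _ _] := slit_weights pc.
have [p3 p2 p1] := pc; have W0 : 0 < \sum_j p j by rewrite sum3 p3 addr0 addr_gt0.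
have n1 : p i1 != 0 by rewrite gt_eqF. have n2 : p i2 != 0 by rewrite gt_eqF.
have nW : \sum_j p j != 0 by rewrite gt_eqF.
split=> //.
- have [-> _] := slitXY p (weights p); rewrite /weights; field; by rewrite n1 n2 nW.
- by have [_ ->] := slitXY p (weights p).
move=> u u1; have [-> ->] := slitXY p u => /subr0_eq ex u3.
move: u1; rewrite sum3 u3 addr0 => u1.
have e1 : u i1 * p i2 = u i2 * p i1.
  by rewrite -[u i1](divfK n1) ex; field.
apply/funext; apply: ord3_ind.
- apply: (mulIf nW); rewrite /weights divfK// sum3 p3 addr0 mulrDr e1.
  by rewrite [u i2 * _]mulrC [u i1 * _]mulrC -mulrDr u1 mulr1.
- apply: (mulIf nW); rewrite /weights divfK// sum3 p3 addr0 mulrDr -e1.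
  by rewrite [u i2 * _]mulrC [u i1 * _]mulrC -mulrDr u1 mulr1.
- by rewrite u3 w3.
Qed.

(** The slope [X / Y] of the direction increases at a speed bounded below: of the
    first two coordinates one increases and the other decreases, so that one of them
    stays above its initial value at all positive times and the other at all negative
    times. *)
Lemma slope_flow p g : sign_case P_iiia p -> sphere_sol p g -> (forall t i, 0 < g t 0 i) ->
  exists s : R -> R, [/\ {homo s : t z / t < z}, forall z, exists t, s t = z &
   forall t, polar (weights p) (slit_x p) slit_y (sq (g t)) =
     row3 (depth (weights p) (sq (g 0)) * (s t / Num.sqrt (1 + s t ^+ 2)))
          (depth (weights p) (sq (g 0)) * (Num.sqrt (1 + s t ^+ 2))^-1) 0].
Proof.
move=> pc sg g0; have [p3 p2 p1] := pc.
have n1 : p i1 != 0 by rewrite gt_eqF. have n2 : p i2 != 0 by rewrite gt_eqF.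
have u0 t i : 0 < sq (g t) i by rewrite exprn_gt0.
pose X t := sq (g t) i1 / p i1 - sq (g t) i2 / p i2.
pose s t := X t / sq (g t) i3.
pose s' t := 2 * (p i2 / p i1 * sq (g t) i1 + p i1 / p i2 * sq (g t) i2) +
  2 * p i1 * p i2 * X t ^+ 2 / sq (g t) i3.
have ds (t : R) : is_derive t 1 s (s' t).
  have ? := sphere_sol_sq sg t i1; have ? := sphere_sol_sq sg t i2.
  have un : sq (g t) i3 != 0 by rewrite gt_eqF.
  pose f s := sq (g s) i3; have fn : f t != 0 by [].
  have d3 := is_deriveV fn (sphere_sol_sq sg t i3).
  have dX : is_derive t 1 X (2 * sq (g t) i1 * cross p (sq (g t)) i1 / p i1 -
      2 * sq (g t) i2 * cross p (sq (g t)) i2 / p i2).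
    by rewrite /X; apply: is_derive_eq; rewrite /GRing.scale/=; ring.
  have := is_deriveM dX d3.
  rewrite (_ : (X * (fun s => (f s)^-1))%R = s)//.
  move=> h; apply: is_derive_eq; rewrite /f /GRing.scale/= /s' /X /cross !vec3E p3.
  by field; rewrite un n1 n2.
have d1 (t : R) := sphere_sol_sq sg t i1; have d2 (t : R) := sphere_sol_sq sg t i2.
have up : {homo (fun t => sq (g t) i1) : t z / t <= z}.
  apply: (homo_of_derive d1) => t; rewrite /cross vec3E p3 mul0r subr0.
  by rewrite !mulr_ge0 ?ltW.
have down := le0_homo_of_derive d2.
have {}down : forall t z, t <= z -> sq (g z) i2 <= sq (g t) i2.
  apply: down => t; rewrite /cross vec3E p3 mul0r sub0r mulrN oppr_le0.
  by rewrite !mulr_ge0 ?ltW.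
pose m := Num.min (2 * (p i2 / p i1 * sq (g 0) i1)) (2 * (p i1 / p i2 * sq (g 0) i2)).
have m0 : 0 < m by rewrite lt_min !mulr_gt0 ?invr_gt0.
have speed t : m <= s' t.
  have h0 : 0 <= 2 * p i1 * p i2 * X t ^+ 2 / sq (g t) i3.
    by rewrite divr_ge0 ?(ltW (u0 _ _))// mulr_ge0 ?sqr_ge0// !mulr_ge0 ?ltW.
  have c1 : 0 < p i2 / p i1 by rewrite divr_gt0.
  have c2 : 0 < p i1 / p i2 by rewrite divr_gt0.
  have h1 := mulr_gt0 c1 (u0 t i1); have h2 := mulr_gt0 c2 (u0 t i2).
  rewrite /s' /m ge_min; have [t0|/ltW t0] := lerP 0 t; apply/orP; [left|right].
    by have := up _ _ t0; rewrite -(ler_pM2l c1); lra.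
  by have := down _ _ t0; rewrite -(ler_pM2l c2); lra.
have [s1 s2] := linear_growth_onto m0 ds speed.
exists s; split=> // t.
have -> : depth (weights p) (sq (g 0)) = depth (weights p) (sq (g t)).
  by rewrite /depth (gmean_flow sg g0 t).
have [lx ly] := slitXY p (sq (g t)).
have un : sq (g t) i3 != 0 by rewrite gt_eqF.
have XE : lin (slit_x p) (sq (g t)) = s t * sq (g t) i3 by rewrite lx /s divfK.
have ME : modulus (slit_x p) slit_y (sq (g t)) = Num.sqrt (1 + s t ^+ 2) * sq (g t) i3.
  rewrite /modulus XE ly -[RHS](@gtr0_norm _ _) ?mulr_gt0 ?sqrtr_gt0 ?ltr_pwDl ?sqr_ge0//.
  by rewrite -sqrtr_sqr [(Num.sqrt _ * _) ^+ 2]exprMn sqr_sqrtr ?addr_ge0 ?sqr_ge0//; congr Num.sqrt; ring.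
have rn : Num.sqrt (1 + s t ^+ 2) != 0.
  by rewrite gt_eqF// sqrtr_gt0 ltr_pwDl// sqr_ge0.
rewrite /polar ME XE ly; congr row3; congr (_ * _); field; by rewrite un rn.
Qed.

(** Orbits with [u3 = 0] are points, the two other edges are followed by rescaling, and
    on interior orbits equal slopes define the change of time. *)
Lemma conjugate_iiia p q : sign_case P_iiia p -> sign_case P_iiia q -> conjugate true p q.
Proof.
move=> pc qc; have [p3 p2 p1] := pc; have [q3 q2 q1] := qc.
have [wp3 wp2 wp1] := slit_weights pc; have [wq3 wq2 wq1] := slit_weights qc.
have frp := slit_frame pc; have frq := slit_frame qc.
pose c := vec3 (q i1 / p i1) (q i2 / p i2) 1.
have pn1 : p i1 != 0 by rewrite gt_eqF. have pn2 : p i2 != 0 by rewrite gt_eqF.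
have qn1 : q i1 != 0 by rewrite gt_eqF. have qn2 : q i2 != 0 by rewrite gt_eqF.
have c0 : forall i, 0 < c i by apply: ord3_ind; rewrite /c !vec3E ?divr_gt0.
have cx : forall i, slit_x q i * c i = slit_x p i.
  by apply: ord3_ind; rewrite /c /slit_x !vec3E; field; rewrite ?pn1 ?pn2 ?qn1 ?qn2.
have cy : forall i, slit_y i * c i = slit_y i.
  by apply: ord3_ind; rewrite /c /slit_y !vec3E; ring.
have ww : forall i, (0 < weights p i) = (0 < weights q i).
  by apply: ord3_ind; rewrite ?wp1 ?wp2 ?wp3 ?wq1 ?wq2 ?wq3.
have ww' i : 0 < weights p i -> 0 < weights q i by rewrite ww.
apply: (conjugate_polar frp frq c0 cx cy ww) => g sg.
have us := simplex_sq (sg.1 0).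
have [v vs ve] := polar_transfer frp frq c0 cx cy ww' us.
have [y yS yE] := simplex_point vs.
have y3 u w : polar_frame (weights w) (slit_x w) slit_y -> weights w i3 = 0 ->
    simplex u -> (polar (weights w) (slit_x w) slit_y u 0 i2 == 0) = (u i3 == 0).
  move=> fr w3 uS; have [->|uw] := pselect (u = weights w).
    by rewrite (polar_center fr) mxE w3.
  have [_ ly] := slitXY w u.
  have d0 : depth (weights w) u != 0 by rewrite gt_eqF//; have := depth_gt0 fr uS uw.
  have m0 : modulus (slit_x w) slit_y u != 0 by rewrite gt_eqF//; have := modulus_gt0 fr uS uw.
  by rewrite /polar row3E ly !mulf_eq0 (negbTE d0) invr_eq0 (negbTE m0) orbF.
(* the second polar coordinate vanishes exactly on the edge [u3 = 0] *)
have vu3 : (v i3 == 0) = (sq (g 0) i3 == 0).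
  by rewrite -(y3 _ _ frq wq3 vs) ve (y3 _ _ frp wp3 us).
have [g3|g3] := pselect (g 0 0 i3 = 0).
  have sE := stationary_edge Cyclic123 g3 p3.
  have v3 : y 0 i3 = 0.
    apply/eqP; rewrite -sqrf_eq0; have := vu3.
    by rewrite -yE /sq g3 expr0n eqxx => ->.
  exists (fun=> y), id; split.
  - exact: sphere_sol_cst yS (stationary_edge Cyclic123 v3 q3).
  - exact: time_change_id.
  - by move=> t; rewrite (stationary_cst sg sE) yE ve.
have [[k gk]|gp] := pselect (exists k, g 0 0 k = 0).
  have [i [j ijk]] := cyclic3_third k.
  have gk' t : g t 0 k = 0 by exact: sphere_sol_eq0 sg gk t.
  have [pk qk wpk wqk] : [/\ 0 < p k, 0 < q k, 0 < weights p k & 0 < weights q k].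
    by move: gk; clear gk' ijk; move: k; apply: ord3_ind.
  have [eta [tau [se tt e]]] := edge_follow ijk c0 pk qk sg gk'.
  exists eta, tau; split=> // t; rewrite e.
  have ut := simplex_sq (sg.1 t); have uk : sq (g t) k = 0 by rewrite /sq gk' expr0n.
  apply: (polar_rescale c0 ut cx cy); apply: (@gmean_eq0 _ _ _ k) => //.
  by rewrite /rescale uk mulr0 mul0r.
have g0 t i : 0 < g t 0 i.
  have [z|//] := sphere_sol_sign sg i; by case: gp; exists i; rewrite z.
have gw : sq (g 0) <> weights p.
  by move=> h; have := congr1 (fun f => f i3) h; rewrite wp3 => /eqP; rewrite gt_eqF// exprn_gt0.
have v30 : v i3 != 0 by rewrite vu3 gt_eqF// exprn_gt0.
have vw : v <> weights q by move=> h; move: v30; rewrite h wq3 eqxx.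
have dE : depth (weights q) v = depth (weights p) (sq (g 0)).
  by rewrite (depth_polar frq vs vw) (depth_polar frp us gw) ve.
have [eta [se ey _]] := sphere_sol_exists q yS.
have gv : 0 < gmean (weights q) v.
  apply: (depth_eq_gmean_gt0 (slit_simplex pc) (slit_simplex qc) dE).
  by rewrite gmean_sq_exp// expR_gt0.
have v0 i : v i != 0.
  have pos (k : 'I_3) : 0 < weights q k -> v k != 0.
    by move=> wk; apply/eqP => vk; move: gv; rewrite (gmean_eq0 wk vk) ltxx.
  move: i; apply: ord3_ind; [exact: pos|exact: pos|exact: v30].
have y0 i : 0 < y 0 i.
  have /S2pE[yg _] := yS; rewrite lt_def yg andbT.
  by have := v0 i; rewrite -yE sqrf_eq0.
have eta0 t i : 0 < eta t 0 i by apply: (sphere_sol_gt0 se (t := 0)); rewrite ey.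
have [s [s1 s2 sE]] := slope_flow pc sg g0.
have [r [r1 r2 rE]] := slope_flow qc se eta0.
have [sig ts [_ sigK]] := @time_changeK _ true r (conj r1 (onto_range r2)).
exists eta, (sig \o s); split=> //.
  exact: time_change_comp (conj s1 (onto_range s2)) ts.
by move=> t; rewrite /= sE rE sigK ey yE dE.
Qed.

End ParabolicCase.

(** * Invariants of conjugacy *)

Section Invariants.
Variable R : realType.
Implicit Types (p q : 'I_3 -> R) (x A B C : 'rV[R]_3) (g : R -> 'rV[R]_3) (b : bool).

Definition rest p : set 'rV[R]_3 :=
  [set x | S2p x /\ forall i, x 0 i * cross p (sq x) i = 0].

Definition connects p A B := exists g, [/\ sphere_sol p g, g t @[t --> -oo] --> A,
  g t @[t --> +oo] --> B & A <> B].

Lemma time_change_limits b (tau : R -> R) : time_change b tau ->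
  if b then (tau t @[t --> -oo] --> -oo) /\ (tau t @[t --> +oo] --> +oo)
  else (tau t @[t --> -oo] --> +oo) /\ (tau t @[t --> +oo] --> -oo).
Proof.
move=> [m r]; have at_ M : exists s, tau s = M.
  by have [s _ <-] : range tau M by [rewrite r]; exists s.
case: b m => m; split; (apply/cvgrNyPlt || apply/cvgryPgt) => M; have [s <-] := at_ M;
  near=> t; apply: m; near: t; (apply: nbhs_ninfty_lt || apply: nbhs_pinfty_gt); exact: num_real.
Unshelve. all: by end_near.
Qed.

Lemma conjugate_rest b p q h k x : sphere_homeo h k -> carries b p q h ->
  rest p x -> rest q (h x).
Proof.
move=> hh cr [xS xr]; have [eta [tau [se [_ rt] e]]] := cr _ (sphere_sol_cst xS xr).
have etaE s : eta s = h x.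
  by have [t _ <-] : range tau s by [rewrite rt]; rewrite -e.
apply: (limit_stationary se).
by under eq_fun do rewrite etaE; exact: cvg_cst.
Qed.

Lemma conjugate_connects b p q h k A B : sphere_homeo h k -> carries b p q h ->
  connects p A B -> if b then connects q (h A) (h B) else connects q (h B) (h A).
Proof.
move=> [ch _ _ _ [hk _]] cr [g [sg gA gB AB]].
have [AS _] := limit_stationaryNy sg gA; have [BS _] := limit_stationary sg gB.
have hAB : h A <> h B.
  by move=> e; apply: AB; rewrite -[A]hk ?inE// e hk// inE.
have [eta [tau [se tt e]]] := cr g sg.
have [sig ts [_ sigK]] := time_changeK tt.
have etaE s : eta s = h (g (sig s)) by rewrite e sigK.
have lim (F : set_system R) (FF : Filter F) Q : S2p Q -> g t @[t --> F] --> Q ->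
    h (g t) @[t --> F] --> h Q.
  move=> QS gQ V nV; have /subspace_continuousP/(_ _ QS V nV) := ch.
  rewrite /= /within /= !nbhs_simpl /= => /gQ; rewrite /= !nbhs_simpl /=.
  by apply: filterS => t; apply; exact: sg.1.
have hA : h (g t) @[t --> -oo] --> h A by exact: lim.
have hB : h (g t) @[t --> +oo] --> h B by exact: lim.
have comp (F G : set_system R) (Q : 'rV[R]_3) : sig t @[t --> F] --> G ->
    h (g t) @[t --> G] --> Q -> eta t @[t --> F] --> Q.
  by move=> sFG hQ; under eq_fun do rewrite etaE; exact: cvg_comp sFG hQ.
case: b ts {cr tt} => ts; have /= [lN lP] := time_change_limits ts; exists eta.
  by split=> //; [exact: comp _ _ _ lN hA|exact: comp _ _ _ lP hB].
by split=> //; [exact: comp _ _ _ lN hB|exact: comp _ _ _ lP hA|exact: nesym].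
Qed.

Definition has_chain p := exists A B C, connects p A B /\ connects p B C.
Definition has_cycle p := exists A B C,
  [/\ connects p A B, connects p B C & connects p C A].
(** Two orbits with a common start, or a common end, and distinct other ends. *)
Definition has_fork p := exists A B C, B <> C /\
  ((connects p A B /\ connects p A C) \/ (connects p B A /\ connects p C A)).

(** Each property is invariant under the reversal of all the connecting orbits, so that
    the direction of time does not matter. *)
Lemma conjugate_invariants b p q : conjugate b p q ->
  [/\ has_chain p -> has_chain q, has_cycle p -> has_cycle q,
      has_fork p -> has_fork q, infinite_set (rest p) -> infinite_set (rest q) &
      (S2p `<=` rest p -> S2p `<=` rest q)].
Proof.
move=> [[h k] /= hh cr]; have tr := conjugate_connects hh cr.
have AS A B : connects p A B -> S2p A /\ S2p B.
  move=> [g [sg gA gB _]]; split; first by have [] := limit_stationaryNy sg gA.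
  by have [] := limit_stationary sg gB.
have [_ _ _ _ [hk kh]] := hh.
have neq B C : S2p B -> S2p C -> B <> C -> h B <> h C.
  by move=> BS CS BC e; apply: BC; rewrite -[B]hk ?inE// e hk// inE.
split.
- move=> [A [B [C [/tr AB /tr BC]]]]; case: b AB BC {tr cr} => AB BC.
    by exists (h A), (h B), (h C).
  by exists (h C), (h B), (h A).
- move=> [A [B [C [/tr AB /tr BC /tr CA]]]]; case: b AB BC CA {tr cr} => AB BC CA.
    by exists (h A), (h B), (h C).
  by exists (h C), (h B), (h A).
- move=> [A [B [C [BC H]]]].
  have [BS CS] : S2p B /\ S2p C.
    by case: H => [] [/AS[? ?] /AS[? ?]].
  exists (h A), (h B), (h C); split; first exact: neq.
  by case: b tr {cr} => tr; case: H => [] [/tr H1 /tr H2]; [left|right|right|left].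
- move=> inf; apply: contra_not inf => fin.
  apply: sub_finite_set (finite_image k fin) => x xr.
  by exists (h x); [exact: conjugate_rest hh cr xr|rewrite hk// inE; case: xr].
- move=> all y yS; have [_ _ _ kS _] := hh.
  rewrite -[y]kh ?inE//; apply: conjugate_rest hh cr _; apply: all; exact: kS.
Qed.

End Invariants.

(** * Separation of the six portraits *)

Section PortraitInvariants.
Variable R : realType.
Implicit Types (p q : 'I_3 -> R) (x A B C : 'rV[R]_3) (g : R -> 'rV[R]_3) (b : bool).

Lemma edge_connects p i j k : cyclic3 i j k ->
  (0 < p k -> connects p (e_ i) (e_ j)) /\ (p k < 0 -> connects p (e_ j) (e_ i)).
Proof.
move=> c; have [x [xS xk xi xj]] := @open_edge_point R _ _ _ c.
have [ji _ _ _] := cyclic3_neq c.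
have [g [sg gx _]] := sphere_sol_exists p xS.
have gk t : g t 0 k = 0 by apply: (sphere_sol_eq0 sg (t := 0)); rewrite gx.
have gi t : 0 < g t 0 i by apply: (sphere_sol_gt0 sg (t := 0)); rewrite gx.
have gj t : 0 < g t 0 j by apply: (sphere_sol_gt0 sg (t := 0)); rewrite gx.
have [P1 P2] := edge_limit c sg gk gi gj; have [N1 N2] := edge_limitNy c sg gk gi gj.
have ne : e_ i <> e_ j :> 'rV[R]_3 by move=> /e_inj ij; rewrite ij eqxx in ji.
split=> pk; exists g; first by split=> //; [exact: N1|exact: P1].
by split=> //; [exact: N2|exact: P2|exact: nesym].
Qed.

Lemma cst_limit (F : set_system R) {FF : ProperFilter F} g Q x :
  (forall t, g t = x) -> g t @[t --> F] --> Q -> Q = x.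
Proof.
move=> gx gQ; apply: (cvg_unique (@norm_hausdorff _ _) gQ).
rewrite (_ : (fun t => g t) = fun=> x); first exact: cvg_cst.
exact/funext.
Qed.

(** A solution that stops at some time is constant, so the form strictly increases
    along every connecting orbit. *)
Lemma lyapunov p (c : 'I_3 -> R) A B :
  (forall x, S2p x -> 0 <= \sum_i c i * (2 * sq x i * cross p (sq x) i)) ->
  (forall x, S2p x -> \sum_i c i * (2 * sq x i * cross p (sq x) i) = 0 -> rest p x) ->
  connects p A B -> \sum_i c i * sq A i < \sum_i c i * sq B i.
Proof.
move=> l0 l1 [g [sg gA gB AB]].
pose L (x : 'rV[R]_3) := \sum_i c i * sq x i.
pose L' (x : 'rV[R]_3) := \sum_i c i * (2 * sq x i * cross p (sq x) i).
have LE x : L x = c i1 * sq x i1 + c i2 * sq x i2 + c i3 * sq x i3 by rewrite /L sum3.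
have dL (t : R) : is_derive t 1 (fun s => L (g s)) (L' (g t)).
  have ? := sphere_sol_sq sg t i1; have ? := sphere_sol_sq sg t i2.
  have ? := sphere_sol_sq sg t i3.
  rewrite (_ : (fun s => _) = fun s => c i1 * sq (g s) i1 + c i2 * sq (g s) i2 + c i3 * sq (g s) i3).
    by apply: is_derive_eq; rewrite /L' sum3.
  by apply/funext => s; rewrite LE.
have pos t : 0 < L' (g t).
  rewrite lt_def l0 ?andbT; last exact: sg.1.
  apply/eqP => /(l1 _ (sg.1 t))[_ gr].
  have gc s : g s = g t.
    have := stationary_cst (sphere_sol_shift t sg); rewrite add0r => /(_ gr (s - t)).
    by rewrite subrK.
  by apply: AB; rewrite (cst_limit gc gA) (cst_limit gc gB).
have incr := shomo_of_derive dL pos.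
have incr' : {homo (fun s => L (g s)) : s t / s <= t}.
  by move=> s t; rewrite le_eqVlt => /predU1P[->//|/incr/ltW].
have lim (F : set_system R) (FF : ProperFilter F) Q : g t @[t --> F] --> Q ->
    L (g t) @[t --> F] --> L Q.
  move=> gQ; rewrite LE; under eq_fun do rewrite LE.
  have term i : c i * sq (g t) i @[t --> F] --> c i * sq Q i.
    by apply: cvgM; [exact: cvg_cst|exact: sq_cvg].
  by apply: cvgD; [apply: cvgD|]; exact: term.
have LA : L (g t) @[t --> -oo] --> L A by exact: lim.
have LB : L (g t) @[t --> +oo] --> L B by exact: lim.
apply: le_lt_trans (homo_ge_limitNy incr' LA 0) _.
exact: lt_le_trans (incr _ _ ltr01) (homo_le_limit incr' LB 1).
Qed.

Lemma rest_of_products p x : S2p x -> (forall i, x 0 i = 0 \/ cross p (sq x) i = 0) -> rest p x.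
Proof. by move=> xS h; split=> // i; have [->|->] := h i; rewrite ?mul0r ?mulr0. Qed.

Lemma no_cycle p (c : 'I_3 -> R) :
  (forall A B, connects p A B -> \sum_i c i * sq A i < \sum_i c i * sq B i) -> ~ has_cycle p.
Proof.
move=> L [A [B [C [/L AB /L BC /L CA]]]].
by have := lt_trans (lt_trans AB BC) CA; rewrite ltxx.
Qed.

Lemma sum3_eq0 (a b c : R) : 0 <= a -> 0 <= b -> 0 <= c -> a + b + c = 0 ->
  [/\ a = 0, b = 0 & c = 0].
Proof. by move=> a0 b0 c0 s; split; lra. Qed.

Lemma vertex_rest p x i j k : cyclic3 i j k -> S2p x -> x 0 i = 0 -> x 0 j = 0 -> rest p x.
Proof.
move=> c xS xi xj.
rewrite (S2p_eqE (cyclic3_rot c) xS xi xj).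
by split; [exact: S2p_e|move=> l; exact: stationary_e].
Qed.

(** The form [u1 - u3] increases. *)
Lemma no_cycle_ii p : sign_case P_ii p -> ~ has_cycle p.
Proof.
move=> [p3 p2 p1]; apply: (@no_cycle _ (vec3 1 0 (-1))) => A B.
have lE x : \sum_i vec3 1 0 (-1) i * (2 * sq x i * cross p (sq x) i) =
    4 * p i2 * (sq x i1 * sq x i3) + 2 * - p i3 * (sq x i1 * sq x i2) +
    2 * - p i1 * (sq x i2 * sq x i3).
  by rewrite sum3 /cross !vec3E; ring.
have m1 : 0 < 4 * p i2 by rewrite mulr_gt0.
have m2 : 0 < 2 * - p i3 by rewrite mulr_gt0// oppr_gt0.
have m3 : 0 < 2 * - p i1 by rewrite mulr_gt0// oppr_gt0.
have t0 x (a : R) i j : 0 < a -> 0 <= a * (sq x i * sq x j).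
  by move=> a0; rewrite mulr_ge0 ?(ltW a0)// mulr_ge0 ?sqr_ge0.
have z x (a : R) i j : 0 < a -> a * (sq x i * sq x j) = 0 -> x 0 i = 0 \/ x 0 j = 0.
  by move=> a0 /eqP; rewrite mulf_eq0 gt_eqF//= mulf_eq0 /sq !sqrf_eq0 => /orP[/eqP|/eqP]; [left|right].
apply: lyapunov => x xS; rewrite lE; first by rewrite !addr_ge0 ?t0.
move=> s0; have [e13 e12 e23] := sum3_eq0 (t0 _ _ _ _ m1) (t0 _ _ _ _ m2) (t0 _ _ _ _ m3) s0.
have h13 := z _ _ _ _ m1 e13; have h12 := z _ _ _ _ m2 e12; have h23 := z _ _ _ _ m3 e23.
case: h13 => h13; case: h12 => h12; case: h23 => h23;
  first [exact: vertex_rest Cyclic123 xS _ _|exact: vertex_rest Cyclic231 xS _ _|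
      exact: vertex_rest Cyclic312 xS _ _].
Qed.

(** The form [u1 - u2] increases. *)
Lemma no_cycle_iiia p : sign_case P_iiia p -> ~ has_cycle p.
Proof.
move=> [p3 p2 p1]; apply: (@no_cycle _ (vec3 1 (-1) 0)) => A B.
have lE x : \sum_i vec3 1 (-1) 0 i * (2 * sq x i * cross p (sq x) i) =
    2 * p i2 * (sq x i1 * sq x i3) + 2 * p i1 * (sq x i2 * sq x i3) + 0.
  by rewrite sum3 /cross !vec3E p3; ring.
have m1 : 0 < 2 * p i2 by rewrite mulr_gt0.
have m2 : 0 < 2 * p i1 by rewrite mulr_gt0.
have t0 x (a : R) i j : 0 < a -> 0 <= a * (sq x i * sq x j).
  by move=> a0; rewrite mulr_ge0 ?(ltW a0)// mulr_ge0 ?sqr_ge0.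
have z x (a : R) i j : 0 < a -> a * (sq x i * sq x j) = 0 -> x 0 i = 0 \/ x 0 j = 0.
  by move=> a0 /eqP; rewrite mulf_eq0 gt_eqF//= mulf_eq0 /sq !sqrf_eq0 => /orP[/eqP|/eqP]; [left|right].
apply: lyapunov => x xS; rewrite lE; first by rewrite !addr_ge0 ?t0.
move=> s0; have [e13 e23 _] := sum3_eq0 (t0 _ _ _ _ m1) (t0 _ _ _ _ m2) (lexx 0) s0.
have h13 := z _ _ _ _ m1 e13; have h23 := z _ _ _ _ m2 e23.
have edge : x 0 i3 = 0 -> rest p x.
  by move=> x3; split=> // l; exact: stationary_edge Cyclic123 x3 p3 l.
case: h13 => h13; last exact: edge.
by case: h23 => h23; [exact: vertex_rest Cyclic123 xS h13 h23|exact: edge].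
Qed.

(** Every connecting orbit ends at [e_ i2]. *)
Lemma no_chain_iiib p : sign_case P_iiib p -> ~ has_chain p.
Proof.
move=> [p3 p2 p1] [A [B [C [AB BC]]]].
have tgt D E : connects p D E -> E = e_ i2 /\ D <> E.
  move=> [g [sg gD gE DE]]; split=> //.
  have [z|z] := sphere_sol_sign sg i2.
    have gc := stationary_cst sg (stationary_edge Cyclic312 (z 0) p2).
    by case: DE; rewrite (cst_limit gc gD) (cst_limit gc gE).
  exact: (cvg_unique (@norm_hausdorff _ _) gE (limit_iiib p1 p2 p3 sg (z 0))).
have [BE _] := tgt _ _ AB; have [CE BC'] := tgt _ _ BC.
by apply: BC'; rewrite BE CE.
Qed.

(** Connecting orbits keep the first coordinate and run from the edge [x2 = 0] to the edge
    [x3 = 0], so that each end determines the other. *)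
Lemma connects_iv p A B : sign_case P_iv p -> connects p A B ->
  [/\ S2p A, S2p B, B 0 i3 = 0, A 0 i2 = 0 & A 0 i1 = B 0 i1].
Proof.
move=> [p3 p2 p1] [g [sg gA gB AB]].
have [AS _] := limit_stationaryNy sg gA; have [BS _] := limit_stationary sg gB.
have move i j k : cyclic3 i j k -> p k = 0 -> 0 < g 0 0 k.
  move=> c pk; have [z|//] := sphere_sol_sign sg k.
  have gc := stationary_cst sg (stationary_edge c (z 0) pk).
  by case: AB; rewrite (cst_limit gc gA) (cst_limit gc gB).
have [A' [B' [gA' gB' _ [B3 A2 A1 B1]]]] :=
  limits_iv p1 p2 p3 sg (move _ _ _ Cyclic312 p2) (move _ _ _ Cyclic123 p3).
have -> : A = A' by exact: (cvg_unique (@norm_hausdorff _ _) gA gA').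
have -> : B = B' by exact: (cvg_unique (@norm_hausdorff _ _) gB gB').
split=> //; last by rewrite A1 B1.
- by have [] := limit_stationaryNy sg gA'.
- by have [] := limit_stationary sg gB'.
Qed.

Lemma S2p_eq_of_edge k l x y : l != k -> S2p x -> S2p y ->
  x 0 k = 0 -> y 0 k = 0 -> x 0 l = y 0 l -> x = y.
Proof.
move=> lk xS yS xk yk xl; apply: sq_inj => //; apply/funext.
have ek : sq x k = sq y k by rewrite /sq xk yk.
have el : sq x l = sq y l by rewrite /sq xl.
have : \sum_i sq x i = \sum_i sq y i by have /S2pE[_ ->] := xS; have /S2pE[_ ->] := yS.
rewrite !sum3 => s; move: lk ek el {xk yk xl}.
by move: k; apply: ord3_ind; move: l; apply: ord3_ind => //= _ ek el; apply: ord3_ind; move: s; lra.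
Qed.

Lemma no_chain_iv p : sign_case P_iv p -> ~ has_chain p.
Proof.
move=> pc [A [B [C [AB BC]]]].
have [AS BS B3 A2 A1] := connects_iv pc AB; have [_ _ _ B2 _] := connects_iv pc BC.
have [g [_ _ _]] := AB; apply.
exact: (@S2p_eq_of_edge i2 i1 A B).
Qed.

Lemma no_fork_iv p : sign_case P_iv p -> ~ has_fork p.
Proof.
move=> pc [A [B [C [BC [[H1 H2]|[H1 H2]]]]]]; apply: BC;
  have [AS1 BS1 B3 A2 A1] := connects_iv pc H1; have [AS2 BS2 B3' A2' A1'] := connects_iv pc H2.
  by apply: (@S2p_eq_of_edge i3 i1 B C) => //; rewrite -A1 -A1'.
by apply: (@S2p_eq_of_edge i2 i1 B C) => //; rewrite A1 A1'.
Qed.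

Lemma all_rest p : S2p `<=` rest p -> sign_case P_v p.
Proof.
move=> all; have pk i j k : cyclic3 i j k -> p k = 0.
  move=> c; have [x [xS xk xi xj]] := @open_edge_point R _ _ _ c.
  have [_ xr] := all x xS; have [ei _ _] := crossE c p (sq x).
  have := xr i; rewrite ei /sq xk expr0n/= mulr0 sub0r => /eqP.
  by rewrite mulf_eq0 gt_eqF//= oppr_eq0 mulf_eq0 sqrf_eq0 (gt_eqF xj) orbF => /eqP.
by split; [exact: pk Cyclic123|exact: pk Cyclic312|exact: pk Cyclic231].
Qed.

Lemma finite_rest_ii p : sign_case P_ii p -> finite_set (rest p).
Proof.
move=> [p3 p2 p1].
apply: (sub_finite_set _ (finite_image (@e_ R) (finite_finset : finite_set [set: 'I_3]))).
move=> x [xS xr]; have sg := sphere_sol_cst xS xr.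
suff [i lim] : exists i, (fun=> x) t @[t --> (+oo : set_system R)] --> (e_ i : 'rV[R]_3).
  by exists i => //; rewrite (cst_limit (fun=> erefl) lim).
have [[k xk]|xk] := pselect (exists k, x 0 k = 0).
  have [//|[k' [pk _ _]]] := boundary_limit sg (ex_intro _ k xk).
  by move: pk; move: k'; apply: ord3_ind => e; move: p1 p2 p3; rewrite e ltxx.
have x0 i : 0 < x 0 i.
  by have /S2pE[xg _] := xS; rewrite lt_def xg andbT; apply/eqP => xi; apply: xk; exists i.
by exists i1; exact: limit_ii p1 p2 p3 _ sg (x0 i1) (x0 i3).
Qed.

Lemma infinite_rest_iiia p : sign_case P_iiia p -> infinite_set (rest p).
Proof.
move=> [p3 _ _]; apply: (@sub_infinite_set _ (@Gamma R i1 i2)); last exact: Gamma_infinite.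
move=> x /(GammaE x Cyclic123)[xS x3]; split=> // l.
exact: stationary_edge Cyclic123 x3 p3 l.
Qed.

(** In case (v) alone every point is at rest.  Chains separate (i), (ii), (iii.a) from
    (iii.b), (iv); the first three are then told apart by cycles and by the number of
    equilibria, the last two by forks. *)
Lemma portrait_facts (c : portrait) p : sign_case c p ->
  (c <> P_v -> ~ S2p `<=` rest p) /\
  match c with
  | P_i => has_chain p /\ has_cycle p
  | P_ii => has_chain p /\ ~ has_cycle p /\ finite_set (rest p)
  | P_iiia => has_chain p /\ ~ has_cycle p /\ infinite_set (rest p)
  | P_iiib => ~ has_chain p /\ has_fork p
  | P_iv => ~ has_chain p /\ ~ has_fork p
  | P_v => S2p `<=` rest p
  end.
Proof.
move=> cp; split.
  move=> cv /all_rest[p3 p2 p1]; move: cp; case: c cv => //= _;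
  by rewrite ?p1 ?p2 ?p3 ltxx => -[].
have [P12 N12] := edge_connects p Cyclic123; have [P23 N23] := edge_connects p Cyclic231.
have [P31 N31] := edge_connects p Cyclic312.
case: c cp => cp; have [p3 p2 p1] := cp.
- split; exists (e_ i1), (e_ i2), (e_ i3); first by split; [exact: P12|exact: P23].
  by split; [exact: P12|exact: P23|exact: P31].
- split; last by split; [exact: no_cycle_ii|exact: finite_rest_ii].
  by exists (e_ i3), (e_ i2), (e_ i1); split; [exact: N23|exact: N12].
- split; last by split; [exact: no_cycle_iiia|exact: infinite_rest_iiia].
  by exists (e_ i2), (e_ i3), (e_ i1); split; [exact: P23|exact: P31].
- split; first exact: no_chain_iiib.
  exists (e_ i2), (e_ i1), (e_ i3); split; first by move/e_inj.
  by right; split; [exact: P12|exact: N23].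
- by split; [exact: no_chain_iv|exact: no_fork_iv].
move=> x xS; apply: rest_of_products => //; right; move: i; apply: ord3_ind;
by rewrite /cross !vec3E ?p1 ?p2 ?p3; ring.
Qed.

(** Conjugacy is symmetric, so the invariants hold for both flows or for none. *)
Lemma portrait_unique (c c' : portrait) b p q : sign_case c p -> sign_case c' q ->
  conjugate b p q -> c = c'.
Proof.
move=> cp cq pq; have [C1 C2 C3 C4 C5] := conjugate_invariants pq.
have [D1 D2 D3 D4 D5] := conjugate_invariants (conjugate_sym pq).
have [np fp] := portrait_facts cp; have [nq fq] := portrait_facts cq.
move: np fp nq fq C1 C2 C3 C4 C5 D1 D2 D3 D4 D5; clear.
case: c; case: c' => //= np fp nq fq C1 C2 C3 C4 C5 D1 D2 D3 D4 D5; exfalso;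
  try (have {}np : ~ S2p `<=` rest p by exact: np);
  try (have {}nq : ~ S2p `<=` rest q by exact: nq); tauto.
Qed.

Lemma portrait_conjugate (c : portrait) p q : sign_case c p -> sign_case c q ->
  conjugate true p q.
Proof.
have via (r : 'I_3 -> R) : conjugate true p r -> conjugate true q r -> conjugate true p q.
  by move=> pr qr; exact: (conjugate_trans pr (conjugate_sym qr)).
case: c => cp cq; have [p3 p2 p1] := cp; have [q3 q2 q1] := cq.
- by apply: conjugate_centres; apply: ord3_ind.
- exact: via (conjugate_ii cp) (conjugate_ii cq).
- exact: conjugate_iiia.
- exact: via (conjugate_iiib cp) (conjugate_iiib cq).
- apply: (@conjugate_multiple _ _ _ (q i1 / p i1)).
    by rewrite nmulr_rgt0 ?invr_lt0.
  by apply: ord3_ind; rewrite ?p2 ?p3 ?q2 ?q3 ?mulr0// divfK// lt_eqF.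
- apply: (@conjugate_multiple _ _ _ 1) => //.
  by apply: ord3_ind; rewrite ?p1 ?p2 ?p3 ?q1 ?q2 ?q3 mulr0.
Qed.

End PortraitInvariants.

(** * Classification and description of the portraits *)

Theorem theorem2p6 (R : realType) :
  (* the six phase portraits, up to topological equivalence *)
  [/\ forall (alpha : R) (d : 'I_3 -> R), 0 < alpha ->
        exists c d', in_case c alpha d' /\ topologically_equivalent alpha d alpha d',
      forall (alpha : R) (c : portrait), 0 < alpha ->
        exists d, in_case c alpha d
    & forall (alpha alpha' : R) (d d' : 'I_3 -> R) (c c' : portrait),
        0 < alpha -> 0 < alpha' -> in_case c alpha d -> in_case c' alpha' d' ->
        (topologically_equivalent alpha d alpha' d' <-> c = c')] /\
  forall (alpha : R) (d : 'I_3 -> R), 0 < alpha ->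
  (* (i) *)
  (in_case P_i alpha d ->
    [/\ global_attractor alpha d (R3p `\ 0) S2p,
        S2p = \bigcup_(h in [set h | hstar alpha d < h]) Gamma_h alpha d h
              `|` [set Qstar alpha d] `|` bdS2p,
        forall h, hstar alpha d < h ->
          periodic_orbit alpha d (Gamma_h alpha d h),
        IntR3p `&` equilibrium alpha d = [set Qstar alpha d]
      & heteroclinic_polycycle alpha d bdS2p] /\
    [/\ forall h x, hstar alpha d < h -> Lambda1 alpha d h x ->
          omega_limit alpha d x = Gamma_h alpha d h,
        forall x, ray (Qstar alpha d) x ->
          omega_limit alpha d x = [set Qstar alpha d]
      & forall x, (bdR3p `\ 0) x -> exists i, omega_limit alpha d x = [set e_ i]]) /\
  (* (ii) *)
  (in_case P_ii alpha d ->
    [/\ stable_node alpha d (e_ i1), unstable_node alpha d (e_ i3),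
        saddle alpha d (e_ i2)
      & forall gamma, complete_solution alpha d gamma -> range gamma `<=` S2p ->
          gamma t @[t --> -oo] --> (e_ i3 : 'rV[R]_3) ->
          (gamma t @[t --> +oo] --> (e_ i1 : 'rV[R]_3) <->
           ~ range gamma `<=` Gamma i2 i3)] /\
    (forall x, IntR3p x -> omega_limit alpha d x = [set e_ i1]) /\
    (forall x, (bdR3p `\ 0) x -> exists i, omega_limit alpha d x = [set e_ i])) /\
  (* (iii.a) *)
  (in_case P_iiia alpha d ->
    [/\ IntS2p = \bigcup_(G in heteroclinic_orbit_in alpha d IntS2p) G,
        infinite_set (heteroclinic_orbit_in alpha d IntS2p),
        infinite_set (@Gamma R i1 i2) /\ Gamma i1 i2 `<=` equilibrium alpha d
      & equilibrium alpha d (e_ i3) /\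
        bdS2p = Gamma i1 i2 `|` [set e_ i3]
                `|` \bigcup_(G in heteroclinic_orbit_in alpha d bdS2p) G] /\
    (forall x, IntR3p x ->
       exists2 Q, Gamma12p alpha d Q & omega_limit alpha d x = [set Q]) /\
    (forall x, (bdR3p `\ 0) x ->
       omega_limit alpha d x = [set e_ i3] \/
       exists2 Q, Gamma i1 i2 Q & omega_limit alpha d x = [set Q])) /\
  (* (iii.b) *)
  (in_case P_iiib alpha d ->
    [/\ stable_node alpha d (e_ i2)
      & forall x, S2p x -> (goes_to alpha d x (e_ i2) <-> ~ Gamma i1 i3 x)] /\
    (forall x, IntR3p x -> omega_limit alpha d x = [set e_ i2]) /\
    (forall x, (bdR3p `\ 0) x ->
       omega_limit alpha d x = [set e_ i2] \/
       exists2 Q, Gamma i1 i3 Q & omega_limit alpha d x = [set Q])) /\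
  (* (iv) *)
  (in_case P_iv alpha d ->
    [/\ IntS2p = \bigcup_(G in heteroclinic_orbit_in alpha d IntS2p) G,
        infinite_set (@Gamma R i1 i2) /\ Gamma i1 i2 `<=` equilibrium alpha d,
        infinite_set (@Gamma R i1 i3) /\ Gamma i1 i3 `<=` equilibrium alpha d
      & exists2 G, heteroclinic_orbit alpha d (e_ i3) (e_ i2) G &
          bdS2p = Gamma i1 i2 `|` Gamma i1 i3 `|` G] /\
    (forall x, IntR3p x ->
       exists2 Q, Gamma i1 i2 Q & omega_limit alpha d x = [set Q]) /\
    (forall x, (bdR3p `\ 0) x ->
       exists2 Q, (Gamma i1 i2 `|` Gamma i1 i3) Q &
         omega_limit alpha d x = [set Q])) /\
  (* (v) *)
  (in_case P_v alpha d ->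
    S2p `<=` equilibrium alpha d /\
    (forall x, (R3p `\ 0) x ->
       exists2 Q, ray x `&` S2p = [set Q] & omega_limit alpha d x = [set Q])).
Proof.
split; last first.
  move=> alpha d alpha0; split; last split; last split; last split; last split.
  - by move=> [h1 h2 h3]; apply: portrait_i => //; apply: ord3_ind; rewrite !exponentsE.
  - exact: portrait_ii.
  - exact: portrait_iiia.
  - exact: portrait_iiib.
  - exact: portrait_iv.
  - exact: portrait_v.
split=> [alpha d _|alpha c _|alpha alpha' d d' c c' _ _ /in_caseE cp /in_caseE cp'].
- have [c [q [s [cq pq]]]] := classification (exponents alpha d).
  have [d' qE] := exponents_onto alpha q.
  exists c, d'; split; first by apply/in_caseE; rewrite qE.
  by apply/topologically_equivalentP; exists s; rewrite qE.
- have [p cp] : exists p : 'I_3 -> R, sign_case c p.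
    case: c; [exists (vec3 1 1 1)|exists (vec3 (-1) 1 (-1))|exists (vec3 1 1 0)|
      exists (vec3 (-1) 0 1)|exists (vec3 (-1) 0 0)|exists (vec3 0 0 0)];
    by rewrite /= !vec3E ?ltr01 ?ltrN10.
  by have [d pE] := exponents_onto alpha p; exists d; apply/in_caseE; rewrite pE.
split=> [/topologically_equivalentP[b pq]|cc]; first exact: portrait_unique cp cp' pq.
apply/topologically_equivalentP; exists true; rewrite -cc in cp'.
exact: portrait_conjugate cp cp'.
Qed.
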